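(* Let $\mathcal G=(O_i,f_m)_{i\in I,m\in M}$ be a $0$-definable finitely faithful connected groupoid in $\mathbb U$, fix $i\in I$, and let $\mathbb U'$ be the cover of $\mathbb U$ with new sorts $O_*$, $M_*$ constructed from $\mathcal G$ and $i$ as in the context. Let $\mathbb U''$ be the structure induced on $(\mathbb U,O_* )$ by $\mathbb U'$ (the sorts of $\mathbb U$ and $O_*$, with all $0$-definable relations of $\mathbb U'$ on them). Then $\mathbb U''$ is an internal generalised imaginary sort of $\mathbb U$, the groupoid $\mathcal G'$ is $0$-definable in $(\mathbb U'')^{\mathrm{eq}}$, and $\operatorname{Aut}_{\mathcal G'}(O_* )$ together with its action on $O_*$ is isomorphic to $\operatorname{Aut}(\mathbb U''/\mathbb U)$ with its action on $O_*$.
   Context: $T$ is a complete multi-sorted theory with elimination of imaginaries in a language $L$, $\mathbb U$ a monster model; ''definable'' means definable with parameters. A definable groupoid $(O_i,f_m)_{i\in I,m\in M}$: definable $I$, $M$ with surjective definable $M\to I\times I$ ($M(i,j)$ the fibre), definable $O$ with surjective definable $\pi:O\to I$ ($O_i=\pi^{-1}(i)$), definable $f\subseteq M\times O\times O$ with $f_m$ the graph of a bijection $O_i\to O_j$ for $m\in M(i,j)$, distinct $m$ giving distinct bijections, family closed under composition and inverses; $\operatorname{Aut}(O_i)=\{f_m:m\in M(i,i)\}$. Connected: all $M(i,j)\ne\emptyset$. Finitely faithful: each object $O_i$ has a finite tuple whose pointwise stabiliser in $\operatorname{Aut}(O_i)$ is trivial. Construction: $\mathbb U'$ expands $\mathbb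 U$ by sorts $O_*:=O_i\times\{0\}$ and $M_*:=(M(i,i)\times\{0,1,2\})\cup\bigcup_{j\neq i}(M(i,j)\cup M(j,i))\times\{0\}$ and a relation $R$ making elements of $M_*$ bijections: for $m\in M(i,i)$, $(m,0):O_*\to O_*$, $(m,1):O_i\to O_*$, $(m,2):O_*\to O_i$; for $j\ne i$, $(m,0):O_*\to O_j$ for $m\in M(i,j)$ and $(m,0):O_j\to O_*$ for $m\in M(j,i)$; each is $f_m$ under the identification $a\leftrightarrow(a,0)$ of $O_i$ with $O_*$ ($\mathbb U'$ is saturated and $\mathbb U$ is stably embedded in it). $\mathcal G'$ is the connected groupoid with objects $(O_j)_{j\in I}$ together with $O_*$ and morphisms $(f_m)_{m\in M}$ together with the bijections encoded by $M_*$ via $R$. An internal generalised imaginary sort of $\mathbb U$ is an expansion of $\mathbb U$ by exactly one new sort which is saturated, in which $\mathbb U$ is stably embedded (every subset of a product of sorts of $\mathbb U$ definable in the expansion is definable in $\mathbb U$), whose new sort is in definable bijection (with parameters) with a definable set of $\mathbb U$, and whose language $L'$ is finitely generated over $L$ (there is $L'_\circ\subseteq L'$ with $L'_\circ\setminus L$ finite such that every $L'$-formula is equivalent modulo the theory to an $L'_\circ$-formula). $\operatorname{Aut}(\mathbb U''/\mathbb U)$ is the group of automorphisms of $\mathbb U''$ fixing $\mathbb U$ pointwise. *)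

(* Defs.v *)
From mathcomp Require Import all_boot.
From Stdlib Require List.

Set Implicit Arguments.
Unset Strict Implicit.
Unset Printing Implicit Defensive.

Fixpoint tup (S : Type) (A : S -> Type) (w : seq S) : Type :=
  if w is s :: w' then (A s * tup A w')%type else unit.

Fixpoint tcat (S : Type) (A : S -> Type) (w v : seq S) :
    tup A w -> tup A v -> tup A (w ++ v) :=
  match w with
  | [::] => fun _ y => y
  | s :: w' => fun x y => (x.1, tcat x.2 y)
  end.

Fixpoint tfst (S : Type) (A : S -> Type) (w v : seq S) :
    tup A (w ++ v) -> tup A w :=
  match w with
  | [::] => fun _ => tt
  | s :: w' => fun x => (x.1, tfst x.2)
  end.

Fixpoint tsnd (S : Type) (A : S -> Type) (w v : seq S) :
    tup A (w ++ v) -> tup A v :=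
  match w with
  | [::] => fun x => x
  | s :: w' => fun x => tsnd x.2
  end.

Fixpoint tmap (S S' : Type) (A : S -> Type) (B : S' -> Type) (g : S -> S')
    (h : forall s, A s -> B (g s)) (w : seq S) :
    tup A w -> tup B (map g w) :=
  match w with
  | [::] => fun _ => tt
  | s :: w' => fun x => (h s x.1, tmap h x.2)
  end.

Fixpoint tunmap (S S' : Type) (A : S -> Type) (B : S' -> Type) (g : S -> S')
    (h : forall s, B (g s) -> A s) (w : seq S) :
    tup B (map g w) -> tup A w :=
  match w with
  | [::] => fun _ => tt
  | s :: w' => fun x => (h s x.1, tunmap h x.2)
  end.

Fixpoint thom (S : Type) (A B : S -> Type) (h : forall s, A s -> B s)
    (w : seq S) : tup A w -> tup B w :=
  match w with
  | [::] => fun _ => tt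
  | s :: w' => fun x => (h s x.1, thom h x.2)
  end.

Fixpoint tall (S : Type) (A : S -> Type) (P : forall s, A s -> Prop)
    (w : seq S) : tup A w -> Prop :=
  match w with
  | [::] => fun _ => True
  | s :: w' => fun x => P s x.1 /\ tall P x.2
  end.

(* [var w s]: positions in [w] carrying [s] (typed de Bruijn indices). *)
Inductive var (S : Type) : seq S -> S -> Type :=
| vz s w : var (s :: w) s
| vs s w t : var w s -> var (t :: w) s.

Fixpoint tget (S : Type) (A : S -> Type) (w : seq S) (s : S)
    (x : var w s) : tup A w -> A s :=
  match x in var w s return tup A w -> A s with
  | vz s w => fun e => e.1
  | vs s w t y => fun e => tget y e.2
  end.

Record language := Language {
  srt : Type;
  fsym : Type;
  fdom : fsym -> seq srt;
  fcod : fsym -> srt;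
  rsym : Type;
  rar : rsym -> seq srt }.

Inductive term (L : language) (w : seq (srt L)) : srt L -> Type :=
| tvar s : var w s -> term w s
| tapp (f : fsym L) : terms w (fdom f) -> term w (fcod f)
with terms (L : language) (w : seq (srt L)) : seq (srt L) -> Type :=
| tnil : terms w [::]
| tcons s v : term w s -> terms w v -> terms w (s :: v).

Inductive formula (L : language) : seq (srt L) -> Type :=
| ffalse w : formula w
| feq w s : term w s -> term w s -> formula w
| frel w (r : rsym L) : terms w (rar r) -> formula w
| fnot w : formula w -> formula w
| fand w : formula w -> formula w -> formula w
| fex w s : formula (s :: w) -> formula w.

(* Sorts are allowed to be empty. *)
Record structure (L : language) := Structure {
  car :> srt L -> Type;
  fint : forall f : fsym L, tup car (fdom f) -> car (fcod f);
  rint : forall r : rsym L, tup car (rar r) -> Prop }.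

Fixpoint teval (L : language) (U : structure L) (w : seq (srt L))
    (e : tup U w) (s : srt L) (t : term w s) : U s :=
  match t in term _ s return U s with
  | tvar s x => tget x e
  | tapp f ts => @fint L U f (tseval e ts)
  end
with tseval (L : language) (U : structure L) (w : seq (srt L))
    (e : tup U w) (v : seq (srt L)) (ts : terms w v) : tup U v :=
  match ts in terms _ v return tup U v with
  | tnil => tt
  | tcons s v t ts => (teval e t, tseval e ts)
  end.

Fixpoint sat (L : language) (U : structure L) (w : seq (srt L))
    (phi : formula w) : tup U w -> Prop :=
  match phi in formula w return tup U w -> Prop with
  | ffalse _ => fun _ => False
  | feq _ s t u => fun e => teval e t = teval e u
  | frel _ r ts => fun e => @rint L U r (tseval e ts)
  | fnot _ p => fun e => ~ sat p e
  | fand _ p q => fun e => sat p e /\ sat q e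
  | fex _ s p => fun e => exists a : U s, @sat L U (s :: _) p (a, e)
  end.

Fixpoint term_uses (L : language) (F : fsym L -> Prop) (w : seq (srt L))
    (s : srt L) (t : term w s) : Prop :=
  match t with
  | tvar _ _ => True
  | tapp f ts => F f /\ terms_use F ts
  end
with terms_use (L : language) (F : fsym L -> Prop) (w : seq (srt L))
    (v : seq (srt L)) (ts : terms w v) : Prop :=
  match ts with
  | tnil => True
  | tcons _ _ t ts => term_uses F t /\ terms_use F ts
  end.

(* All symbols of the formula belong to the sublanguage [(F, R)]. *)
Fixpoint formula_uses (L : language) (F : fsym L -> Prop) (R : rsym L -> Prop)
    (w : seq (srt L)) (phi : formula w) : Prop :=
  match phi with
  | ffalse _ => True
  | feq _ _ t u => term_uses F t /\ term_uses F u
  | frel _ r ts => R r /\ terms_use F ts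
  | fnot _ p => formula_uses F R p
  | fand _ p q => formula_uses F R p /\ formula_uses F R q
  | fex _ _ p => formula_uses F R p
  end.

Section Definability.
Variables (L : language) (U : structure L).

Definition def0 (w : seq (srt L)) (D : tup U w -> Prop) : Prop :=
  exists phi : formula w, forall x, D x <-> sat phi x.

Definition def0_2 (w1 w2 : seq (srt L))
    (D : tup U w1 -> tup U w2 -> Prop) : Prop :=
  exists phi : formula (w1 ++ w2),
    forall x y, D x y <-> sat phi (tcat x y).

Definition def0_3 (w1 w2 w3 : seq (srt L))
    (D : tup U w1 -> tup U w2 -> tup U w3 -> Prop) : Prop :=
  exists phi : formula (w1 ++ (w2 ++ w3)),
    forall x y z, D x y z <-> sat phi (tcat x (tcat y z)).

Definition definable (w : seq (srt L)) (D : tup U w -> Prop) : Prop :=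
  exists (v : seq (srt L)) (phi : formula (w ++ v)) (b : tup U v),
    forall x, D x <-> sat phi (tcat x b).

Definition definable_2 (w1 w2 : seq (srt L))
    (D : tup U w1 -> tup U w2 -> Prop) : Prop :=
  exists (v : seq (srt L)) (phi : formula (w1 ++ (w2 ++ v))) (b : tup U v),
    forall x y, D x y <-> sat phi (tcat x (tcat y b)).

Definition equiv_formula (w : seq (srt L)) (E : formula (w ++ w)) : Prop :=
  [/\ forall x : tup U w, sat E (tcat x x),
      forall x y : tup U w, sat E (tcat x y) -> sat E (tcat y x)
    & forall x y z : tup U w,
        sat E (tcat x y) -> sat E (tcat y z) -> sat E (tcat x z)].

End Definability.

Definition theory (L : language) := formula (L := L) [::] -> Prop.

Definition models (L : language) (U : structure L) (T : theory L) : Prop :=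
  forall phi, T phi -> sat phi (tt : tup U [::]).

Definition entails (L : language) (T : theory L)
    (phi : formula (L := L) [::]) : Prop :=
  forall A : structure L, models A T -> sat phi (tt : tup A [::]).

Definition complete (L : language) (T : theory L) : Prop :=
  (exists A : structure L, models A T) /\
  forall phi, entails T phi \/ entails T (fnot phi).

(* Every class of a 0-definable equivalence relation is [phi(-, b)] for some
   formula [phi] and exactly one real tuple [b]. *)
Definition elim_imaginaries (L : language) (T : theory L) : Prop :=
  forall A : structure L, models A T ->
  forall (w : seq (srt L)) (E : formula (w ++ w)), equiv_formula A E ->
  forall a : tup A w,
  exists (v : seq (srt L)) (phi : formula (w ++ v)),
  exists! b : tup A v,
    forall x : tup A w, sat E (tcat x a) <-> sat phi (tcat x b).

Section Saturation.
Variables (L : language) (U : structure L).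

Definition total := {s : srt L & U s}.

(* |P| < |U|, by comparability of cardinals. *)
Definition small (P : forall s, U s -> Prop) : Prop :=
  ~ exists f : total -> total,
      injective f /\ forall x, P (projT1 (f x)) (projT2 (f x)).

Record pformula (w : seq (srt L)) := PFormula {
  pf_ar : seq (srt L);
  pf_formula : formula (w ++ pf_ar);
  pf_param : tup U pf_ar }.

Definition psat (w : seq (srt L)) (q : pformula w) (x : tup U w) : Prop :=
  sat (pf_formula q) (tcat x (pf_param q)).

Definition saturated : Prop :=
  forall P : (forall s, U s -> Prop), small P ->
  forall (w : seq (srt L)) (p : pformula w -> Prop),
    (forall q, p q -> tall P (pf_param q)) ->
    (forall l : seq (pformula w), (forall q, List.In q l -> p q) ->
       exists x, forall q, List.In q l -> psat q x) ->
    exists x, forall q, p q -> psat q x.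

End Saturation.

(* A saturated model of cardinality greater than |L|. *)
Definition monster (L : language) (T : theory L) (U : structure L) : Prop :=
  [/\ models U T, saturated U
    & ~ exists f : total U -> {w : seq (srt L) & formula w}, injective f].

Record langext (L : language) := LangExt {
  nsrt : Type;
  nfsym : Type;
  nfdom : nfsym -> seq (srt L + nsrt);
  nfcod : nfsym -> srt L + nsrt;
  nrsym : Type;
  nrar : nrsym -> seq (srt L + nsrt) }.

Definition extlang (L : language) (E : langext L) : language :=
  @Language (srt L + nsrt E)
    (fsym L + nfsym E)
    (fun f => match f with inl f => map inl (fdom f) | inr f => nfdom f end)
    (fun f => match f with inl f => inl (fcod f) | inr f => nfcod f end)
    (rsym L + nrsym E)
    (fun r => match r with inl r => map inl (rar r) | inr r => nrar r end).

Definition extcar (S N : Type) (A : S -> Type) (B : N -> Type) (s : S + N) :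
    Type :=
  match s with inl s => A s | inr n => B n end.

Definition tlift (S N : Type) (A : S -> Type) (B : N -> Type) (w : seq S) :
    tup A w -> tup (extcar A B) (map inl w) :=
  tmap (B := extcar A B) (g := inl) (fun s x => x) (w := w).

Definition tunlift (S N : Type) (A : S -> Type) (B : N -> Type) (w : seq S) :
    tup (extcar A B) (map inl w) -> tup A w :=
  tunmap (B := extcar A B) (g := inl) (fun s x => x) (w := w).

Record expansion (L : language) (U : structure L) (E : langext L) :=
  Expansion {
    ncar : nsrt E -> Type;
    nfint : forall f : nfsym E,
      tup (extcar U ncar) (nfdom f) -> extcar U ncar (nfcod f);
    nrint : forall r : nrsym E, tup (extcar U ncar) (nrar r) -> Prop }.

Definition ext (L : language) (U : structure L) (E : langext L)
    (X : expansion U E) : structure (extlang E) :=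
  @Structure (extlang E) (extcar U (ncar X))
    (fun f => match f with
      | inl f => fun x => @fint L U f (tunlift x)
      | inr f => fun x => @nfint L U E X f x end)
    (fun r => match r with
      | inl r => fun x => @rint L U r (tunlift x)
      | inr r => fun x => @nrint L U E X r x end).

Section InternalGeneralisedImaginarySorts.
Variables (L : language) (U : structure L) (E : langext L)
  (X : expansion U E).

Definition stably_embedded : Prop :=
  forall (w : seq (srt L)) (D : tup U w -> Prop),
    definable (U := ext X) (w := map inl w) (fun x => D (tunlift x)) ->
    definable D.

Definition internal (n : nsrt E) : Prop :=
  exists (w : seq (srt L)) (D : tup U w -> Prop)
    (B : ncar X n -> tup U w -> Prop),
  [/\ definable D,
      definable_2 (U := ext X) (w1 := [:: inr n]) (w2 := map inl w)
        (fun a x => B a.1 (tunlift x)),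
      forall a x, B a x -> D x,
      forall a, exists! x, B a x
    & forall x, D x -> exists! a, B a x].

Definition finite_pred (Y : Type) (P : Y -> Prop) : Prop :=
  exists l : seq Y, forall y, P y -> List.In y l.

(* [(F0, R0)] is the sublanguage L'_o of L'; its part outside L is finite. *)
Definition finitely_generated : Prop :=
  exists (F0 : fsym (extlang E) -> Prop) (R0 : rsym (extlang E) -> Prop),
  [/\ finite_pred (fun f : nfsym E => F0 (inr f)),
      finite_pred (fun r : nrsym E => R0 (inr r))
    & forall (w : seq (srt (extlang E))) (phi : formula w),
      exists2 psi : formula w, formula_uses F0 R0 psi &
        forall x : tup (ext X) w, sat phi x <-> sat psi x].

Definition internal_generalised_imaginary_sort : Prop :=
  exists n : nsrt E,
  (forall n' : nsrt E, n' = n) /\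
  [/\ saturated (ext X), stably_embedded, internal n & finitely_generated].

End InternalGeneralisedImaginarySorts.

Definition automorphism (L : language) (U : structure L)
    (h : forall s, U s -> U s) : Prop :=
  [/\ forall s, bijective (h s),
      forall f (x : tup U (fdom f)), h (fcod f) (fint x) = fint (thom h x)
    & forall r (x : tup U (rar r)), rint (thom h x) <-> rint x].

(* Aut(X/U): the automorphisms of the expansion fixing U pointwise. *)
Definition aut_over (L : language) (U : structure L) (E : langext L)
    (X : expansion U E) (h : forall s, ext X s -> ext X s) : Prop :=
  automorphism h /\ forall (s : srt L) (a : U s), h (inl s) a = a.

(* The structure induced by the expansion [X] on U together with the new sorts
   [g n]: one relation symbol for each 0-formula whose variables range over
   these sorts. *)
Section Induced.
Variables (L : language) (U : structure L) (E : langext L)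
  (X : expansion U E) (N : Type) (g : N -> nsrt E).

Definition ind_srt (s : srt L + N) : srt (extlang E) :=
  match s with inl s => inl s | inr n => inr (g n) end.

Definition ind_incl (s : srt L + N) :
    extcar U (fun n => ncar X (g n)) s -> ext X (ind_srt s) :=
  match s with inl _ => id | inr _ => id end.

Definition ind_lang : langext L :=
  @LangExt L N void (of_void _) (of_void _)
    {w : seq (srt L + N) & formula (L := extlang E) (map ind_srt w)}
    (fun r => projT1 r).

Definition induced : expansion U ind_lang :=
  @Expansion L U ind_lang (fun n => ncar X (g n))
    (fun f => match f with end)
    (fun r x => sat (projT2 r) (tmap ind_incl x)).

End Induced.

Section Eq.
Variables (L : language) (U : structure L).

Definition eq_srt :=
  {w : seq (srt L) & {E : formula (w ++ w) | equiv_formula U E}}.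

Definition eq_rel (e : eq_srt) (x y : tup U (projT1 e)) : Prop :=
  sat (sval (projT2 e)) (tcat x y).

Definition eq_car (e : eq_srt) : Type :=
  {C : tup U (projT1 e) -> Prop | exists a, C = eq_rel a}.

Definition eq_proj (e : eq_srt) (a : tup U (projT1 e)) : eq_car e :=
  exist _ (eq_rel a) (ex_intro _ a erefl).

Definition eq_lang : langext L :=
  @LangExt L eq_srt eq_srt (fun e => map inl (projT1 e)) (fun e => inr e)
    void (of_void _).

Definition eq_expansion : expansion U eq_lang :=
  @Expansion L U eq_lang eq_car
    (fun e x => eq_proj (tunlift x)) (fun r => match r with end).

End Eq.

(* I, M and O are subsets of ambient types; [st] is the graph of M -> I x I,
   [pr] that of O -> I, and [act m] that of f_m. *)
Record gpd (XI XM XO : Type) := Gpd {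
  obj : XI -> Prop;
  mor : XM -> Prop;
  pts : XO -> Prop;
  st : XM -> XI -> XI -> Prop;
  pr : XO -> XI -> Prop;
  act : XM -> XO -> XO -> Prop }.

Section Groupoids.
Variables (XI XM XO : Type) (G : gpd XI XM XO).

Record is_groupoid : Prop := IsGroupoid {
  st_sub : forall m i j, st G m i j -> [/\ mor G m, obj G i & obj G j];
  st_tot : forall m, mor G m -> exists i j, st G m i j;
  st_fun : forall m i j i' j',
    st G m i j -> st G m i' j' -> i = i' /\ j = j';
  st_surj : forall i j, obj G i -> obj G j -> exists m, st G m i j;
  pr_sub : forall a i, pr G a i -> pts G a /\ obj G i;
  pr_tot : forall a, pts G a -> exists i, pr G a i;
  pr_fun : forall a i i', pr G a i -> pr G a i' -> i = i';
  pr_surj : forall i, obj G i -> exists a, pr G a i;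
  act_sub : forall m a b, act G m a b -> [/\ mor G m, pts G a & pts G b];
  act_obj : forall m i j, st G m i j ->
    forall a b, act G m a b -> pr G a i /\ pr G b j;
  act_fun : forall m i j, st G m i j ->
    forall a, pr G a i -> exists! b, act G m a b;
  act_bij : forall m i j, st G m i j ->
    forall b, pr G b j -> exists! a, act G m a b;
  act_inj : forall m m', mor G m -> mor G m' ->
    (forall a b, act G m a b <-> act G m' a b) -> m = m';
  act_comp : forall m n i j k, st G m i j -> st G n j k ->
    exists2 p, st G p i k &
      forall a c, act G p a c <-> exists2 b, act G m a b & act G n b c;
  act_inv : forall m i j, st G m i j ->
    exists2 p, st G p j i & forall a b, act G p b a <-> act G m a b }.

Definition connected : Prop :=
  forall i j, obj G i -> obj G j -> exists m, st G m i j.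

Definition finitely_faithful : Prop :=
  forall i, obj G i ->
  exists l : seq XO,
    (forall a, List.In a l -> pr G a i) /\
    forall m, st G m i i -> (forall a, List.In a l -> act G m a a) ->
      forall a, pr G a i -> act G m a a.

End Groupoids.

Definition def0_gpd (L : language) (U : structure L) (wI wM wO : seq (srt L))
    (G : gpd (tup U wI) (tup U wM) (tup U wO)) : Prop :=
  [/\ def0 (obj G), def0 (mor G) & def0 (pts G)] /\
  [/\ def0_3 (st G), def0_2 (pr G) & def0_3 (act G)].

Definition gpd_image (XI XM XO YI YM YO : Type)
    (cI : XI -> YI) (cM : XM -> YM) (cO : XO -> YO) (G : gpd XI XM XO) :
    gpd YI YM YO :=
  Gpd (fun i' => exists2 i, obj G i & cI i = i')
      (fun m' => exists2 m, mor G m & cM m = m')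
      (fun a' => exists2 a, pts G a & cO a = a')
      (fun m' i' j' => exists m i j,
         [/\ st G m i j, cM m = m', cI i = i' & cI j = j'])
      (fun a' i' => exists a i, [/\ pr G a i, cO a = a' & cI i = i'])
      (fun m' a' b' => exists m a b,
         [/\ act G m a b, cM m = m', cO a = a' & cO b = b']).

Section ExtendedGroupoid.
Variables (XI XM XO : Type) (G : gpd XI XM XO) (i : XI).

Definition Ostar : Type := {a : XO | pr G a i}.

Definition in_Mstar (mk : XM * 'I_3) : Prop :=
  let: (m, k) := mk in
  st G m i i \/
  val k = 0 /\ exists j, j <> i /\ (st G m i j \/ st G m j i).

Definition Mstar : Type := {mk : XM * 'I_3 | in_Mstar mk}.

(* Source and target of an element of M_*; [inr tt] is the index of O_*. *)
Definition star_st (mk : Mstar) (p q : XI + unit) : Prop :=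
  let: (m, k) := sval mk in
  match p, q with
  | inr _, inr _ => st G m i i /\ val k = 0
  | inl j, inr _ => j = i /\ st G m i i /\ val k = 1 \/
                    j <> i /\ st G m j i /\ val k = 0
  | inr _, inl j => j = i /\ st G m i i /\ val k = 2 \/
                    j <> i /\ st G m i j /\ val k = 0
  | inl _, inl _ => False
  end.

Definition star_pr (x : XO + Ostar) (p : XI + unit) : Prop :=
  match x, p with
  | inl a, inl j => pr G a j
  | inr _, inr _ => True
  | _, _ => False
  end.

(* The identification of O_* with O_i. *)
Definition unstar (x : XO + Ostar) : XO :=
  match x with inl a => a | inr a => sval a end.

(* The relation R. *)
Definition star_act (mk : Mstar) (x y : XO + Ostar) : Prop :=
  (exists p q, [/\ star_st mk p q, star_pr x p & star_pr y q]) /\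
  act G (sval mk).1 (unstar x) (unstar y).

Definition gpd_star : gpd (XI + unit) (XM + Mstar) (XO + Ostar) :=
  Gpd (fun p => match p with inl j => obj G j | inr _ => True end)
      (fun m => match m with inl m => mor G m | inr _ => True end)
      (fun x => match x with inl a => pts G a | inr _ => True end)
      (fun m p q => match m, p, q with
         | inl m, inl j, inl k => st G m j k
         | inr m, p, q => star_st m p q
         | _, _, _ => False end)
      star_pr
      (fun m x y => match m, x, y with
         | inl m, inl a, inl b => act G m a b
         | inr m, x, y => star_act m x y
         | _, _, _ => False end).

(* The automorphism group of O_* in G', as a set of permutations of O_* . *)
Definition Aut_star (g : Ostar -> Ostar) : Prop :=
  exists2 m, st gpd_star m (inr tt) (inr tt) &
    forall x y, act gpd_star m (inr x) (inr y) <-> g x = y.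

End ExtendedGroupoid.

Inductive cover_srt := Ost | Mst.

Section Cover.
Variables (L : language) (U : structure L) (wI wM wO : seq (srt L)).
Variables (G : gpd (tup U wI) (tup U wM) (tup U wO)) (i : tup U wI).

Definition cover_car (s : cover_srt) : Type :=
  match s with Ost => Ostar G i | Mst => Mstar G i end.

(* R is a subset of M_* x Y x Y, where Y is the union of O and O_* ; it is given
   by one relation symbol for each choice of O_* ([true]) or O ([false]) in the
   last two places. *)
Definition arO (b : bool) : seq (srt L + cover_srt) :=
  if b then [:: inr Ost] else map inl wO.

Definition cover_lang : langext L :=
  @LangExt L cover_srt void (of_void _) (of_void _)
    (bool * bool) (fun bc => inr Mst :: (arO bc.1 ++ arO bc.2)).

Definition valO (b : bool) :
    tup (extcar U cover_car) (arO b) -> tup U wO + Ostar G i :=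
  match b with
  | true => fun x => inr x.1
  | false => fun x => inl (tunlift x)
  end.

Definition cover : expansion U cover_lang :=
  @Expansion L U cover_lang cover_car
    (fun f => match f with end)
    (fun bc x => star_act x.1 (valO (tfst x.2)) (valO (tsnd x.2))).

(* U'' as an expansion of U by the single sort O_*. *)
Definition cover_ind :
    expansion U (ind_lang (E := cover_lang) (fun _ : unit => Ost)) :=
  induced cover (fun _ : unit => Ost).

Definition cover_ind_eq := ext (eq_expansion (ext cover_ind)).

Definition real_eq (w : seq (srt L)) (x : tup U w) :
    tup cover_ind_eq (map inl (map inl w)) :=
  tlift _ (tlift (ncar cover_ind) x).

Definition def0_code (w : seq (srt L))
    (w' : seq (srt (extlang (eq_lang (ext cover_ind)))))
    (P : tup U w -> Prop) (c : tup U w -> tup cover_ind_eq w') : Prop :=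
  def0_2 (U := cover_ind_eq)
    (fun x y => exists2 a, P a & x = real_eq a /\ y = c a).

(* The sets of indices, morphisms and points of G' are disjoint unions of sets
   from different sorts. G' is 0-definable if, by injections [cI], [cM], [cO]
   into products of sorts, it becomes a 0-definable groupoid; on the parts I, M,
   O and O_* , which already are sets of real tuples, these injections have to
   be 0-definable. *)
Definition star_def0_in_eq : Prop :=
  exists (wI' wM' wO' : seq (srt (extlang (eq_lang (ext cover_ind)))))
    (cI : tup U wI + unit -> tup cover_ind_eq wI')
    (cM : tup U wM + Mstar G i -> tup cover_ind_eq wM')
    (cO : tup U wO + Ostar G i -> tup cover_ind_eq wO'),
  let G' := gpd_star G i in
  [/\ forall p q, obj G' p -> obj G' q -> cI p = cI q -> p = q,
      forall m n, mor G' m -> mor G' n -> cM m = cM n -> m = n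
    & forall x y, pts G' x -> pts G' y -> cO x = cO y -> x = y] /\
  [/\ def0_code (obj G) (fun j => cI (inl j)),
      def0_code (mor G) (fun m => cM (inl m)),
      def0_code (pts G) (fun a => cO (inl a))
    & def0_2 (U := cover_ind_eq) (w1 := [:: inl (inr tt)])
        (fun x y => y = cO (inr x.1))] /\
  def0_gpd (gpd_image cI cM cO G').

(* A group isomorphism from the automorphism group of O_* in G' to Aut(U''/U),
   compatible with the actions on O_* . *)
Definition star_action_iso : Prop :=
  exists Phi : (Ostar G i -> Ostar G i) ->
               (forall s, ext cover_ind s -> ext cover_ind s),
  [/\ forall g, Aut_star g -> aut_over (X := cover_ind) (Phi g),
      forall g h, Aut_star g -> Aut_star h -> Phi g = Phi h -> g = h,
      forall s, aut_over (X := cover_ind) s -> exists2 g, Aut_star g & Phi g = s,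
      forall g h, Aut_star g -> Aut_star h ->
        Phi (g \o h) = (fun s => Phi g s \o Phi h s)
    & forall g, Aut_star g -> forall x : Ostar G i, Phi g (inr tt) x = g x].

End Cover.

(* Main.v *)
(* A morphism of G' between any two objects is determined by its values on a
   finite base, so it is coded by finitely many pairs of points of O and O_* ;
   the single 0-definable relation "these n + 2 pairs are all mapped by one
   morphism of G'" therefore recovers M_* and R as imaginaries of U''.
   Translating formulas through this code shows that this relation generates
   the language of U'' over L (finite generation), that G' lives in (U'')^eq, and
   that the bijection O_* -> O_i is definable from the code of one morphism
   (internality). An automorphism of U'' over U moves that code to the code
   of another morphism O_* -> O_i, hence acts on O_* as a morphism of G';
   conversely every automorphism of O_* in G' acts on morphisms by conjugation
   and preserves the generating relation. Finally, identifying O_* with O_i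
   interprets U'' in U over the parameter i, which gives stable embeddedness and
   saturation; for the latter one needs that a set of parameters and the set
   of its coordinates have the same size, i.e. that X * X embeds into X for
   infinite X.
   Definable sets are handled through families of relations closed under
   boolean operations, quantifiers and renaming of variables, so that
   interpretations act on relations and not on formulas. *)

Require Import Defs.
From mathcomp Require Import all_boot.
From mathcomp Require classical_sets.
From Stdlib Require Import Classical ClassicalEpsilon.
From Stdlib Require Import FunctionalExtensionality PropExtensionality.

Set Implicit Arguments.
Unset Strict Implicit.
Unset Printing Implicit Defensive.

(** * Coordinate maps between tuples and abstract families of definable sets *)

#[global] Arguments tup : simpl never.

(** Three obstacles shape the proof. U'' has no sort of morphisms, so a formula about points alone
    must recognise which tuples are codes: a tuple is a code when the pairs that can be appended to
    it form the graph of a function ([cactP]). This costs one pair beyond the code, and a code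
    itself has n + 1 pairs, at least one, because its first pair fixes the two ends of the morphism;
    hence the number n + 2. Next, a disjoint union such as that of O and [O_*] is no product of
    sorts; its summands are told apart by a tag in a sort with two distinct elements, which exists
    because U has more elements than L has formulas. Last, U'' has one symbol for each 0-formula of
    U', so generation by a single symbol is obtained by interpreting all of U' in U'' with that
    symbol alone ([Dcover_cover]). The sorts built for this purpose also hold the indices, points
    and morphisms of G' and serve again for internality, for the automorphisms and for the
    imaginaries. The first layer of them is built over an arbitrary family, as it is needed a second
    time over U with the parameter i. *)

Section Tuples.
Variables (S : Type) (A : S -> Type).

Lemma tfst_tcat w v (x : tup A w) (y : tup A v) : tfst (tcat x y) = x.
Proof. by elim: w x => [[]|s w IH] //= [a x] /=; rewrite IH. Qed.

Lemma tsnd_tcat w v (x : tup A w) (y : tup A v) : tsnd (tcat x y) = y.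
Proof. by elim: w x => [[]|s w IH] //= [a x] /=; rewrite IH. Qed.

Lemma tcat_fst_snd w v (x : tup A (w ++ v)) : tcat (tfst x) (tsnd x) = x.
Proof. by elim: w x => [|s w IH] //= [a x] /=; rewrite IH. Qed.

Lemma thom_id w (x : tup A w) : thom (fun s a => a) x = x.
Proof. by elim: w x => [[]|s w IH] //= [a x] /=; rewrite IH. Qed.

End Tuples.

Lemma thom_ext S (A B : S -> Type) (h h' : forall s, A s -> B s) w
    (x : tup A w) :
  (forall s a, h s a = h' s a) -> thom h x = thom h' x.
Proof. by move=> e; elim: w x => [|s w IH] //= x; rewrite e IH. Qed.

Lemma thom_comp S (A B C : S -> Type) (h : forall s, A s -> B s)
    (k : forall s, B s -> C s) w (x : tup A w) :
  thom k (thom h x) = thom (fun s a => k s (h s a)) x.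
Proof. by elim: w x => [|s w IH] //= x; rewrite IH. Qed.

Lemma tget_thom S (A B : S -> Type) (h : forall s, A s -> B s) w s
    (y : var w s) (x : tup A w) : tget y (thom h x) = h s (tget y x).
Proof. by elim: y x => //= s0 w0 t y IH x; rewrite IH. Qed.

Lemma thom_tcat S (A B : S -> Type) (h : forall s, A s -> B s) w v
    (x : tup A w) (y : tup A v) :
  thom h (tcat x y) = tcat (thom h x) (thom h y).
Proof. by elim: w x => [|s w IH] //= x; rewrite IH. Qed.

Lemma thom_tfst S (A B : S -> Type) (h : forall s, A s -> B s) w v
    (x : tup A (w ++ v)) : thom h (tfst x) = tfst (thom h x).
Proof. by elim: w x => [|s w IH] //= x; rewrite IH. Qed.

Lemma thom_tsnd S (A B : S -> Type) (h : forall s, A s -> B s) w v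
    (x : tup A (w ++ v)) : thom h (tsnd x) = tsnd (thom h x).
Proof. by elim: w x => [|s w IH] //= x; rewrite IH. Qed.

Lemma tmapK S S' (A : S -> Type) (B : S' -> Type) (g : S -> S')
    (h : forall s, A s -> B (g s)) (k : forall s, B (g s) -> A s) w
    (x : tup A w) :
  (forall s a, k s (h s a) = a) -> tunmap k (tmap h x) = x.
Proof. by move=> e; elim: w x => [[]|s w IH] //= [a x] /=; rewrite e IH. Qed.

Lemma tunmapK S S' (A : S -> Type) (B : S' -> Type) (g : S -> S')
    (h : forall s, A s -> B (g s)) (k : forall s, B (g s) -> A s) w
    (x : tup B (map g w)) :
  (forall s a, h s (k s a) = a) -> tmap h (tunmap k x) = x.
Proof. by move=> e; elim: w x => [[]|s w IH] //= [a x] /=; rewrite e IH. Qed.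

(** The generic point of [w]: it represents the identity as a coordinate map and supplies the
    argument list of an atomic formula. *)
Fixpoint allvars (S : Type) (w : seq S) : tup (var w) w :=
  match w with
  | [::] => tt
  | s :: w' => (vz s w', thom (fun t y => vs s y) (allvars w'))
  end.

Lemma tget_allvars S (A : S -> Type) w (x : tup A w) :
  thom (fun s y => tget y x) (allvars w) = x.
Proof.
elim: w x => [[]|s w IH] //= [a x] /=; congr pair.
by rewrite thom_comp /= IH.
Qed.

(* [G] copies coordinates of its argument, a coordinate of sort [s] of the
   result being read off a coordinate of sort [g s] through [h]. *)
Definition racc (S S0 : Type) (A : S -> Type) (A0 : S0 -> Type)
    (g : S0 -> S) (h : forall s, A (g s) -> A0 s) (v : seq S) (w : seq S0)
    (G : tup A v -> tup A0 w) : Prop :=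
  exists sg : tup (fun s => var v (g s)) w,
    forall x, G x = thom (fun s y => h s (tget y x)) sg.

Definition sacc (S S0 : Type) (A : S -> Type) (A0 : S0 -> Type)
    (g : S0 -> S) (h : forall s, A (g s) -> A0 s) (v : seq S) (s : S0)
    (f : tup A v -> A0 s) : Prop :=
  exists y : var v (g s), forall x, f x = h s (tget y x).

Arguments racc {S S0 A A0} g h {v w} G.
Arguments sacc {S S0 A A0} g h {v s} f.

Notation bacc G := (racc (fun s => s) (fun s a => a) G).
Notation vacc f := (sacc (fun s => s) (fun s a => a) f).

Section Accessors.
Variables (S S0 : Type) (A : S -> Type) (A0 : S0 -> Type).
Variables (g : S0 -> S) (h : forall s, A (g s) -> A0 s).

Lemma racc_nil v (G : tup A v -> tup A0 [::]) : racc g h G.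
Proof. by exists tt => x /=; case: (G x). Qed.

Lemma racc_cons v s w (f : tup A v -> A0 s) (G : tup A v -> tup A0 w) :
  sacc g h f -> racc g h G -> racc g h (w := s :: w) (fun x => (f x, G x)).
Proof. by move=> [y ey] [sg eg]; exists (y, sg) => x /=; rewrite ey eg. Qed.

Lemma sacc_hd v s w (G : tup A v -> tup A0 (s :: w)) :
  racc g h G -> sacc g h (fun x => (G x).1).
Proof. by move=> [[y sg] eg]; exists y => x /=; rewrite eg. Qed.

Lemma racc_tl v s w (G : tup A v -> tup A0 (s :: w)) :
  racc g h G -> racc g h (w := w) (fun x => (G x).2).
Proof. by move=> [[y sg] eg]; exists sg => x /=; rewrite eg. Qed.

Lemma racc_tfst v w w' (G : tup A v -> tup A0 (w ++ w')) :
  racc g h G -> racc g h (fun x => tfst (G x)).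
Proof. by move=> [sg eg]; exists (tfst sg) => x /=; rewrite eg thom_tfst. Qed.

Lemma racc_tsnd v w w' (G : tup A v -> tup A0 (w ++ w')) :
  racc g h G -> racc g h (fun x => tsnd (G x)).
Proof. by move=> [sg eg]; exists (tsnd sg) => x /=; rewrite eg thom_tsnd. Qed.

Lemma racc_tcat v w w' (G : tup A v -> tup A0 w) (G' : tup A v -> tup A0 w') :
  racc g h G -> racc g h G' -> racc g h (fun x => tcat (G x) (G' x)).
Proof.
move=> [sg eg] [sg' eg']; exists (tcat sg sg') => x /=.
by rewrite eg eg' thom_tcat.
Qed.

Lemma racc_comp u v w (G : tup A v -> tup A0 w) (F : tup A u -> tup A v) :
  racc g h G -> bacc F -> racc g h (fun x => G (F x)).
Proof.
move=> [sg eg] [st est].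
exists (thom (fun s y => tget y st) sg) => x; rewrite eg thom_comp.
by apply: thom_ext => s y; rewrite est tget_thom.
Qed.

Lemma sacc_comp u v s (f : tup A v -> A0 s) (F : tup A u -> tup A v) :
  sacc g h f -> bacc F -> sacc g h (fun x => f (F x)).
Proof.
move=> [y ey] [st est]; exists (tget y st) => x.
by rewrite ey est tget_thom.
Qed.

End Accessors.

Lemma racc_id S (A : S -> Type) (w : seq S) : bacc (fun x : tup A w => x).
Proof. by exists (allvars w) => x; rewrite tget_allvars. Qed.

Lemma racc_tunmap S S0 S1 (A : S -> Type) (A0 : S0 -> Type) (A1 : S1 -> Type)
    (g : S0 -> S) (h : forall s, A (g s) -> A0 s)
    (k : S1 -> S0) (h1 : forall s, A0 (k s) -> A1 s) v (w : seq S1)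
    (G : tup A v -> tup A0 (map k w)) :
  racc g h G ->
  racc (fun s => g (k s)) (fun s a => h1 s (h (k s) a))
    (fun x => tunmap h1 (G x)).
Proof.
elim: w G => [|s w IH] G rG; first exact: racc_nil.
apply: racc_cons; last by apply: IH; apply: racc_tl rG.
by have [y ey] := sacc_hd rG; exists y => x; rewrite ey.
Qed.

(** In every use the sorts [g0 s] and [g (k s)] are convertible and [eg] is the identity; keeping
    [eg] as an argument avoids transports. *)
Lemma racc_tmap S S0 S1 (A : S -> Type) (A0 : S0 -> Type) (A1 : S1 -> Type)
    (g : S1 -> S) (h : forall s, A (g s) -> A1 s) (k : S0 -> S1)
    (g0 : S0 -> S) (h0 : forall s, A (g0 s) -> A0 s)
    (h1 : forall s, A0 s -> A1 (k s)) (eg : forall s v, var v (g0 s) -> var v (g (k s)))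
    v (w : seq S0) (G : tup A v -> tup A0 w) :
  (forall s v (y : var v (g0 s)) (x : tup A v),
     h (k s) (tget (eg s v y) x) = h1 s (h0 s (tget y x))) ->
  racc g0 h0 G -> racc g h (fun x => tmap h1 (G x)).
Proof.
move=> eh; elim: w G => [|s w IH] G rG; first exact: racc_nil.
apply: racc_cons; last by apply: IH; apply: racc_tl rG.
by have [y ey] := sacc_hd rG; exists (eg s v y) => x; rewrite eh ey.
Qed.

(* The proof is built from the innermost projection outwards, so that every word
   is known when it is needed. *)
Ltac acc_proof g h G :=
  lazymatch G with
  | (fun x : @tup ?S ?A ?v => x) => constr:(@racc_id S A v)
  | (fun x => @tfst _ _ ?w ?w' (@?F x)) =>
    let p := acc_proof g h F in constr:(racc_tfst (w := w) (w' := w') p)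
  | (fun x => @tsnd _ _ ?w ?w' (@?F x)) =>
    let p := acc_proof g h F in constr:(racc_tsnd (w := w) (w' := w') p)
  | (fun x => tcat (@?F x) (@?F' x)) =>
    let p := acc_proof g h F in
    let p' := acc_proof g h F' in constr:(racc_tcat p p')
  | (fun x => (@?F x).2) => let p := acc_proof g h F in constr:(racc_tl p)
  | (fun x => ?F x) =>
    lazymatch goal with r : racc _ _ F |- _ => constr:(r) end
  | _ => lazymatch goal with r : racc _ _ G |- _ => constr:(r) end
  end.

Ltac acc :=
  lazymatch goal with
  | |- racc _ _ (fun x => tt) => exact: racc_nil
  | |- racc _ _ (fun x => (@?F x, @?F' x)) => apply: racc_cons; acc
  | |- racc _ _ (fun x => tcat (@?F x) (@?F' x)) => apply: racc_tcat; acc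
  | |- @racc _ _ ?A _ ?g ?h ?v _ snd =>
    let p := acc_proof g h (fun x : tup A v => x) in exact (racc_tl p)
  | |- racc ?g ?h (@tfst ?S ?A ?w ?w') =>
    let p := acc_proof g h (fun x : tup A (w ++ w') => tfst x) in exact p
  | |- racc ?g ?h (@tsnd ?S ?A ?w ?w') =>
    let p := acc_proof g h (fun x : tup A (w ++ w') => tsnd x) in exact p
  | |- racc ?g ?h ?G =>
    first [ assumption | let p := acc_proof g h G in exact p | idtac ]
  | |- @sacc _ _ ?A _ ?g ?h ?v _ fst =>
    let p := acc_proof g h (fun x : tup A v => x) in exact (sacc_hd p)
  | |- sacc ?g ?h (fun x => (@?F x).1) =>
    let p := acc_proof g h F in exact (sacc_hd p)
  | |- sacc _ _ _ => try assumption
  end.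

Definition dfam (S : Type) (A : S -> Type) :=
  forall w : seq S, (tup A w -> Prop) -> Prop.

(** Projection is asked for one coordinate at a time and equality only for two variables of one
    sort. Classical negation then yields disjunction and universal quantification, and induction on
    words yields the versions for tuples. *)
Record defsys (S : Type) (A : S -> Type) (Df : dfam A) : Prop := DefSys {
  ds_ext : forall w (D D' : tup A w -> Prop),
    Df w D -> (forall x, D x <-> D' x) -> Df w D';
  ds_false : forall w, Df w (fun _ => False);
  ds_not : forall w (D : tup A w -> Prop), Df w D -> Df w (fun x => ~ D x);
  ds_and : forall w (D D' : tup A w -> Prop),
    Df w D -> Df w D' -> Df w (fun x => D x /\ D' x);
  ds_ex : forall s w (D : A s -> tup A w -> Prop),
    Df (s :: w) (fun x => D x.1 x.2) -> Df w (fun x => exists a, D a x);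
  ds_sub : forall w v (D : tup A w -> Prop) (G : tup A v -> tup A w),
    Df w D -> bacc G -> Df v (fun x => D (G x));
  ds_eq0 : forall s, Df [:: s; s] (fun x => x.1 = x.2.1) }.


Section DefSysTheory.
Variables (S : Type) (A : S -> Type) (Df : dfam A) (H : defsys Df).
Arguments Df : clear implicits.

Lemma ds_true w : Df w (fun _ => True).
Proof. by apply: (ds_ext H) (ds_not H (ds_false H w)) _ => x; tauto. Qed.

Lemma ds_or w (D D' : tup A w -> Prop) :
  Df w D -> Df w D' -> Df w (fun x => D x \/ D' x).
Proof.
move=> d d'; apply: (ds_ext H) (ds_not H (ds_and H (ds_not H d) (ds_not H d'))) _.
by move=> // x; split; [move/not_and_or=> [] /NNPP; tauto | tauto].
Qed.

Lemma ds_imp w (D D' : tup A w -> Prop) :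
  Df w D -> Df w D' -> Df w (fun x => D x -> D' x).
Proof.
move=> d d'; apply: (ds_ext H) (ds_or (ds_not H d) d') _ => // x.
by have := classic (D x); tauto.
Qed.

Lemma ds_iff w (D D' : tup A w -> Prop) :
  Df w D -> Df w D' -> Df w (fun x => D x <-> D' x).
Proof. by move=> d d'; apply: ds_and => //; apply: ds_imp. Qed.

Lemma ds_all s w (D : A s -> tup A w -> Prop) :
  Df (s :: w) (fun x => D x.1 x.2) -> Df w (fun x => forall a, D a x).
Proof.
move=> d; have e := ds_ex H (D := fun a x => ~ D a x) (ds_not H d).
apply: (ds_ext H) (ds_not H e) _ => // x; split=> [n a|n [a]]; last exact.
by apply: NNPP => na; apply: n; exists a.
Qed.

Lemma ds_ext_tup v w (D : tup A v -> tup A w -> Prop) :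
  Df (v ++ w) (fun x => D (tfst x) (tsnd x)) ->
  Df w (fun x => exists y, D y x).
Proof.
elim: v D => [|s v IH] D d.
  apply: (ds_ext H) d _ => // x /=; split; first by exists tt.
  by case=> -[].
have := IH (fun y x => exists a, D (a, y) x); rewrite /=.
move=> /(_ (ds_ex H (D := fun a x => D (a, tfst x) (tsnd x)) d)) e.
apply: (ds_ext H) e _ => // x; split=> [[y [a Dx]]|[[a y] Dx]].
  by exists (a, y).
by exists y, a.
Qed.

Lemma ds_eq v s (f f' : tup A v -> A s) :
  vacc f -> vacc f' -> Df v (fun x => f x = f' x).
Proof.
move=> vf vf'.
apply: (ds_ext H) (ds_sub H (ds_eq0 H s)
  (racc_cons vf (racc_cons vf' (racc_nil _ (fun=> tt))))) _ => // x.
Qed.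

Lemma ds_eq_tup v w (G G' : tup A v -> tup A w) :
  bacc G -> bacc G' -> Df v (fun x => G x = G' x).
Proof.
elim: w G G' => [|s w IH] G G' r r'.
  by apply: (ds_ext H) (ds_true _) _ => // x; case: (G x) (G' x) => [] [].
apply: (ds_ext H) (ds_and H (ds_eq (sacc_hd r) (sacc_hd r'))
  (IH _ _ (racc_tl r) (racc_tl r'))) _ => // x.
by case: (G x) (G' x) => a y [a' y'] /=; split=> [[-> ->]|[-> ->]].
Qed.

End DefSysTheory.

(* Substitution of a coordinate map into a set already known to be definable. The words are read off
   the types; what remains is that the map copies coordinates and that the two descriptions of the
   set agree. *)
Tactic Notation "dsub" constr(H) constr(d) uconstr(G) :=
  let T := type of d in
  lazymatch T with _ ?w _ =>
  lazymatch goal with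
  | |- _ ?v _ =>
    refine (ds_ext H (ds_sub H (w := w) (v := v) (G := G) d _) _);
    [try acc | try by [] ]
  end end.

(** * Definability by formulas *)

Section Renaming.
Variable L : language.

Fixpoint tren (w : seq (srt L)) (s : srt L) (t : term w s) v
    (sg : tup (var v) w) : term v s :=
  match t with
  | tvar s x => tvar (tget x sg)
  | tapp f ts => tapp (tsren ts sg)
  end
with tsren (w u : seq (srt L)) (ts : terms w u) v (sg : tup (var v) w) :
    terms v u :=
  match ts with
  | tnil => tnil v
  | tcons s u t ts => tcons (tren t sg) (tsren ts sg)
  end.

Fixpoint fren (w : seq (srt L)) (phi : formula w) :
    forall v, tup (var v) w -> formula v :=
  match phi in formula w return forall v, tup (var v) w -> formula v with
  | ffalse w => fun v _ => ffalse v
  | feq w s t u => fun v sg => feq (tren t sg) (tren u sg)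
  | Defs.frel w r ts => fun v sg => Defs.frel (tsren ts sg)
  | fnot w p => fun v sg => fnot (fren p sg)
  | fand w p q => fun v sg => fand (fren p sg) (fren q sg)
  | fex w s p => fun v sg =>
      fex (fren p ((vz s v, thom (fun t y => vs s y) sg) : tup _ (s :: w)))
  end.

Scheme term_mind := Induction for term Sort Prop
  with terms_mind := Induction for terms Sort Prop.

Definition term_terms_ind w P Q c1 c2 c3 c4 :=
  conj (@term_mind L w P Q c1 c2 c3 c4) (@terms_mind L w P Q c1 c2 c3 c4).

Variable U : structure L.

Lemma eval_ren w v (sg : tup (var v) w) (x : tup U v) :
  let y := thom (fun s y => tget y x) sg in
  (forall s (t : term w s), teval x (tren t sg) = teval y t) /\
  (forall u (ts : terms w u), tseval x (tsren ts sg) = tseval y ts).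
Proof.
move=> y; apply: term_terms_ind => //=.
- by move=> s z; rewrite tget_thom.
- by move=> f ts ->.
- by move=> s u t -> ts ->.
Qed.

Lemma sat_fren w (phi : formula w) v (sg : tup (var v) w) (x : tup U v) :
  sat (fren phi sg) x <-> sat phi (thom (fun s y => tget y x) sg).
Proof.
elim: phi v sg x => {w} /=.
- by [].
- by move=> w s t u v sg x; have [-> _] := eval_ren sg x; rewrite (eval_ren sg x).1.
- by move=> w r ts v sg x; rewrite (eval_ren sg x).2.
- by move=> w p IH v sg x; rewrite IH.
- by move=> w p IH q IH' v sg x; rewrite IH IH'.
- move=> w s p IH v sg x; split=> -[a sa]; exists a.
    by move/IH: sa; rewrite /= thom_comp.
  by apply/IH; rewrite /= thom_comp.
Qed.

Variables (F : Defs.fsym L -> Prop) (R : rsym L -> Prop).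

Lemma uses_ren w v (sg : tup (var v) w) :
  (forall s (t : term w s), term_uses F t -> term_uses F (tren t sg)) /\
  (forall u (ts : terms w u), terms_use F ts -> terms_use F (tsren ts sg)).
Proof.
apply: term_terms_ind => //=.
- by move=> f ts IH [Ff /IH].
- by move=> s u t IH ts IH' [/IH ? /IH'].
Qed.

Lemma uses_fren w (phi : formula w) v (sg : tup (var v) w) :
  formula_uses F R phi -> formula_uses F R (fren phi sg).
Proof.
elim: phi v sg => {w} //=.
- by move=> w s t u v sg [ut uu]; split; apply: (uses_ren sg).1.
- by move=> w r ts v sg [Rr us]; split=> //; apply: (uses_ren sg).2.
- by move=> w p IH q IH' v sg [/IH ? /IH'].
- by move=> w s p IH v sg up; apply: IH.
Qed.

Definition Dform : dfam U := fun w D =>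
  exists2 phi : formula w, formula_uses F R phi & forall x, D x <-> sat phi x.

Lemma Dform_defsys : defsys Dform.
Proof.
split.
- by move=> w D D' [phi u e] e'; exists phi => // x; rewrite -e'.
- by move=> w; exists (ffalse w).
- by move=> w D [phi u e]; exists (fnot phi) => //= x; rewrite e.
- move=> w D D' [phi u e] [phi' u' e']; exists (fand phi phi') => //= x.
  by rewrite e e'.
- move=> s w D [phi u e]; exists (fex phi) => //= x.
  by split=> -[a Da]; exists a; apply/(e (a, x)).
- move=> w v D G [phi u e] [sg eg]; exists (fren phi sg); first exact: uses_fren.
  by move=> x; rewrite eg e sat_fren.
- move=> s.
  by exists (feq (tvar (vz s [:: s])) (tvar (vs s (vz s [::])))).
Qed.

Fixpoint tsvar v (w : seq (srt L)) : tup (var v) w -> terms v w :=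
  match w with
  | [::] => fun _ => tnil v
  | s :: w' => fun sg => tcons (tvar sg.1) (tsvar sg.2)
  end.

Lemma tseval_tsvar v (w : seq (srt L)) (sg : tup (var v) w) (x : tup U v) :
  tseval x (tsvar sg) = thom (fun s y => tget y x) sg.
Proof. by elim: w sg => //= s w IH sg; rewrite IH. Qed.

Lemma uses_tsvar v (w : seq (srt L)) (sg : tup (var v) w) :
  terms_use F (tsvar sg).
Proof. by elim: w sg => //= s w IH sg. Qed.

Lemma Dform_rel r : R r -> Dform (@rint L U r).
Proof.
move=> Rr; exists (Defs.frel (tsvar (allvars (rar r)))).
  by split=> //; apply: uses_tsvar.
by move=> x /=; rewrite tseval_tsvar tget_allvars.
Qed.

Lemma Dform_fun f : F f ->
  Dform (w := fcod f :: fdom f) (fun x => x.1 = fint x.2).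
Proof.
move=> Ff.
exists (feq (tvar (vz (fcod f) (fdom f)))
            (tapp (tsvar (thom (fun s y => vs _ y) (allvars (fdom f)))))).
  by do 2!split=> //; apply: uses_tsvar.
by case=> a x /=; rewrite tseval_tsvar thom_comp tget_allvars.
Qed.

Variables (Df : dfam U) (H : defsys Df).
Hypothesis Df_rel : forall r, R r -> Df (@rint L U r).
Hypothesis Df_fun : forall f, F f ->
  Df (w := fcod f :: fdom f) (fun x => x.1 = fint x.2).

(** Only graphs of function symbols are known to be definable, so a nested term is handled by
    quantifying over the values of its arguments. *)
Lemma Df_eval w :
  (forall s (t : term w s), term_uses F t ->
     Df (w := s :: w) (fun x => x.1 = teval x.2 t)) /\
  (forall u (ts : terms w u), terms_use F ts ->
     Df (w := u ++ w) (fun x => tfst x = tseval (tsnd x) ts)).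
Proof.
apply: term_terms_ind => /=.
- move=> s y _; apply: (ds_eq H); first by acc.
  by exists (vs s y).
- move=> f ts IH [Ff uts].
  apply: (ds_ext H) (ds_ext_tup H (v := fdom f) (w := fcod f :: w)
    (D := fun y x => y = tseval x.2 ts /\ x.1 = fint y) _) _ => [|x].
    apply: (ds_and H).
      apply: (ds_ext H)
        (ds_sub H (v := fdom f ++ (fcod f :: w))
           (G := fun x => tcat (tfst x) (tsnd x).2) (IH uts) _) _; first by acc.
      by move=> x; rewrite tfst_tcat tsnd_tcat.
    by dsub H (Df_fun Ff) (fun x => ((tsnd x).1, tfst x)).
  by split=> [[y [-> //]]|e]; exists (tseval x.2 ts).
- by move=> _; apply: (ds_ext H) (ds_true H w) _.
- move=> s u t IH ts IH' [ut uts].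
  have d1 : Df (w := s :: u ++ w) (fun x => x.1 = teval (tsnd x.2) t).
    by dsub H (IH ut) (fun x => (x.1, tsnd x.2)).
  have d2 : Df (w := s :: u ++ w) (fun x => tfst x.2 = tseval (tsnd x.2) ts).
    by dsub H (IH' uts) (fun x => x.2).
  apply: (ds_ext H) (ds_and H d1 d2) _.
  by case=> a x /=; split=> [[-> ->]|[-> ->]].
Qed.

(** The universal property of formulas: [Dform] is the least family containing the basic relations
    and the graphs of the functions. Every transfer below, along an interpretation, a change of
    sorts or an automorphism, is this lemma for a suitable [Df]. *)
Lemma sat_in w (phi : formula w) : formula_uses F R phi -> Df (sat (U := U) phi).
Proof.
elim: phi => {w} /=.
- by move=> w _; apply: (ds_false H).
- move=> w s t u [ut uu].
  apply: (ds_ext H) (ds_ex H (s := s) (D := fun a x => a = teval x t /\ a = teval x u) _) _.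
    by apply: (ds_and H); [exact: (Df_eval w).1 | exact: (Df_eval w).1].
  by move=> x; split=> [[a [<- //]]|e]; exists (teval x t).
- move=> w r ts [Rr uts].
  apply: (ds_ext H) (ds_ext_tup H (D := fun y x => y = tseval x ts /\ rint y) _) _.
    apply: (ds_and H); first exact: (Df_eval w).2.
    by apply: (ds_sub H (Df_rel Rr)); acc.
  by move=> x; split=> [[y [-> //]]|e]; exists (tseval x ts).
- by move=> w p IH u; apply: (ds_not H); apply: IH.
- by move=> w p IH q IH' [u u']; apply: (ds_and H); [apply: IH | apply: IH'].
- move=> w s p IH u; apply: (ds_ex H (D := fun a x => sat p ((a, x) : tup U (s :: w)))).
  by apply: (ds_ext H) (IH u) _ => -[].
Qed.

End Renaming.

(** * New families from old ones: fixed parameters, part of the sorts, invariance *)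

Section WithParams.
Variables (S : Type) (A : S -> Type) (Df : dfam A) (H : defsys Df).
Variables (v : seq S) (p : tup A v).

(** The parameter tuple is fixed once for the whole family, so intersections need no merging of
    parameters. The tuple used later is the object [i]. *)
Definition Dparam : dfam A := fun w D =>
  exists2 D0 : tup A (w ++ v) -> Prop, Df D0 & forall x, D x <-> D0 (tcat x p).

Lemma Dparam_defsys : defsys Dparam.
Proof.
split.
- by move=> w D D' [D0 d e] e'; exists D0 => // x; rewrite -e'.
- by move=> w; exists (fun=> False) => //; apply: (ds_false H).
- by move=> w D [D0 d e]; exists (fun x => ~ D0 x) => [|x];
    [apply: (ds_not H) | rewrite e].
- move=> w D D' [D0 d e] [D0' d' e']; exists (fun x => D0 x /\ D0' x) => [|x].
    exact: (ds_and H).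
  by rewrite e e'.
- move=> s w D [D0 d e]; exists (fun x => exists a, D0 (a, x)).
    by apply: (ds_ex H (D := fun a x => D0 (a, x))); apply: (ds_ext H) d _ => -[].
  by move=> x; split=> -[a Da]; exists a; apply/(e (a, x)).
- move=> w u D G [D0 d e] rG.
  exists (fun x => D0 (tcat (G (tfst x)) (tsnd x))).
    apply: (ds_sub H (G := fun x => tcat (G (tfst x)) (tsnd x))) => //; acc.
    by apply: (racc_comp rG); acc.
  by move=> x; rewrite tfst_tcat tsnd_tcat e.
- move=> s; exists (fun x => x.1 = x.2.1) => [|[a [b []]]] //=.
  by apply: (ds_eq H); acc.
Qed.

Lemma Dparam_sub w (D : tup A w -> Prop) : Df D -> Dparam D.
Proof.
move=> d; exists (fun x => D (tfst x)) => [|x]; last by rewrite tfst_tcat.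
by apply: (ds_sub H d); acc.
Qed.

Lemma Dparam_in w (D : tup A w -> tup A v -> Prop) :
  Df (fun x => D (tfst x) (tsnd x)) -> Dparam (fun x => D x p).
Proof.
by move=> d; exists (fun x => D (tfst x) (tsnd x)) => // x;
  rewrite tfst_tcat tsnd_tcat.
Qed.

End WithParams.

Section Reindex.
Variables (S S0 : Type) (A : S -> Type) (A0 : S0 -> Type) (Df : dfam A).
Hypothesis H : defsys Df.
Variables (g : S0 -> S) (h : forall s, A (g s) -> A0 s).
Variable k : forall s, A0 s -> A (g s).
Hypotheses (hk : forall s a, h (@k s a) = a) (kh : forall s a, k (@h s a) = a).

(** The family seen on a structure whose sorts are some of the sorts of [A]. In the uses [h] and [k]
    are identities; they only separate the two indexings of the same carriers. *)
Definition Dreindex : dfam A0 := fun w D => Df (fun y => D (tunmap h (w := w) y)).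

Lemma racc_tunmap0 w : racc g h (tunmap h (w := w)).
Proof.
exact: (@racc_tunmap _ _ _ A A A0 (fun s => s) (fun s a => a) g h _ w
  (fun x => x) (racc_id _ _)).
Qed.

Lemma racc_tmap_bacc v w (G : tup A v -> tup A0 w) :
  racc g h G -> bacc (fun x => tmap k (G x)).
Proof.
by apply: (racc_tmap (h := fun s a => a) (eg := fun _ _ y => y)) => s u y x.
Qed.

Lemma Dreindex_out v w (D : tup A0 w -> Prop) (G : tup A v -> tup A0 w) :
  Dreindex D -> racc g h G -> Df (fun x => D (G x)).
Proof.
move=> d rG; apply: (ds_ext H) (ds_sub H d (racc_tmap_bacc rG)) _ => x.
by rewrite tmapK.
Qed.

Lemma Dreindex_defsys : defsys Dreindex.
Proof.
split.
- by move=> w D D' d e; apply: (ds_ext H) d _ => x; rewrite e.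
- by move=> w; apply: (ds_false H).
- by move=> w D d; apply: (ds_not H).
- by move=> w D D' d d'; apply: (ds_and H).
- move=> s w D d.
  apply: (ds_ext H) (ds_ex H (D := fun a x => D (h a) (tunmap h x)) d) _ => x.
  by split=> -[a Da]; [exists (h a) | exists (k a); rewrite hk].
- move=> w v D G d [sg eg].
  apply: (Dreindex_out (G := fun x => G (tunmap h x)) d).
  have [rh erh] := racc_tunmap0 v.
  exists (thom (fun s y => tget y rh) sg) => x.
  rewrite eg thom_comp; apply: thom_ext => s y.
  by rewrite erh tget_thom.
- move=> s; apply: (ds_ext H) (ds_eq0 H (g s)) _ => -[a [b []]] /=.
  by split=> [->|e] //; rewrite -(kh a) e kh.
Qed.

End Reindex.

Section Invariance.
Variables (S : Type) (A : S -> Type) (h : forall s, A s -> A s).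
Variable k : forall s, A s -> A s.
Hypotheses (hk : forall s a, h (@k s a) = a) (kh : forall s a, k (@h s a) = a).

(** As a family of sets, invariance turns the preservation of all formulas by an automorphism into
    an instance of [sat_in]. The inverse [k] serves the quantifier and equality. *)
Definition Dinv : dfam A := fun w D => forall x, D (thom h x) <-> D x.

Lemma Dinv_defsys : defsys Dinv.
Proof.
split=> //.
- by move=> w D D' d e x; rewrite -!e.
- by move=> w D d x; rewrite d.
- by move=> w D D' d d' x; rewrite d d'.
- move=> s w D d x; split=> -[a Da].
    by exists (k a); apply/(d (k a, x)); rewrite /= hk.
  by exists (h a); apply/(d (a, x)).
- move=> w v D G d [sg eg] x; rewrite !eg.
  rewrite -(d (thom (fun s y => tget y x) sg)) thom_comp.
  suff -> : thom (fun s y => tget y (thom h x)) sg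
          = thom (fun s y => h (tget y x)) sg by [].
  by apply: thom_ext => s y; rewrite tget_thom.
- move=> s [a [b []]] /=; split=> [e|-> //].
  by rewrite -(kh a) e kh.
Qed.

End Invariance.

(** * Interpretations *)

Section Pull.
Variables (S : Type) (A : S -> Type).
Variables (Sg : Type) (B : Sg -> Type) (cw : Sg -> seq S).
(* [cr s] is the graph of a partial surjection, presenting the elements of [B s]
   by tuples. *)
Variable cr : forall s, tup A (cw s) -> B s -> Prop.

Fixpoint flat (w : seq Sg) : seq S :=
  if w is s :: w' then cw s ++ flat w' else [::].

Fixpoint crs (w : seq Sg) : tup A (flat w) -> tup B w -> Prop :=
  match w with
  | [::] => fun _ _ => True
  | s :: w' => fun x e => cr (tfst x) e.1 /\ crs (tsnd x) e.2
  end.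

Definition Dpull (Df : dfam A) : dfam B := fun w D =>
  Df (flat w) (fun x => exists2 e, crs x e & D e).

Fixpoint flatget v s (y : var v s) : tup A (flat v) -> tup A (cw s) :=
  match y in var v s return tup A (flat v) -> tup A (cw s) with
  | vz s w => fun x => tfst x
  | vs s w t y => fun x => flatget y (tsnd x)
  end.

Fixpoint flatren v w : tup (var v) w -> tup A (flat v) -> tup A (flat w) :=
  match w with
  | [::] => fun _ _ => tt
  | s :: w' => fun sg x => tcat (flatget sg.1 x) (flatren sg.2 x)
  end.

(** The words [flat (w ++ v)] and [flat w ++ flat v] are equal but not convertible; moving the
    coordinates avoids a transport along that equality. *)
Fixpoint flatcat w v : tup A (flat w) -> tup A (flat v) -> tup A (flat (w ++ v)) :=
  match w with
  | [::] => fun _ y => y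
  | s :: w' => fun x y => tcat (tfst x) (flatcat (tsnd x) y)
  end.

Lemma racc_flatget v s (y : var v s) : bacc (flatget y).
Proof.
elim: y => {v s} [s w|s w t y IH] /=; first by acc.
by apply: (racc_comp IH); acc.
Qed.

Lemma racc_flatren v w (sg : tup (var v) w) : bacc (flatren sg).
Proof.
elim: w sg => [|s w IH] sg /=; first exact: racc_nil.
by acc; [apply: racc_flatget | apply: IH].
Qed.

Lemma racc_flatcat u w v (F : tup A u -> tup A (flat w)) (G : tup A u -> tup A (flat v)) :
  bacc F -> bacc G -> bacc (fun x => flatcat (F x) (G x)).
Proof.
elim: w F => [|s w IH] F rF rG //=; acc.
by apply: (IH (fun x => tsnd (F x))) => //; acc.
Qed.

Lemma crs_get v s (y : var v s) x e : crs x e -> cr (flatget y x) (tget y e).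
Proof. by elim: y x e => {v s} [s w|s w t y IH] x e /= [] // _ /IH. Qed.

Lemma crs_ren v w (sg : tup (var v) w) x e : crs x e ->
  crs (flatren sg x) (thom (fun s y => tget y e) sg).
Proof.
move=> c; elim: w sg => [|s w IH] sg //=.
by rewrite tfst_tcat tsnd_tcat; split; [apply: crs_get | apply: IH].
Qed.

Lemma crs_cat w v (x : tup A (flat w)) (y : tup A (flat v)) e :
  crs (flatcat x y) e <-> crs x (tfst e) /\ crs y (tsnd e).
Proof.
elim: w x e => [|s w IH] x e /=; first by tauto.
by rewrite tfst_tcat tsnd_tcat IH; tauto.
Qed.

Hypothesis cfun : forall s x b b', @cr s x b -> cr x b' -> b = b'.
Hypothesis csurj : forall s b, exists x, @cr s x b.

Lemma crs_fun w x e e' : @crs w x e -> crs x e' -> e = e'.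
Proof.
elim: w x e e' => [|s w IH] x; first by move=> [] [].
move=> [b e] [b' e'] /= [c cs] [c' cs'].
by rewrite (cfun c c') (IH _ _ _ cs cs').
Qed.

Lemma crs_surj w e : exists x, @crs w x e.
Proof.
elim: w e => [|s w IH] e; first by exists tt.
have [x cx] := csurj e.1; have [y cy] := IH e.2.
by exists (tcat x y); rewrite /= tfst_tcat tsnd_tcat.
Qed.

Variables (Df : dfam A) (H : defsys Df).
Arguments Df : clear implicits.
Hypothesis cker : forall s, Df (cw s ++ cw s)
  (fun x => exists2 b, cr (tfst x) b & cr (tsnd x) b).

Lemma Df_dom w : Df (flat w) (fun x => exists e, crs x e).
Proof.
elim: w => [|s w IH] /=.
  by apply: (ds_ext H) (ds_true H _) _ => x; split=> // _; exists tt.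
have d1 : Df (cw s ++ flat w) (fun x => exists2 b, cr (tfst x) b & cr (tfst x) b).
  dsub H (cker s) (fun x => tcat (tfst x) (tfst x)).
  by move=> x; rewrite tfst_tcat tsnd_tcat.
have d2 : Df (cw s ++ flat w) (fun x => exists e, crs (tsnd x) e).
  by dsub H IH (fun x => tsnd x).
apply: (ds_ext H) (ds_and H d1 d2) _ => x; split.
  by move=> [[b c _] [e ce]]; exists (b, e).
by move=> [[b e] [c ce]]; split; [exists b | exists e].
Qed.

Lemma Df_and_dom w w' (D : tup A w' -> Prop) (D' : tup B w -> Prop)
    (G : tup A (flat w) -> tup A w') :
  Df w' D -> bacc G -> (forall x e, crs x e -> (D (G x) <-> D' e)) ->
  Df (flat w) (fun x => exists2 e, crs x e & D' e).
Proof.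
move=> d rG eD.
apply: (ds_ext H) (ds_and H (Df_dom w) (ds_sub H d rG)) _ => x; split.
  by move=> [[e c] Dx]; exists e => //; apply/(eD x).
by move=> [e c Dx]; split; [exists e | apply/(eD x e)].
Qed.

(** Definability of the kernel of [cr] is the only input about definability: on the diagonal it is
    the domain of [cr], within which complements have to be taken, and it interprets equality.
    Surjectivity of [cr] is what makes a quantifier over elements a quantifier over codes. *)
Lemma Dpull_defsys : defsys (Dpull Df).
Proof.
split.
- move=> w D D' d e; apply: (ds_ext H) d _ => x.
  by split=> -[y c Dy]; exists y => //; apply/e.
- by move=> w; apply: (ds_ext H) (ds_false H _) _ => x; split=> // -[].
- move=> w D d; apply: (Df_and_dom (ds_not H d) (racc_id _ _)) => x e c.
  by split=> [n Dx|n [e' c' Dx]]; apply: n; [exists e | rewrite (crs_fun c c')].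
- move=> w D D' d d'.
  apply: (Df_and_dom (ds_and H d d') (racc_id _ _)) => x e c; split.
    by move=> [[e1 c1 D1] [e2 c2 DQ]]; rewrite {1}(crs_fun c c1) (crs_fun c c2).
  by move=> [Dx Dx']; split; exists e.
- move=> s w D d.
  have /= e := @ds_ext_tup _ _ _ H (cw s) (flat w)
    (fun y x => exists2 e : tup B (s :: w), cr y e.1 /\ crs x e.2 & D e.1 e.2) d.
  apply: (ds_ext H) e _ => x; split.
    by move=> [y [[b e] [/= c cs] Dx]]; exists e => //; exists b.
  move=> [e c [b Dx]]; have [y cy] := csurj b.
  by exists y, (b, e).
- move=> w v D G d [sg eG].
  apply: (Df_and_dom d (racc_flatren sg)) => x e c; rewrite eG.
  have c' := crs_ren sg c; split; last by exists (thom (fun s y => tget y e) sg).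
  by move=> [e' c'' De]; rewrite (crs_fun c' c'').
- move=> s; rewrite /Dpull /=; dsub H (cker s) (fun x => tcat (tfst x) (tfst (tsnd x))).
  move=> x; rewrite tfst_tcat tsnd_tcat; split.
    by move=> [b c c']; exists (b, (b, tt)).
  by move=> [[b [b' []]] /= [c [c' _]] e]; exists b => //; rewrite e.
Qed.

Section Base.
Variables (kb : S -> Sg) (h : forall s, B (kb s) -> A s).
Variable o : forall s, tup A (cw (kb s)) -> A s.
Hypothesis ro : forall s, vacc (@o s).
Hypothesis cro : forall s x b, cr x b -> @o s x = h b.

Fixpoint flatbase v w : tup (fun s => var v (kb s)) w -> tup A (flat v) -> tup A w :=
  match w with
  | [::] => fun _ _ => tt
  | s :: w' => fun sg x => (o (flatget sg.1 x), flatbase sg.2 x)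
  end.

Lemma racc_flatbase v w (sg : tup (fun s => var v (kb s)) w) : bacc (flatbase sg).
Proof.
elim: w sg => [|s w IH] sg /=; first exact: racc_nil.
acc; last exact: IH.
by apply: (sacc_comp (ro s)); apply: racc_flatget.
Qed.

Lemma crs_base v w (sg : tup (fun s => var v (kb s)) w) x e : crs x e ->
  flatbase sg x = thom (fun s y => h (tget y e)) sg.
Proof.
move=> c; elim: w sg => [|s w IH] sg //=.
by rewrite IH (cro (crs_get _ c)).
Qed.

(** Allows relations that mix raw coordinates of the interpreting structure with interpreted
    elements. The raw ones sit in sorts [kb s], where [o] reads the element off any of its codes. *)
Lemma Dpull_in v w w' (D : tup A w -> tup B w' -> Prop)
    (G : tup B v -> tup A w) (F : tup B v -> tup B w') :
  Df (w ++ flat w') (fun x => exists2 e, crs (tsnd x) e & D (tfst x) e) ->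
  racc kb h G -> bacc F -> Dpull Df (fun e => D (G e) (F e)).
Proof.
move=> d [sg eG] [st eF].
apply: (Df_and_dom (G := fun x => tcat (flatbase sg x) (flatren st x)) d).
  by acc; [apply: racc_flatbase | apply: racc_flatren].
move=> x e c; rewrite tfst_tcat tsnd_tcat (crs_base _ c) -eG.
have c' := crs_ren st c; rewrite -eF in c'.
by split=> [[e' c'' De]|De]; [rewrite (crs_fun c' c'') | exists (F e)].
Qed.

Lemma Dpull_in0 v w (D : tup A w -> Prop) (G : tup B v -> tup A w) :
  Df w D -> racc kb h G -> Dpull Df (fun e => D (G e)).
Proof.
move=> d rG; apply: (Dpull_in (w' := [::]) (D := fun x _ => D x) (F := fun=> tt)) => //.
  dsub H d (fun x => tfst x); move=> x.
  by split=> [Dx|[]//]; exists tt.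
exact: racc_nil.
Qed.

End Base.

End Pull.

(** * Composition of two interpretations *)

Section PullComp.
Variables (S S0 S1 : Type) (A : S -> Type) (B0 : S0 -> Type) (B1 : S1 -> Type).
Variables (cw0 : S0 -> seq S) (cr0 : forall s, tup A (cw0 s) -> B0 s -> Prop).
Variables (cw1 : S1 -> seq S0) (cr1 : forall s, tup B0 (cw1 s) -> B1 s -> Prop).

Definition cwc s := flat cw0 (cw1 s).

Definition crc s (x : tup A (cwc s)) (b : B1 s) :=
  exists2 e, crs cr0 x e & cr1 e b.

Fixpoint flatflat w : tup A (flat cwc w) -> tup A (flat cw0 (flat cw1 w)) :=
  match w with
  | [::] => fun _ => tt
  | s :: w' => fun x => flatcat (w := cw1 s) (tfst x) (flatflat (tsnd x))
  end.

Lemma racc_flatflat w u (F : tup A u -> tup A (flat cwc w)) :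
  bacc F -> bacc (fun x => flatflat (F x)).
Proof.
elim: w u F => [|s w IH] u F rF /=; first exact: racc_nil.
apply: racc_flatcat; first by acc.
by apply: IH; acc.
Qed.

Lemma crs_flatflat w x b :
  crs crc (w := w) x b <-> exists2 e, crs cr0 (flatflat x) e & crs cr1 e b.
Proof.
elim: w x b => [|s w IH] x b /=; first by split=> // _; exists tt.
split=> [[[e c c1] /IH [e' c' c1']]|[e /crs_cat [c c'] [c1 c1']]].
  by exists (tcat e e'); rewrite ?crs_cat tfst_tcat tsnd_tcat.
by split; [exists (tfst e) | apply/IH; exists (tsnd e)].
Qed.

Lemma Dpull_comp (Df : dfam A) (H : defsys Df) w (D : tup B1 w -> Prop) :
  Dpull cr1 (Dpull cr0 Df) D -> Dpull crc Df D.
Proof.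
move=> d; rewrite /Dpull in d *.
dsub H d (fun x => flatflat x); first exact: racc_flatflat (racc_id _ _).
move=> x; split=> [[e c [b c1 Db]]|[b /crs_flatflat [e c c1] Db]].
  by exists b => //; apply/crs_flatflat; exists e.
by exists e => //; exists b.
Qed.

Lemma crc_fun :
  (forall s x b b', @cr0 s x b -> cr0 x b' -> b = b') ->
  (forall s x b b', @cr1 s x b -> cr1 x b' -> b = b') ->
  forall s x b b', @crc s x b -> crc x b' -> b = b'.
Proof.
move=> f0 f1 s x b b' [e c c1] [e' c' c1'].
by apply: f1 c1 _; rewrite (crs_fun f0 c c').
Qed.

Lemma crc_surj :
  (forall s b, exists x, @cr0 s x b) -> (forall s b, exists x, @cr1 s x b) ->
  forall s b, exists x, @crc s x b.
Proof.
move=> f0 f1 s b; have [e c1] := f1 s b; have [x c] := crs_surj f0 e.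
by exists x, e.
Qed.

Lemma crc_ker (Df : dfam A) (H : defsys Df) :
  (forall s, Dpull cr0 Df (w := cw1 s ++ cw1 s)
     (fun x => exists2 b, cr1 (tfst x) b & cr1 (tsnd x) b)) ->
  forall s, Df (cwc s ++ cwc s)
     (fun x => exists2 b, crc (tfst x) b & crc (tsnd x) b).
Proof.
move=> k s; have d := k s; rewrite /Dpull in d.
dsub H d (fun x => flatcat (w := cw1 s) (v := cw1 s) (tfst x) (tsnd x)).
  by apply: racc_flatcat; acc.
move=> x; split.
  by move=> [e /crs_cat [c c'] [b c1 c1']]; exists b; [exists (tfst e)|exists (tsnd e)].
move=> [b [e c c1] [e' c' c1']]; exists (tcat e e').
  by rewrite crs_cat tfst_tcat tsnd_tcat.
by exists b; rewrite ?tfst_tcat ?tsnd_tcat.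
Qed.

End PullComp.

(** * 0-definable sets of a structure inside its expansions *)

Section ExtLift.
Variables (L : language) (U : structure L) (E : langext L) (X : expansion U E).
Variables (Df : dfam (ext X)) (H : defsys Df).
Hypothesis Df_rel : forall r, Df (@rint _ (ext X) (inl r)).
Hypothesis Df_fun : forall f,
  Df (w := fcod (l := extlang E) (inl f) :: fdom (l := extlang E) (inl f))
     (fun x => x.1 = @fint _ (ext X) (inl f) x.2).

Lemma racc_tunlift v w (G : tup (ext X) v -> tup (ext X) (map inl w)) :
  bacc G -> racc inl (fun s a => a) (fun x => tunlift (G x) : tup U w).
Proof.
exact: (@racc_tunmap _ _ _ (ext X) (ext X) U (fun s => s) (fun s a => a)
  inl (fun s a => a) v w G).
Qed.

Lemma def0_full w (D : tup U w -> Prop) : def0 D ->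
  Dform (fun=> True) (fun=> True) D.
Proof.
move=> [phi e]; exists phi => //.
have tu (w1 : seq (srt L)) :
    (forall s (t : term w1 s), term_uses (fun=> True) t) /\
    (forall u (ts : terms w1 u), terms_use (fun=> True) ts).
  by apply: (@term_terms_ind L w1 (fun s t => term_uses (fun=> True) t)
    (fun u ts => terms_use (fun=> True) ts)).
elim: phi {e} => //=.
- by move=> w1 s t t'; split; apply: (tu w1).1.
- by move=> w1 r ts; split=> //; apply: (tu w1).2.
Qed.

(** This is [sat_in] for the family restricted to the old sorts: it contains the old basic relations
    and graphs, hence every 0-definable set of U. *)
Lemma ext_lift w (D : tup U w -> Prop) : def0 D ->
  Dreindex (A0 := U) Df (g := inl) (fun s a => a) D.
Proof.
move=> /def0_full [phi u e].
have H' := @Dreindex_defsys _ _ _ _ _ H inl (fun s (a : ext X (inl s)) => (a : U s))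
  (fun s a => a) (fun _ _ => erefl) (fun _ _ => erefl).
apply: (ds_ext H') (sat_in H' _ _ u) _; last by move=> x; rewrite e.
- by move=> r _; apply: Df_rel.
- move=> f _; exact: Df_fun.
Qed.

Lemma ext_lift_acc w (D : tup U w -> Prop) v (G : tup (ext X) v -> tup U w) :
  def0 D -> racc inl (fun s a => a) G -> Df (fun x => D (G x)).
Proof.
move=> d rG; apply: (@Dreindex_out _ _ (ext X) U Df H inl (fun s a => a)
  (fun s a => a) _ _ v w D G) => //.
exact: ext_lift.
Qed.

End ExtLift.

(** * Cardinal arithmetic *)

(** The chain [F] may be empty, so [P] has to hold for the empty set as well. *)
Lemma zorn_union (T : Type) (P : (T -> Prop) -> Prop) :
  (forall F : (T -> Prop) -> Prop, (forall A, F A -> P A) ->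
     (forall A B, F A -> F B -> (forall t, A t -> B t) \/ (forall t, B t -> A t)) ->
     P (fun t => exists2 A, F A & A t)) ->
  exists2 A, P A & forall B, P B -> (forall t, A t -> B t) -> forall t, B t -> A t.
Proof.
move=> h; have [|A [PA mA]] := @classical_sets.Zorn_bigcup T P; first exact: h.
exists A => // B PB AB t Bt; apply: NNPP => nA.
by apply: (mA B) => //; split=> // BA; apply: nA; exact: BA.
Qed.

Definition inj (A B : Type) : Prop := exists f : A -> B, injective f.

Lemma inj_trans A B C : inj A B -> inj B C -> inj A C.
Proof. by move=> [f hf] [g hg]; exists (g \o f); apply: inj_comp. Qed.

Lemma inj_prod A B C D : inj A B -> inj C D -> inj (A * C) (B * D).
Proof.
move=> [f hf] [g hg]; exists (fun x => (f x.1, g x.2)).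
by move=> [a c] [a' c'] /= [/hf -> /hg ->].
Qed.

Lemma inj_sum A B C D : inj A B -> inj C D -> inj (A + C) (B + D).
Proof.
move=> [f hf] [g hg].
exists (fun x => match x with inl a => inl (f a) | inr c => inr (g c) end).
by move=> [a|c] [a'|c'] // [] => [/hf ->|/hg ->].
Qed.

(** The relation need not be functional: after choosing a value for each [a], injectivity follows
    because no value serves two arguments. *)
Lemma inj_rel A B (R : A -> B -> Prop) : (forall a, exists b, R a b) ->
  (forall a a' b, R a b -> R a' b -> a = a') -> inj A B.
Proof.
move=> t i; exists (fun a => sval (constructive_indefinite_description _ (t a))) => a a' e.
apply: i (svalP (constructive_indefinite_description _ (t a))) _; rewrite e.
exact: (svalP (constructive_indefinite_description _ (t a'))).
Qed.

Lemma inj_double A : inj nat A -> inj (A + A) (A * A).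
Proof.
move=> [f hf].
exists (fun x => match x with inl a => (f 0, a) | inr a => (f 1, a) end).
by move=> [a|a] [b|b] [] // => [-> | /hf | /hf | ->].
Qed.

(** If no list exhausts [A], then [new] picks an element outside any given list, and [s k] collects
    the first [k] picks. If some list does, positions in it give the embedding into [nat]. *)
Lemma inj_nat_dichotomy A : inj nat A \/ inj A nat.
Proof.
have [fin|inf] := classic (exists l : seq A, forall a, List.In a l).
  right; have [l hl] := fin; apply: (@inj_rel _ _ (fun a k => List.nth_error l k = Some a)).
    by move=> a; have [k hk] := List.In_nth_error _ _ (hl a); exists k.
  by move=> a a' k -> [].
left; have nx (l : seq A) : exists a, ~ List.In a l.
  apply: NNPP => n; apply: inf; exists l => a; apply: NNPP => na.
  by apply: n; exists a.
pose new l := sval (constructive_indefinite_description _ (nx l)).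
have newP l : ~ List.In (new l) l := svalP (constructive_indefinite_description _ (nx l)).
pose s := fix s k := if k is k'.+1 then new (s k') :: s k' else [::].
have mono k l : k < l -> List.In (new (s k)) (s l).
  elim: l => // l IH; rewrite ltnS leq_eqVlt => /orP [/eqP ->|/IH]; first by left.
  by right.
exists (fun k => new (s k)) => k l e.
case: (ltngtP k l) => // /mono h.
  by rewrite e in h; case: (newP _ h).
by rewrite -e in h; case: (newP _ h).
Qed.

(** A maximal partial bijection is total on one of the two sides: otherwise a pair with [a] outside
    its domain and [b] outside its range could be added. *)
Lemma inj_total A B : inj A B \/ inj B A.
Proof.
pose P (R : A * B -> Prop) := forall a b a' b', R (a, b) -> R (a', b') -> (a = a' <-> b = b').
have [|R PR mR] := @zorn_union (A * B) P.
  move=> F FP ch a b a' b' [R FR Rab] [R' FR' Rab'].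
  have [h|h] := ch _ _ FR FR'.
    by apply: (FP R') => //; exact: h.
  by apply: (FP R) => //; exact: h.
have [da|/not_all_ex_not [a na]] := classic (forall a, exists b, R (a, b)).
  left; apply: (inj_rel da) => a a' b h h'.
  by apply/(PR _ _ _ _ h h').
have [db|/not_all_ex_not [b nb]] := classic (forall b, exists a, R (a, b)).
  right; apply: (inj_rel (R := fun b a => R (a, b)) db) => b b' a' h h'.
  by apply/(PR _ _ _ _ h h').
suff h : R (a, b) by case: na; exists b.
apply: (mR (fun t => R t \/ t = (a, b))); try by auto.
move=> x y x' y' [h|[-> ->]] [h'|[-> ->]]; first exact: PR h h'.
- by split=> e; [case: na | case: nb]; eexists; rewrite e in h; exact: h.
- by split=> e; [case: na | case: nb]; eexists; rewrite -e in h'; exact: h'.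
- by [].
Qed.

Section Square.
Variable X : Type.

Definition sqdom (A : X * X * X -> Prop) x := exists y z, A (x, y, z).

(** Such an [A] is the graph of an injection from the square of [sqdom A] into [sqdom A]. The domain
    is recovered from the graph, so that Zorn's lemma applies to one predicate ordered by
    inclusion. *)
Record sqgood (A : X * X * X -> Prop) : Prop := SqGood {
  sq_fun : forall x y z z', A (x, y, z) -> A (x, y, z') -> z = z';
  sq_inj : forall x y x' y' z, A (x, y, z) -> A (x', y', z) -> x = x' /\ y = y';
  sq_tot : forall x y, sqdom A x -> sqdom A y -> exists z, A (x, y, z);
  sq_dom : forall x y z, A (x, y, z) -> sqdom A y /\ sqdom A z }.

Lemma sqgood_chain (F : (X * X * X -> Prop) -> Prop) : (forall A, F A -> sqgood A) ->
  (forall A B, F A -> F B -> (forall t, A t -> B t) \/ (forall t, B t -> A t)) ->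
  sqgood (fun t => exists2 A, F A & A t).
Proof.
move=> FP ch.
have two A B t u : F A -> F B -> A t -> B u -> exists2 C, F C & C t /\ C u.
  move=> FA FB At Bu.
  by have [h|h] := ch _ _ FA FB; [exists B|exists A] => //; split=> //; exact: h.
split.
- move=> x y z z' [A FA h] [B FB h']; have [C FC [c c']] := two _ _ _ _ FA FB h h'.
  exact: (sq_fun (FP C FC) c c').
- move=> x y x' y' z [A FA h] [B FB h']; have [C FC [c c']] := two _ _ _ _ FA FB h h'.
  exact: (sq_inj (FP C FC) c c').
- move=> x y [x1 [x2 [A FA h]]] [y1 [y2 [B FB h']]].
  have [C FC [c c']] := two _ _ _ _ FA FB h h'.
  have [||z cz] := sq_tot (FP C FC) (x := x) (y := y); [by exists x1, x2|by exists y1, y2|].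
  by exists z, C.
- move=> x y z [A FA h]; have [[y1 [y2 h1]] [z1 [z2 h2]]] := sq_dom (FP A FA) h.
  by split; [exists y1, y2, A | exists z1, z2, A].
Qed.

(* Zorn on injections [D * D -> D] with [D] containing a copy of [nat]: a
   maximal [D] cannot embed into its complement, since otherwise the part of
   [(D + D) * (D + D)] outside [D * D], three copies of [D * D], would embed
   into that copy of [D]. *)
Lemma inj_square : inj nat X -> inj (X * X) X.
Proof.
move=> [iota hiota]; pose A0 (t : X * X * X) :=
  exists k l, t = (iota k, iota l, iota (pickle (k, l))).
have dA0 x : sqdom A0 x <-> exists k, x = iota k.
  split=> [[y [z [k [l [-> _ _]]]]]|[k ->]]; first by exists k.
  by exists (iota 0), (iota (pickle (k, 0))), k, 0.
have gA0 : sqgood A0.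
  split.
  - by move=> x y z z' [k [l [-> -> ->]]] [k' [l' [/hiota <- /hiota <- ->]]].
  - move=> x y x' y' z [k [l [-> -> ->]]] [k' [l' [-> -> /hiota e]]].
    by have [-> ->] : (k, l) = (k', l') by apply: (pcan_inj pickleK).
  - move=> x y /dA0 [k ->] /dA0 [l ->].
    by exists (iota (pickle (k, l))), k, l.
  - move=> x y z [k [l [_ -> ->]]]; split; apply/dA0; by eexists.
(* Adjoining [A0] in the property makes the empty chain harmless and puts the image of [iota] into
   the maximal domain. *)
have [|A gA mA] := @zorn_union _ (fun A => sqgood (fun t => A t \/ A0 t)).
  move=> F FP ch; have [[C FC]|none] := classic (exists A, F A); last first.
    suff -> : (fun t => (exists2 A, F A & A t) \/ A0 t) = A0 by [].
    apply: boolp.funext => t; apply: boolp.propext; split; last by right.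
    by case=> // -[A FA]; case: none; exists A.
  pose F' B := exists2 A, F A & B = (fun t => A t \/ A0 t).
  have := @sqgood_chain F'.
  suff -> : (fun t => exists2 B, F' B & B t) = (fun t => (exists2 A, F A & A t) \/ A0 t).
    apply; first by move=> B [A FA ->]; exact: FP.
    move=> B B' [A FA ->] [A' FA' ->].
    by have [h|h] := ch _ _ FA FA'; [left|right] => t [/h|]; auto.
  apply: boolp.funext => t; apply: boolp.propext; split.
    by move=> [B [A FA ->] [At|]]; [left; exists A | right].
  move=> [[A FA At]|At]; first by exists (fun t => A t \/ A0 t); [exists A|left].
  by exists (fun t => C t \/ A0 t); [exists C|right].
pose B t := A t \/ A0 t; pose D := sqdom B.
have mB B' : sqgood B' -> (forall t, B t -> B' t) -> forall t, B' t -> B t.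
  move=> gB' sB t B't; left; apply: (mA B') => //.
    suff -> : (fun t => B' t \/ A0 t) = B' by [].
    apply: boolp.funext => u; apply: boolp.propext; split; last by left.
    by case=> // h; apply: sB; right.
  by move=> u Au; apply: sB; left.
have Di k : D (iota k).
  by exists (iota 0), (iota (pickle (k, 0))); right; exists k, 0.
have fex x y : exists z, D x -> D y -> B (x, y, z).
  have [[hx hy]|n] := classic (D x /\ D y); last by exists x => hx hy; case: n.
  by have [z hz] := sq_tot gA hx hy; exists z.
pose f x y := sval (constructive_indefinite_description _ (fex x y)).
have fP x y : D x -> D y -> B (x, y, f x y) :=
  svalP (constructive_indefinite_description _ (fex x y)).
have fD x y : D x -> D y -> D (f x y).
  by move=> hx hy; have [] := sq_dom gA (fP x y hx hy).
have fI x y x' y' : D x -> D y -> D x' -> D y' -> f x y = f x' y' -> x = x' /\ y = y'.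
  move=> h1 h2 h3 h4 e; have b1 := fP _ _ h1 h2; have b2 := fP _ _ h3 h4.
  by rewrite -e in b2; exact: (sq_inj gA b1 b2).
have sqD : inj ({x | D x} * {x | D x}) {x | D x}.
  exists (fun p => exist _ _ (fD _ _ (svalP p.1) (svalP p.2))).
  move=> [[x hx] [y hy]] [[x' hx'] [y' hy']] /= /(f_equal (fun z => sval z)) /= /fI.
  move=> /(_ hx hy hx' hy') [ex ey]; subst x' y'.
  by rewrite (boolp.Prop_irrelevance hx hx') (boolp.Prop_irrelevance hy hy').
have natD : inj nat {x | D x}.
  by exists (fun k => exist _ _ (Di k)) => k l [] /hiota.
have XD : inj {x | ~ D x} {x | D x} -> inj X {x | D x}.
  move=> h; apply: (@inj_trans _ ({x | D x} + {x | ~ D x})).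
    apply: (@inj_rel _ _ (fun x t => x = match t with inl a => sval a | inr a => sval a end)).
      move=> x; have [h1|h1] := classic (D x); first by exists (inl (exist _ _ h1)).
      by exists (inr (exist (fun y => ~ D y) _ h1)).
    by move=> x x' t -> ->.
  have hid : inj {x | D x} {x | D x} by exists id.
  exact: inj_trans (inj_sum hid h) (inj_trans (inj_double natD) sqD).
(* If the complement of [D] embeds into [D], then so does [X], and [sqD] gives the claim. Otherwise
   [j0] is a second copy of [D] outside [D], over which the graph can be extended, against
   maximality. *)
have [h|[j0 hj0]] := inj_total {x | ~ D x} {x | D x}.
  have h' := XD h; apply: inj_trans (inj_prod h' h') (inj_trans sqD _).
  exists (fun x => sval x) => -[x hx] [y hy] /= e; subst y.
  by rewrite (boolp.Prop_irrelevance hx hy).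
have [j jN jI] : exists2 j : X -> X, forall x, D x -> ~ D (j x) &
    forall x y, D x -> D y -> j x = j y -> x = y.
  have jex x : exists y, forall hx : D x, y = sval (j0 (exist _ x hx)).
    have [hx|n] := classic (D x); last by exists x => hx; case: n.
    exists (sval (j0 (exist _ x hx))) => hx'.
    by rewrite (boolp.Prop_irrelevance hx hx').
  pose j x := sval (constructive_indefinite_description _ (jex x)).
  have jP x (hx : D x) : j x = sval (j0 (exist _ x hx)) :=
    svalP (constructive_indefinite_description _ (jex x)) hx.
  exists j => [x hx|x y hx hy]; first by rewrite (jP x hx); exact: (svalP (j0 _)).
  rewrite (jP x hx) (jP y hy) => e.
  have e' : j0 (exist _ x hx) = j0 (exist _ y hy).
    case: (j0 _) (j0 _) e => a ha [b hb] /= e; subst b.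
    by rewrite (boolp.Prop_irrelevance ha hb).
  by move/hj0: e' => [].
pose emb (t : bool) x := if t then j x else x.
have embI t t' x y : D x -> D y -> emb t x = emb t' y -> t = t' /\ x = y.
  case: t t' => [] [] hx hy /=; first by move/jI => ->.
  - by move=> e; case: (jN x) => //; rewrite e.
  - by move=> e; case: (jN y) => //; rewrite -e.
  - by [].
(* The tag [c t t'] numbers the four blocks of pairs from [D] and [j D]. Outside the old block,
   excluded by [t || t'], the value is put into [j D], at the point coding tag and pair; old values
   lie in [D], so none is hit twice. *)
pose c (t t' : bool) := iota (t + t'.*2).
pose B2 u := B u \/ exists t t' x y,
  [/\ t || t', D x, D y & u = (emb t x, emb t' y, j (f (c t t') (f x y)))].
have fcD t t' x y : D x -> D y -> D (f (c t t') (f x y)).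
  by move=> hx hy; apply: fD (Di _) (fD _ _ hx hy).
have dB2 x : sqdom B2 x <-> exists t d, D d /\ x = emb t d.
  split=> [[y [z [h|[t [t' [d [d' [_ hd _ [-> _ _]]]]]]]]]|[t [d [hd ->]]]].
  - by exists false, x; split=> //; exists y, z.
  - by exists t, d.
  - exists (emb true (iota 0)); eexists; right; exists t, true, d, (iota 0).
    by split=> //; rewrite orbT.
have notD t x : D x -> D (emb t x) -> t = false.
  by case: t => //= /jN h.
have gB2 : sqgood B2.
  split.
  - move=> x y z z' [h|[t [t' [d [d' [tt' hd hd' [-> -> ->]]]]]]].
      move=> [h'|[t [t' [d [d' [tt' hd hd' [ex ey _]]]]]]]; first exact: (sq_fun gA h h').
      have h1 : D x by exists y, z.
      have [h2 _] := sq_dom gA h; rewrite ex in h1; rewrite ey in h2.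
      by move: tt'; rewrite (notD _ _ hd h1) (notD _ _ hd' h2).
    move=> [h|[s [s' [e [e' [_ he he' [/embI h1 /embI h2 ->]]]]]]].
      have h1 : D (emb t d) by exists (emb t' d'), z'.
      have [h2 _] := sq_dom gA h.
      by move: tt'; rewrite (notD _ _ hd h1) (notD _ _ hd' h2).
    by have [-> ->] := h1 hd he; have [-> ->] := h2 hd' he'.
  - move=> x y x' y' z [h|[t [t' [d [d' [tt' hd hd' [-> -> ->]]]]]]].
      move=> [h'|[t [t' [d [d' [tt' hd hd' [_ _ ez]]]]]]]; first exact: (sq_inj gA h h').
      by have [_ hz] := sq_dom gA h; rewrite ez in hz;
        case: (jN _ (fcD t t' d d' hd hd') hz).
    move=> [h|[s [s' [e [e' [_ he he' [-> -> /jI ez]]]]]]].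
      by have [_ hz] := sq_dom gA h; case: (jN _ (fcD t t' d d' hd hd') hz).
    have [ec ef] := fI _ _ _ _ (Di _) (fD _ _ hd hd') (Di _) (fD _ _ he he')
      (ez (fcD _ _ _ _ hd hd') (fcD _ _ _ _ he he')).
    have [-> ->] := fI _ _ _ _ hd hd' he he' ef.
    by move/hiota: ec; case: t t' s s' {tt' ez} => [] [] [] [].
  - move=> x y /dB2 [t [d [hd ->]]] /dB2 [t' [d' [hd' ->]]].
    have [tt'|] := boolP (t || t'); last first.
      rewrite negb_or => /andP [/negbTE -> /negbTE ->] /=.
      by have [z hz] := sq_tot gA hd hd'; exists z; left.
    by eexists; right; exists t, t', d, d'.
  - move=> x y z [h|[t [t' [d [d' [_ hd hd' [_ -> ->]]]]]]].
      by have [h1 h2] := sq_dom gA h; split; apply/dB2; [exists false, y|exists false, z].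
    split; apply/dB2; first by exists t', d'.
    by exists true, (f (c t t') (f d d')); split=> //; exact: fcD.
(* The extended domain contains [j (iota 0)], which is not in [D]; maximality would put it there. *)
have [y [z h]] : sqdom B2 (j (iota 0)) by apply/dB2; exists true, (iota 0).
case: (jN (iota 0) (Di 0)); exists y, z; apply: (mB B2) => //.
by move=> t; left.
Qed.

End Square.

(** * The groupoid G' *)

Lemma sval_inj_prop (T : Type) (P : T -> Prop) (a b : {x | P x}) :
  sval a = sval b -> a = b.
Proof.
case: a b => [x px] [y py] /= e; rewrite e in px *.
by rewrite (proof_irrelevance _ px py).
Qed.

Section StarGroupoid.
Variables (XI XM XO : Type) (G : gpd XI XM XO) (i : XI).
Hypotheses (hG : is_groupoid G) (hi : obj G i).

Let G' := gpd_star G i.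

(** Together with [um] and [unstar] this retracts G' onto G. A morphism of G' amounts to its two
    ends and its underlying morphism ([st_mk], [st_um_inj]), and in this way the groupoid axioms are
    lifted from G. *)
Definition us (p : XI + unit) : XI := if p is inl j then j else i.
Definition um (m : XM + Mstar G i) : XM :=
  match m with inl m => m | inr mk => (sval mk).1 end.

Lemma star_mor (m : XM) (k : 'I_3) : in_Mstar G i (m, k) ->
  exists mk : Mstar G i, sval mk = (m, k).
Proof. by move=> h; exists (exist _ (m, k) h). Qed.

Lemma st_us m p q : st G' m p q -> st G (um m) (us p) (us q).
Proof.
case: m p q => [m|[[m k] h]] [j|[]] [j'|[]] //=; rewrite /star_st /=.
- by case=> [[-> [] //]|[_ [] //]].
- by case=> [[-> [] //]|[_ [] //]].
- by case.
Qed.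

Lemma st_mk m0 p q : st G m0 (us p) (us q) -> exists2 m, st G' m p q & um m = m0.
Proof.
case: p q => [j|[]] [j'|[]] /= s.
- by exists (inl m0).
- have [e|ne] := classic (j = i).
    rewrite e in s *.
    have [|mk e1] := @star_mor m0 (@Ordinal 3 1 isT); first by left.
    by exists (inr mk); rewrite /= /star_st e1 //=; left.
  have [|mk e1] := @star_mor m0 ord0; first by right; split=> //; exists j; auto.
  by exists (inr mk); rewrite /= /star_st e1 //=; right.
- have [e|ne] := classic (j' = i).
    rewrite e in s *.
    have [|mk e1] := @star_mor m0 (@Ordinal 3 2 isT); first by left.
    by exists (inr mk); rewrite /= /star_st e1 //=; left.
  have [|mk e1] := @star_mor m0 ord0; first by right; split=> //; exists j'; auto.
  by exists (inr mk); rewrite /= /star_st e1 //=; right.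
- have [|mk e1] := @star_mor m0 ord0; first by left.
  by exists (inr mk); rewrite /= /star_st e1.
Qed.

(** The ends decide both the summand containing the morphism and, in [M_*], its tag in ['I_3]. *)
Lemma st_um_inj m m' p q :
  st G' m p q -> st G' m' p q -> um m = um m' -> m = m'.
Proof.
have eqM (a b : Mstar G i) : (sval a).1 = (sval b).1 ->
    val (sval a).2 = val (sval b).2 -> inr a = inr b :> XM + Mstar G i.
  move=> e1 e2; congr inr; apply: sval_inj_prop.
  by case: (sval a) (sval b) e1 e2 => x k [y k'] /= -> /val_inj ->.
case: p q => [j|[]] [j'|[]].
- by case: m m' => [m|[[m k] h]] [m'|[[m' k'] h']] //= _ _ ->.
- case: m m' => [m|a] [m'|b] //=; rewrite /star_st.
  move: (eqM a b); case: (sval a) (sval b) => m k [m' k'] /= E.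
  by move=> [[e [_ k1]]|[e [_ k1]]] [[e' [_ k2]]|[e' [_ k2]]] em //;
    apply: E; rewrite ?k1 ?k2.
- case: m m' => [m|a] [m'|b] //=; rewrite /star_st.
  move: (eqM a b); case: (sval a) (sval b) => m k [m' k'] /= E.
  by move=> [[e [_ k1]]|[e [_ k1]]] [[e' [_ k2]]|[e' [_ k2]]] em //;
    apply: E; rewrite ?k1 ?k2.
- case: m m' => [m|a] [m'|b] //=; rewrite /star_st.
  move: (eqM a b); case: (sval a) (sval b) => m k [m' k'] /= E.
  by move=> [_ k1] [_ k2] em; apply: E; rewrite ?k1 ?k2.
Qed.

Lemma pr_us x p : pr G' x p -> pr G (unstar x) (us p).
Proof. by case: x p => [a|[a h]] [j|[]]. Qed.

Lemma pr_mk a p : pr G a (us p) -> exists2 x, pr G' x p & unstar x = a.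
Proof.
case: p => [j|[]] /= h; first by exists (inl a).
by exists (inr (exist _ a h)).
Qed.

Lemma pr_unstar_inj x y p :
  pr G' x p -> pr G' y p -> unstar x = unstar y -> x = y.
Proof.
case: x y p => [a|a] [b|b] [j|[]] //=; first by move=> _ _ ->.
by move=> _ _ /sval_inj_prop ->.
Qed.

Lemma obj_us p : obj G' p -> obj G (us p).
Proof. by case: p. Qed.

Lemma st_star_fun m p q p' q' :
  st G' m p q -> st G' m p' q' -> p = p' /\ q = q'.
Proof.
have sf := st_fun hG.
case: m p q p' q' => [m|[[m k] h]] [j|[]] [j'|[]] [l|[]] [l'|[]] //=;
  rewrite /star_st /=.
- by move=> s /(sf _ _ _ _ _ s) [-> ->].
- move=> [[-> [s ->]]|[n [s ->]]] [[-> [s' //]]|[n' [s' //]]].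
  by have [-> _] := sf _ _ _ _ _ s s'.
- move=> [[-> [s ->]]|[n [s ->]]] [[-> [s' //]]|[n' [s' //]]].
  by have [] := sf _ _ _ _ _ s s'.
- move=> [[-> [s ->]]|[n [s ->]]] [s' //].
  by have [] := sf _ _ _ _ _ s s'.
- move=> [[-> [s ->]]|[n [s ->]]] [[-> [s' //]]|[n' [s' //]]].
  by have [_ e] := sf _ _ _ _ _ s s'; rewrite e in n.
- move=> [[-> [s ->]]|[n [s ->]]] [[-> [s' //]]|[n' [s' //]]].
  by have [_ ->] := sf _ _ _ _ _ s s'.
- move=> [[-> [s ->]]|[n [s ->]]] [s' //].
  by have [_ e] := sf _ _ _ _ _ s s'.
- move=> [s ->] [[-> [s' //]]|[n [s' //]]].
  by have [e _] := sf _ _ _ _ _ s s'; case: n.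
- move=> [s ->] [[-> [s' //]]|[n [s' //]]].
  by have [_ e] := sf _ _ _ _ _ s s'; case: n.
Qed.

Lemma pr_star_fun x p p' : pr G' x p -> pr G' x p' -> p = p'.
Proof.
case: x p p' => [a|a] [j|[]] [j'|[]] //= h h'.
by rewrite (pr_fun hG h h').
Qed.

(** The relation R quantifies over the ends of an element of [M_*]; they are unique, so they may be
    prescribed. *)
Lemma act_st m p q x y : st G' m p q ->
  (act G' m x y <->
   [/\ pr G' x p, pr G' y q & act G (um m) (unstar x) (unstar y)]).
Proof.
case: m => [m|mk] s.
  case: p q s => [j|[]] [j'|[]] //= s.
  case: x y => [a|a] [b|b] //=; [|by split=> // -[]..].
  by split=> [h|[] //]; have [] := act_obj hG s h.
split=> [[[p' [q' [s' hx hy]]] h]|[hx hy h]].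
  by have [e e'] := st_star_fun s s'; rewrite -e in hx; rewrite -e' in hy.
by split=> //; exists p, q.
Qed.

Lemma st_star_tot m : mor G' m -> exists p q, st G' m p q.
Proof.
case: m => [m /(st_tot hG) [j [j' s]]|[[m k] h] _]; first by exists (inl j), (inl j').
rewrite /= /star_st /=; case: h => [s|[k0 [j [ne [s|s]]]]].
- case: k => [[|[|[|]]]] //= hk.
  + by exists (inr tt), (inr tt).
  + by exists (inl i), (inr tt); left.
  + by exists (inr tt), (inl i); left.
- by exists (inr tt), (inl j); right.
- by exists (inl j), (inr tt); right.
Qed.

Lemma st_star_sub m p q : st G' m p q -> [/\ mor G' m, obj G' p & obj G' q].
Proof.
move=> s; have [h1 h2 h3] := st_sub hG (st_us s).
by case: m p q s h1 h2 h3 => [m|mk] [j|[]] [j'|[]].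
Qed.

Lemma act_star_sub m x y : act G' m x y ->
  exists p q, [/\ st G' m p q, pr G' x p & pr G' y q].
Proof.
case: m => [m|mk] h; last by case: h => -[p [q s]] _; exists p, q.
case: x y h => [a|a] [b|b] //= h.
have [hm _ _] := act_sub hG h; have [j [j' s]] := st_tot hG hm.
by have [] := act_obj hG s h; exists (inl j), (inl j').
Qed.

Lemma pr_star_sub x p : pr G' x p -> pts G' x /\ obj G' p.
Proof.
by case: x p => [a|a] [j|[]] //= h; apply: (pr_sub hG h).
Qed.

Lemma pr_star_surj p : obj G' p -> exists x, pr G' x p.
Proof. by move=> /obj_us /(pr_surj hG) [a /pr_mk [x]]; exists x. Qed.

Lemma act_star_fun m p q : st G' m p q ->
  forall x, pr G' x p -> exists! y, act G' m x y.
Proof.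
move=> s x hx; have [b [hb ub]] := act_fun hG (st_us s) (pr_us hx).
have [_ pb] := act_obj hG (st_us s) hb.
have [y py ey] := pr_mk pb; exists y; split; first by apply/(act_st _ _ s); rewrite ey.
move=> y' /(act_st _ _ s) [_ py' /ub e].
by apply: (pr_unstar_inj py py'); rewrite ey.
Qed.

Lemma act_star_bij m p q : st G' m p q ->
  forall y, pr G' y q -> exists! x, act G' m x y.
Proof.
move=> s y hy; have [b [hb ub]] := act_bij hG (st_us s) (pr_us hy).
have [pb _] := act_obj hG (st_us s) hb.
have [x px ex] := pr_mk pb; exists x; split; first by apply/(act_st _ _ s); rewrite ex.
move=> x' /(act_st _ _ s) [px' _ /ub e].
by apply: (pr_unstar_inj px px'); rewrite ex.
Qed.

Lemma star_is_groupoid : is_groupoid G'.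
Proof.
split.
- exact: st_star_sub.
- exact: st_star_tot.
- exact: st_star_fun.
- move=> p q /obj_us hp /obj_us hq; have [m s] := st_surj hG hp hq.
  by have [m' s' _] := st_mk s; exists m'.
- exact: pr_star_sub.
- case=> [a|a] /=; last by exists (inr tt).
  by move=> /(pr_tot hG) [j h]; exists (inl j).
- exact: pr_star_fun.
- exact: pr_star_surj.
- move=> m x y /act_star_sub [p [q [s hx hy]]].
  have [? _ _] := st_star_sub s; have [? _] := pr_star_sub hx.
  by have [? _] := pr_star_sub hy.
- by move=> m p q s x y /(act_st _ _ s) [].
- exact: act_star_fun.
- exact: act_star_bij.
(* One pair in the common graph shows that the ends agree; then [st_um_inj] reduces the claim to
   injectivity of the action in [G]. *)
- move=> m m' hm hm' e.
  have [p [q s]] := st_star_tot hm; have [p' [q' s']] := st_star_tot hm'.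
  have [_ hp _] := st_star_sub s.
  have [x hx] := pr_star_surj hp; have [y [hy _]] := act_star_fun s hx.
  have [_ hyq _] := (act_st _ _ s).1 hy.
  have [hx' hy' _] := (act_st _ _ s').1 ((e _ _).1 hy).
  have ep := pr_star_fun hx hx'; have eq := pr_star_fun hyq hy'.
  rewrite -ep -eq in s'; apply: (st_um_inj s s').
  have [h1 _ _] := st_sub hG (st_us s); have [h2 _ _] := st_sub hG (st_us s').
  apply: (act_inj hG) => // a b; split=> h.
    have [ha hb] := act_obj hG (st_us s) h.
    have [u pu eu] := pr_mk ha; have [v pv ev] := pr_mk hb.
    rewrite -eu -ev in h *.
    by have [] := (act_st u v s').1 ((e _ _).1 ((act_st u v s).2 (And3 pu pv h))).
  have [ha hb] := act_obj hG (st_us s') h.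
  have [u pu eu] := pr_mk ha; have [v pv ev] := pr_mk hb.
  rewrite -eu -ev in h *.
  by have [] := (act_st u v s).1 ((e _ _).2 ((act_st u v s').2 (And3 pu pv h))).
- move=> m n p q r s t; have [m0 s0 e0] := act_comp hG (st_us s) (st_us t).
  have [m' s' e'] := st_mk s0; exists m' => // x z.
  rewrite (act_st _ _ s') e'; split.
    move=> [hx hz /e0 [b h1 h2]]; have [_ pb] := act_obj hG (st_us s) h1.
    by have [y py ey] := pr_mk pb; exists y; [apply/(act_st _ _ s)|apply/(act_st _ _ t)];
      rewrite ey.
  move=> [y /(act_st _ _ s) [hx _ h1] /(act_st _ _ t) [_ hz h2]].
  by split=> //; apply/e0; exists (unstar y).
- move=> m p q s; have [m0 s0 e0] := act_inv hG (st_us s).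
  have [m' s' e'] := st_mk s0; exists m' => // x y.
  rewrite (act_st _ _ s') (act_st _ _ s) e'.
  by split=> -[h1 h2 /e0 h3].
Qed.

End StarGroupoid.

(** * Coding morphisms by finite tuples of points *)

Section Codes.
Variables (Sg : Type) (B : Sg -> Type) (so : Sg) (XI XM : Type).
Variable G : gpd XI XM (B so).
Hypothesis hG : is_groupoid G.

Fixpoint prs n : seq Sg := if n is n'.+1 then [:: so, so & prs n'] else [::].

Fixpoint vact n (m : XM) : tup B (prs n) -> Prop :=
  match n with
  | 0 => fun _ => True
  | n'.+1 => fun z => act G m z.1 z.2.1 /\ vact m z.2.2
  end.

Definition Qv n (z : tup B (prs n)) := exists m, vact m z.

Definition codes n (z : tup B (prs n)) m :=
  vact m z /\ forall m', vact m' z -> m' = m.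

(** The graph of the morphism coded by [z]; it is empty when [z] is not a code. *)
Definition cact n (z : tup B (prs n)) x y := exists2 m, codes z m & act G m x y.

Lemma codes_fun n (z : tup B (prs n)) m m' : codes z m -> codes z m' -> m = m'.
Proof. by move=> [_ u] [v _]; rewrite (u _ v). Qed.

Lemma act_ends m x y : act G m x y ->
  exists i j, [/\ st G m i j, pr G x i & pr G y j].
Proof.
move=> h; have [hm _ _] := act_sub hG h; have [i [j s]] := st_tot hG hm.
by have [] := act_obj hG s h; exists i, j.
Qed.

Lemma act_total m : mor G m -> exists x y, act G m x y.
Proof.
move=> /(st_tot hG) [i [j s]]; have [_ hi _] := st_sub hG s.
have [x hx] := pr_surj hG hi; have [y [hy _]] := act_fun hG s hx.
by exists x, y.
Qed.

Lemma act_functional m x y y' : act G m x y -> act G m x y' -> y = y'.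
Proof.
move=> h h'; have [i [j [s hx _]]] := act_ends h.
by have [z [_ u]] := act_fun hG s hx; rewrite -(u _ h) -(u _ h').
Qed.

Lemma act_injective m x x' y : act G m x y -> act G m x' y -> x = x'.
Proof.
move=> h h'; have [i [j [s _ hy]]] := act_ends h.
by have [z [_ u]] := act_bij hG s hy; rewrite -(u _ h) -(u _ h').
Qed.

Lemma act_sub_eq m m' i j : st G m i j -> st G m' i j ->
  (forall x y y', act G m x y -> act G m' x y' -> y = y') -> m = m'.
Proof.
move=> s s' e; have [hm _ _] := st_sub hG s; have [hm' _ _] := st_sub hG s'.
apply: (act_inj hG) => // x y; split=> h.
  have [hx _] := act_obj hG s h; have [y' [h' _]] := act_fun hG s' hx.
  by rewrite (e _ _ _ h h').
have [hx _] := act_obj hG s' h; have [y' [h' _]] := act_fun hG s hx.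
by rewrite -(e _ _ _ h' h).
Qed.

(** This is why codes are nonempty: the first pair of points determines both ends. *)
Lemma vact_st n m m' (z : tup B (prs n.+1)) i j :
  vact m z -> vact m' z -> st G m i j -> st G m' i j.
Proof.
move=> [h _] [h' _] s; have [hx hy] := act_obj hG s h.
have [i' [j' [s' hx' hy']]] := act_ends h'.
by rewrite (pr_fun hG hx hx') (pr_fun hG hy hy').
Qed.

(** The right-hand side mentions points only. Two morphisms through [z] have the same ends, so if
    they differ, they send some point to different places; hence [z] is a code exactly when some
    morphism passes through it and the pairs that can be put before it form a function. *)
Lemma cactP n (z : tup B (prs n.+1)) x y :
  cact z x y <->
  Qv (n := n.+2) (x, (y, z)) /\
  forall x' y' y'', Qv (n := n.+2) (x', (y', z)) ->
    Qv (n := n.+2) (x', (y'', z)) -> y' = y''.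
Proof.
split=> [[m [v u] h]|[[m [h v]] u]].
  split; first by exists m.
  by move=> x' y' y'' [m' /= [h' /u e']] [m'' /= [h'' /u e'']];
    rewrite e' in h'; rewrite e'' in h''; apply: act_functional h' h''.
exists m => //; split=> // m' v'.
have [i [j [s _ _]]] := act_ends v.1; have s' := vact_st v v' s.
apply: (act_sub_eq s' s) => x' y' y'' h' h''.
by apply: (u x'); [exists m' | exists m].
Qed.

Lemma codes_mor n (z : tup B (prs n.+1)) m : codes z m -> mor G m.
Proof. by move=> [[h _] _]; have [] := act_sub hG h. Qed.

Lemma cact_dom n (z : tup B (prs n.+1)) m : codes z m -> exists x y, cact z x y.
Proof.
move=> c; have [x [y h]] := act_total (codes_mor c).
by exists x, y, m.
Qed.

Lemma codes_act n (z : tup B (prs n)) m x y : codes z m ->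
  (cact z x y <-> act G m x y).
Proof.
move=> c; split=> [[m' c' h]|h]; last by exists m.
by rewrite (codes_fun c c').
Qed.

(** Equality of coded morphisms is equality of graphs. Nonemptiness must be added, since two tuples
    that are not codes have the same empty graph. *)
Lemma codes_ker n (z z' : tup B (prs n.+1)) :
  (exists2 m, codes z m & codes z' m) <->
  (exists x y, cact z x y) /\ (forall x y, cact z x y <-> cact z' x y).
Proof.
split=> [[m c c']|[[x [y h]] e]].
  by split=> [|x y]; [exact: cact_dom c | rewrite (codes_act _ _ c) (codes_act _ _ c')].
have [m' c' _] := (e x y).1 h; case: h => m c _; exists m => //.
suff -> : m = m' by [].
apply: (act_inj hG) => [||u v]; [exact: codes_mor c | exact: codes_mor c' |].
by rewrite -(codes_act _ _ c) -(codes_act _ _ c').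
Qed.

Lemma vact_list i j m (l : seq (B so)) : st G m i j ->
  (forall a, List.In a l -> pr G a i) ->
  exists2 z : tup B (prs (size l)), vact m z &
    forall m', vact m' z -> forall a b, List.In a l -> act G m a b -> act G m' a b.
Proof.
move=> s; elim: l => [|a l IH] hl /=; first by exists tt.
have [|z v u] := IH; first by move=> b hb; apply: hl; right.
have [b [hb _]] := act_fun hG s (hl a (or_introl erefl)).
exists (a, (b, z)); first by split.
move=> m' [h' v'] a' b' [<-|ha] h; last exact: u v' _ _ ha h.
by rewrite -(act_functional hb h).
Qed.

(* [i0] carries a finite base [l]; any morphism [m] is determined by its values
   on the image of [l] under a morphism from [i0] to the source of [m]. *)
Lemma codes_surj i0 (l : seq (B so)) a0 : obj G i0 ->
  (forall a, List.In a (a0 :: l) -> pr G a i0) ->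
  (forall m, st G m i0 i0 -> (forall a, List.In a (a0 :: l) -> act G m a a) ->
     forall a, pr G a i0 -> act G m a a) ->
  forall m, mor G m -> exists z : tup B (prs (size l).+1), codes z m.
Proof.
move=> h0 hl ff m hm; have [p [q s]] := st_tot hG hm.
have [_ hp _] := st_sub hG s; have [k sk] := st_surj hG h0 hp.
have [l' [e1 [e2 e3]]] : exists l', size l' = size (a0 :: l) /\
    (forall a, List.In a l' -> pr G a p) /\
    (forall a, List.In a (a0 :: l) -> exists2 b, List.In b l' & act G k a b).
  elim: (a0 :: l) hl => [|a r IH] hr; first by exists [::].
  have [|r' [f1 [f2 f3]]] := IH; first by move=> b hb; apply: hr; right.
  have [b [hb _]] := act_fun hG sk (hr a (or_introl erefl)).
  exists (b :: r'); split=> [|] /=; first by rewrite f1.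
  split=> [c [<-|/f2 //]|c [<-|/f3 [d hd hcd]]].
  - by have [] := act_obj hG sk hb.
  - by exists b; [left|].
  - by exists d; [right|].
have [z v u] := vact_list s e2.
move: z v u; rewrite e1 /= => z v u; exists z; split=> // m' v'.
have s' := vact_st (n := size l) v v' s.
have [k' sk' ek'] := act_inv hG sk; have [n sn en] := act_inv hG s'.
(* The composite [t] is k^{-1} m'^{-1} m k, an automorphism of [i0]. It fixes the base, because [m]
   and [m'] agree on the image of the base under [k], so it is the identity on the fibre over
   [i0]. *)
have [t1 st1 et1] := act_comp hG sk s; have [t2 st2 et2] := act_comp hG st1 sn.
have [t st_ et] := act_comp hG st2 sk'.
have tE a c : act G t a c <-> exists b d e,
    [/\ act G k a b, act G m b d, act G m' e d & act G k c e].
  rewrite et; split=> [[e /et2 [d /et1 [b h1 h2] /en h3] /ek' h4]|].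
    by exists b, d, e.
  move=> [b [d [e [h1 h2 h3 h4]]]]; exists e; last exact/ek'.
  by apply/et2; exists d; [apply/et1; exists b | apply/en].
have fixt : forall a, pr G a i0 -> act G t a a.
  apply: ff => // a ha; have [b hb hab] := e3 a ha.
  have [d [hd _]] := act_fun hG s (e2 b hb).
  apply/tE; exists b, d, b; split=> //; exact: u hd.
apply: (act_sub_eq s' s) => x y y' h' h.
have [hx _] := act_obj hG s h.
have [a [ha _]] := act_bij hG sk hx; have [pa _] := act_obj hG sk ha.
have [b [d [e [h1 h2 h3 h4]]]] := (tE a a).1 (fixt a pa).
have eb := act_functional h1 ha; have ee := act_functional h4 ha.
rewrite eb in h2; rewrite ee in h3.
by rewrite (act_functional h' h3) (act_functional h2 h).
Qed.

End Codes.

(** * The cover U' *)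

Section Charts.
Variables (L : language) (U : structure L) (wI wM wO : seq (srt L)).
Variables (G : gpd (tup U wI) (tup U wM) (tup U wO)) (i : tup U wI).
Variable s0 : srt L.

Local Notation U1 := (ext (Defs.cover G i)).
Local Notation U2 := (ext (cover_ind G i)).
Local Notation OO := (tup U wO + Ostar G i)%type.
Local Notation MM := (tup U wM + Mstar G i)%type.
Local Notation II := (tup U wI + unit)%type.

Inductive csort := Base of srt L + unit | SI | SO.

Definition ccar (s : csort) : Type :=
  match s with Base s => U2 s | SI => II | SO => OO end.

(** A code carries coordinates for every summand of a disjoint union, those of the other summand
    being arbitrary; [unit] needs none. *)
Definition cword (s : csort) : seq (srt L + unit) :=
  match s with
  | Base s => [:: s]
  | SI => map inl wI ++ [:: inl s0; inl s0]
  | SO => map inl wO ++ [:: inr tt; inl s0; inl s0]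
  end.

(* Points of I, resp. O, are marked by a pair on the diagonal of the sort [s0],
   and those outside by a pair off the diagonal. *)
Definition crep (s : csort) : tup U2 (cword s) -> ccar s -> Prop :=
  match s return tup U2 (cword s) -> ccar s -> Prop with
  | Base s => fun x b => x.1 = b
  | SI => fun x p =>
      (tsnd x).1 = (tsnd x).2.1 /\ p = inl (tunlift (tfst x)) \/
      (tsnd x).1 <> (tsnd x).2.1 /\ p = inr tt
  | SO => fun x y =>
      (tsnd x).2.1 = (tsnd x).2.2.1 /\ y = inl (tunlift (tfst x)) \/
      (tsnd x).2.1 <> (tsnd x).2.2.1 /\ y = inr (tsnd x).1
  end.

Definition Gs : gpd II MM (ccar SO) := gpd_star G i.

Definition isrt : srt L + unit -> srt L + cover_srt :=
  ind_srt (E := cover_lang wO) (fun _ : unit => Ost).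

Definition iout (s : srt L + unit) : U1 (isrt s) -> U2 s :=
  match s with inl _ => id | inr _ => id end.

Definition iin (s : srt L + unit) : U2 s -> U1 (isrt s) :=
  ind_incl (X := Defs.cover G i) (g := fun _ : unit => Ost) (s := s).

Section InCover.
Hypothesis hact : def0_3 (act G).

Let DU1 : dfam U1 := Dform (U := U1) (fun=> True) (fun=> True).
Let HU1 : defsys DU1 := Dform_defsys U1 _ _.

Lemma racc_tlift v w (g : tup U1 v -> tup U w) :
  racc inl (fun s a => a) g -> bacc (fun x => tlift _ (g x) : tup U1 (map inl w)).
Proof. exact: (@racc_tmap_bacc _ _ U1 U inl (fun s a => a) (fun s a => a)). Qed.

Lemma DU1_lift w (D : tup U w -> Prop) v (g : tup U1 v -> tup U w) :
  def0 D -> racc inl (fun s a => a) g -> DU1 (fun x => D (g x)).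
Proof.
move=> d rg; apply: (ext_lift_acc HU1) d rg => [r|f]; first exact: Dform_rel.
exact: (@Dform_fun _ U1 (fun=> True) (fun=> True) (inl f)).
Qed.

Lemma DU1_act v (gm : tup U1 v -> tup U wM) (ga gb : tup U1 v -> tup U wO) :
  racc inl (fun s a => a) gm -> racc inl (fun s a => a) ga ->
  racc inl (fun s a => a) gb -> DU1 (fun x => act G (gm x) (ga x) (gb x)).
Proof.
move=> rm ra rb; have [phi e] := hact.
have d : def0 (fun x : tup U (wM ++ (wO ++ wO)) =>
    act G (tfst x) (tfst (tsnd x)) (tsnd (tsnd x))).
  by exists phi => x; rewrite e !tcat_fst_snd.
have := DU1_lift (g := fun x => tcat (gm x) (tcat (ga x) (gb x))) d.
move=> d'; apply: (ds_ext HU1) (d' _) _; last by move=> x; rewrite !(tfst_tcat, tsnd_tcat).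
by do !apply: racc_tcat.
Qed.

(** R is split into four symbols according to the summands of its last two places, so it applies
    directly only to terms whose summand [b] is known. *)
Definition ovar v b (f : tup U1 v -> OO) :=
  exists2 g : tup U1 v -> tup U1 (arO wO b), bacc g & forall x, f x = valO (g x).

Lemma DU1_star v (gm : tup U1 v -> Mstar G i) b c (f f' : tup U1 v -> OO) :
  sacc (fun s => s) (fun s a => a) (s := inr Mst) (gm : tup U1 v -> U1 (inr Mst)) ->
  ovar b f -> ovar c f' -> DU1 (fun x => act Gs (inr (gm x)) (f x) (f' x)).
Proof.
move=> rm [g rg eg] [g' rg' eg'].
have d : DU1 _ := @Dform_rel _ U1 (fun=> True) (fun=> True)
  (inr (b, c) : rsym (extlang (cover_lang wO))) I.
apply: (ds_ext HU1) (ds_sub HU1 (v := v)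
  (G := fun x => (gm x, tcat (g x) (g' x)) : tup U1 (inr Mst :: (arO wO b ++ arO wO c))) d _) _.
  by apply: racc_cons => //; apply: racc_tcat.
by move=> x /=; rewrite tfst_tcat tsnd_tcat eg eg'.
Qed.

Lemma DU1_base v (gm : tup U1 v -> tup U wM) b c (f f' : tup U1 v -> OO) :
  racc inl (fun s a => a) gm ->
  ovar b f -> ovar c f' -> DU1 (fun x => act Gs (inl (gm x)) (f x) (f' x)).
Proof.
move=> rm [g rg eg] [g' rg' eg'].
case: b g rg eg => g rg eg; last case: c g' rg' eg' => g' rg' eg'.
- apply: (ds_ext HU1) (ds_false HU1 v) _ => x; rewrite eg.
  by case: (f' x).
- by apply: (ds_ext HU1) (ds_false HU1 v) _ => x; rewrite eg eg'.
- apply: (ds_ext HU1) (DU1_act rm (racc_tunlift rg) (racc_tunlift rg')) _ => x.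
  by rewrite eg eg'.
Qed.

(** The tags of the two codes split the set into four cases, in each of which both points have a
    fixed summand. *)
Lemma DU1_pair v (ga gb : tup U1 v -> tup U2 (cword SO)) (W : tup U1 v -> OO -> OO -> Prop) :
  racc isrt iout ga -> racc isrt iout gb ->
  (forall b c f f', ovar b f -> ovar c f' -> DU1 (fun x => W x (f x) (f' x))) ->
  DU1 (fun x => exists a b, [/\ crep (ga x) a, crep (gb x) b & W x a b]).
Proof.
move=> ra rb dW.
have kind (g : tup U1 v -> tup U2 (cword SO)) : racc isrt iout g ->
    [/\ DU1 (fun x => (tsnd (g x)).2.1 = (tsnd (g x)).2.2.1),
        ovar false (fun x => inl (tunlift (tfst (g x))))
      & ovar true (fun x => inr (tsnd (g x)).1)].
  move=> rg; have rg1 := racc_tfst rg; have rg2 := racc_tsnd rg; split.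
  - apply: (ds_eq HU1 (s := inl s0)).
      exact: (sacc_hd (racc_tl rg2)).
    exact: (sacc_hd (racc_tl (racc_tl rg2))).
  - exists (fun x => tlift _ (tunlift (tfst (g x)))).
      apply: racc_tlift.
      exact: (@racc_tunmap _ _ _ U1 U2 U isrt iout inl (fun s a => a) v wO _ rg1).
    by move=> x; rewrite /valO /tunlift /tlift tmapK.
  - exists (fun x => ((tsnd (g x)).1, tt)) => //.
    apply: racc_cons; last exact: racc_nil.
    exact: (sacc_hd rg2).
have [ka la oa] := kind _ ra; have [kb lb ob] := kind _ rb.
apply: (ds_ext HU1) (ds_or HU1
  (ds_and HU1 ka (ds_or HU1 (ds_and HU1 kb (dW _ _ _ _ la lb))
                          (ds_and HU1 (ds_not HU1 kb) (dW _ _ _ _ la ob))))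
  (ds_and HU1 (ds_not HU1 ka) (ds_or HU1 (ds_and HU1 kb (dW _ _ _ _ oa lb))
                          (ds_and HU1 (ds_not HU1 kb) (dW _ _ _ _ oa ob))))) _ => x.
split.
  by move=> [[h [[h' w]|[h' w]]]|[h [[h' w]|[h' w]]]]; do 2!eexists; split;
    try exact: w; rewrite /crep; tauto.
by move=> [a [b [[[h ->]|[h ->]] [[h' ->]|[h' ->]] w]]]; tauto.
Qed.

Lemma DU1_vact n v (gz : tup U1 v -> tup U2 (flat cword (prs SO n)))
    (gm : tup U1 v -> MM) :
  (forall b c f f', ovar b f -> ovar c f' -> DU1 (fun x => act Gs (gm x) (f x) (f' x))) ->
  racc isrt iout gz ->
  DU1 (fun x => exists2 e, crs crep (gz x) e & vact Gs (gm x) e).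
Proof.
move=> da; elim: n gz => [|n IH] gz rz /=.
  by apply: (ds_ext HU1) (ds_true HU1 v) _ => x; split=> // _; exists tt.
have d1 := DU1_pair (W := fun x => act Gs (gm x))
  (racc_tfst rz) (racc_tfst (racc_tsnd rz)) da.
have d2 := IH _ (racc_tsnd (racc_tsnd rz)).
apply: (ds_ext HU1) (ds_and HU1 d1 d2) _ => x; split.
  by move=> [[a [b [h1 h2 h3]]] [e h4 h5]]; exists (a, (b, e)).
move=> [[a [b e]] [/= h1 [h2 h3]] [h4 h5]].
by split; [exists a, b | exists e].
Qed.

(** In U' the morphism itself can be quantified: over M by a tuple of old variables, over [M_*] by
    one new variable. So this relation on U and [O_*] is among those with which U'' is equipped. *)
Lemma Q_def0 n : def0 (U := U1) (w := map isrt (flat cword (prs SO n)))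
  (fun y => exists2 e, crs crep (tunmap iout y) e & Qv Gs e).
Proof.
suff [phi _ e] : DU1 (w := map isrt (flat cword (prs SO n)))
  (fun y => exists2 e, crs crep (tunmap iout y) e & Qv Gs e) by exists phi.
have d1 : DU1 (w := map isrt (flat cword (prs SO n))) (fun y =>
    exists m : tup U1 (map inl wM), exists2 e,
      crs crep (tunmap iout y) e & vact Gs (inl (tunlift m)) e).
  apply: (ds_ext_tup HU1 (D := fun (m : tup U1 (map inl wM))
      (y : tup U1 (map isrt (flat cword (prs SO n)))) =>
    exists2 e, crs crep (tunmap iout y) e & vact Gs (inl (tunlift m)) e)).
  apply: (DU1_vact (gz := fun y => tunmap iout (tsnd y))
    (gm := fun y => inl (tunlift (tfst y)))).
    move=> b c f f' of_ of'; apply: DU1_base of_ of'.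
    by apply: racc_tunlift; acc.
  by apply: (racc_comp (racc_tunmap0 iout _)); acc.
have d2 : DU1 (w := map isrt (flat cword (prs SO n))) (fun y => exists m : Mstar G i,
    exists2 e, crs crep (tunmap iout y) e & vact Gs (inr m) e).
  apply: (ds_ex HU1 (s := inr Mst) (D := fun (m : U1 (inr Mst)) y =>
    exists2 e, crs crep (tunmap iout y) e & vact Gs (inr m) e)).
  apply: (@DU1_vact n (inr Mst :: map isrt (flat cword (prs SO n)))
    (fun y => tunmap iout y.2) (fun y => inr y.1)).
    move=> b c f f' of_ of'; apply: DU1_star of_ of'.
    by acc.
  by apply: (racc_comp (racc_tunmap0 iout _)); acc.
apply: (ds_ext HU1) (ds_or HU1 d1 d2) _ => y; split.
  by move=> [[m [e c v]]|[m [e c v]]]; exists e => //; eexists; exact: v.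
move=> [e c [[m|m] v]]; last by right; exists m, e.
by left; exists (tlift _ m), e => //; rewrite /tunlift /tlift tmapK.
Qed.

End InCover.
End Charts.

Arguments Base {L} _.
Arguments SI {L}.
Arguments SO {L}.

(** * G' interpreted in U'' *)

Section Interpretation.
Variables (L : language) (U : structure L) (wI wM wO : seq (srt L)).
Variables (G : gpd (tup U wI) (tup U wM) (tup U wO)) (i : tup U wI).
Variable s0 : srt L.
Hypotheses (hG : is_groupoid G) (hi : obj G i).
Hypothesis hs0 : exists c d : U s0, c <> d.

Local Notation U1 := (ext (Defs.cover G i)).
Local Notation U2 := (ext (cover_ind G i)).
Local Notation OO := (tup U wO + Ostar G i)%type.
Local Notation MM := (tup U wM + Mstar G i)%type.
Local Notation II := (tup U wI + unit)%type.
Local Notation ccar := (@ccar L U wI wM wO G i).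
Local Notation crep := (@crep L U wI wM wO G i s0).
Local Notation cword := (@cword L wI wO s0).
Local Notation Gs := (@Gs L U wI wM wO G i).

Lemma hGs : is_groupoid Gs.
Proof. exact: (star_is_groupoid hG hi). Qed.

Lemma crep_fun s x b b' : @crep s x b -> crep x b' -> b = b'.
Proof.
case: s x b b' => [s|| ] x b b' /=; first by move=> -> ->.
  by move=> [[h ->]|[h ->]] [[h' ->]|[h' ->]].
by move=> [[h ->]|[h ->]] [[h' ->]|[h' ->]].
Qed.

Lemma Ostar_inh : exists a : Ostar G i, True.
Proof. by have [a h] := pr_surj hG hi; exists (exist _ a h). Qed.

Lemma crep_surj s b : exists x, @crep s x b.
Proof.
have [c [d cd]] := hs0; have [o _] := Ostar_inh.
case: s b => [s b|[j|[]]|[a|a]] /=; first by exists (b, tt).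
- exists (tcat (tlift _ j) ((c, (c, tt)) : tup U2 [:: inl s0; inl s0])).
  by left; rewrite tsnd_tcat tfst_tcat /tlift /tunlift tmapK.
- exists (tcat (tlift _ i) ((c, (d, tt)) : tup U2 [:: inl s0; inl s0])).
  by right; rewrite tsnd_tcat.
- exists (tcat (tlift _ a) ((o, (c, (c, tt))) : tup U2 [:: inr tt; inl s0; inl s0])).
  by left; rewrite tsnd_tcat tfst_tcat /tlift /tunlift tmapK.
- exists (tcat (tlift _ (sval a)) ((a, (c, (d, tt))) : tup U2 [:: inr tt; inl s0; inl s0])).
  by right; rewrite tsnd_tcat.
Qed.

(** * Charts for the sorts of G', over an arbitrary family on U'' *)

Section OverDefsys.
Variables (Df : dfam U2) (H : defsys Df).
Arguments Df : clear implicits.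
Hypothesis hlift : forall w (D : tup U w -> Prop) v (g : tup U2 v -> tup U w),
  def0 D -> racc inl (fun s a => a) g -> Df v (fun x => D (g x)).

Lemma Df_eq_lift v w (g g' : tup U2 v -> tup U2 (map inl w)) :
  bacc g -> bacc g' -> Df v (fun x => tunlift (g x) = tunlift (g' x) :> tup U w).
Proof.
move=> r r'; apply: (ds_ext H) (ds_eq_tup H r r') _ => x.
split=> [-> //|e]; have : tlift (ncar (cover_ind G i)) (tunlift (g x))
   = tlift (ncar (cover_ind G i)) (tunlift (g' x)) by rewrite e.
by rewrite /tlift /tunlift !tunmapK.
Qed.

Lemma crep_ker s : Df (cword s ++ cword s)
  (fun x => exists2 b, crep (tfst x) b & crep (tsnd x) b).
Proof.
case: s => [s|| ].
- apply: (ds_ext H) (ds_eq0 H s) _.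
  by move=> [a [b []]] /=; split=> [->|[c -> ->]] //; exists b.
- set w := cword SI ++ cword SI.
  have e1 : Df w (fun x => (tsnd (tfst x)).1 = (tsnd (tfst x)).2.1)
    by apply: (ds_eq H (s := inl s0)); acc.
  have e2 : Df w (fun x => (tsnd (tsnd x)).1 = (tsnd (tsnd x)).2.1)
    by apply: (ds_eq H (s := inl s0)); acc.
  have e3 : Df w (fun x => tunlift (tfst (tfst x)) = tunlift (tfst (tsnd x)) :> tup U wI)
    by apply: (@Df_eq_lift w wI (fun x => tfst (tfst x)) (fun x => tfst (tsnd x))); acc.
  apply: (ds_ext H) (ds_or H (ds_and H e1 (ds_and H e2 e3))
    (ds_and H (ds_not H e1) (ds_not H e2))) _ => x; split.
    move=> [[h1 [h2 h3]]|[h1 h2]]; first by exists (inl (tunlift (tfst (tfst x))));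
      left; rewrite // h3.
    by exists (inr tt); right.
  move=> [p [[h ->]|[h ->]] [[h' e]|[h' e]]] //; last by right.
  by left; case: e.
- set w := cword SO ++ cword SO.
  have e1 : Df w (fun x => (tsnd (tfst x)).2.1 = (tsnd (tfst x)).2.2.1)
    by apply: (ds_eq H (s := inl s0)); acc.
  have e2 : Df w (fun x => (tsnd (tsnd x)).2.1 = (tsnd (tsnd x)).2.2.1)
    by apply: (ds_eq H (s := inl s0)); acc.
  have e3 : Df w (fun x => tunlift (tfst (tfst x)) = tunlift (tfst (tsnd x)) :> tup U wO)
    by apply: (@Df_eq_lift w wO (fun x => tfst (tfst x)) (fun x => tfst (tsnd x))); acc.
  have e4 : Df w (fun x => (tsnd (tfst x)).1 = (tsnd (tsnd x)).1)
    by apply: (ds_eq H (s := inr tt)); acc.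
  apply: (ds_ext H) (ds_or H (ds_and H e1 (ds_and H e2 e3))
    (ds_and H (ds_not H e1) (ds_and H (ds_not H e2) e4))) _ => x; split.
    move=> [[h1 [h2 h3]]|[h1 [h2 h3]]]; first by exists (inl (tunlift (tfst (tfst x))));
      left; rewrite // h3.
    by exists (inr (tsnd (tfst x)).1); right; rewrite // h3.
  move=> [p [[h ->]|[h ->]] [[h' e]|[h' e]]] //; first by left; case: e.
  by right; case: e.
Qed.

(** The family [Df] stays abstract because two are used: the sets defined in the small sublanguage,
    and the sets that are definable in U over [i]. *)
Definition Dchart : dfam ccar := Dpull crep Df.
Definition Hchart : defsys Dchart := Dpull_defsys crep_fun crep_surj H crep_ker.

Lemma Dchart_in v w w' (D : tup U2 w -> tup ccar w' -> Prop)
    (g : tup ccar v -> tup U2 w) (f : tup ccar v -> tup ccar w') :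
  Df (w ++ flat cword w') (fun x => exists2 e, crs crep (tsnd x) e & D (tfst x) e) ->
  racc Base (fun s (a : ccar (Base s)) => a) g -> bacc f -> Dchart (fun e => D (g e) (f e)).
Proof.
apply: (@Dpull_in _ U2 _ ccar cword crep crep_fun Df H crep_ker Base (fun s a => a)
  (fun s x => x.1)) => [s|s x b //].
by acc.
Qed.

Lemma racc_Base v w (g : tup ccar v -> tup U w) :
  racc (fun s => Base (inl s)) (fun s a => a) g ->
  racc Base (fun s (a : ccar (Base s)) => a) (fun x => tlift _ (g x) : tup U2 (map inl w)).
Proof.
by apply: (@racc_tmap _ _ _ ccar U U2 Base (fun s a => a) inl
  (fun s => Base (inl s)) (fun s a => a) (fun s a => a) (fun s u y => y)).
Qed.

Lemma Dchart_lift v w (D : tup U w -> Prop) (g : tup ccar v -> tup U w) :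
  def0 D -> racc (fun s => Base (inl s)) (fun s a => a) g -> Dchart (fun e => D (g e)).
Proof.
move=> d rg.
have := @Dchart_in v (map inl w) [::] (fun x _ => D (tunlift x)) _ (fun=> tt) _
  (racc_Base rg) (racc_nil _ _).
move=> h; apply: (ds_ext Hchart) (h _) _.
  have d' := hlift (v := map inl w ++ [::]) (g := fun x => tunlift (tfst x)) d.
  apply: (ds_ext H) (d' _) _.
    by apply: (@racc_tunmap _ _ _ U2 U2 U (fun s => s) (fun s a => a)
      inl (fun s a => a)); acc.
  by move=> x; split=> [Dx|[]//]; exists tt.
by move=> x; rewrite /tunlift /tlift tmapK.
Qed.

Lemma Dchart_isinr v (f : tup ccar v -> ccar SO) : vacc f ->
  Dchart (fun x => exists o, f x = inr o).
Proof.
move=> vf; have d : Dchart (w := [:: SO]) (fun x => exists o, x.1 = inr o).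
  rewrite /Dchart /Dpull /=; set w := _ ++ _.
  have e1 : Df w (fun x => (tsnd (tfst (w := cword SO) x)).2.1
                         = (tsnd (tfst (w := cword SO) x)).2.2.1)
    by apply: (ds_eq H (s := inl s0)); acc.
  apply: (ds_ext H) (ds_not H e1) _ => x; split=> [h|].
    by exists (inr (tsnd (tfst (w := cword SO) x)).1, tt); [split=> //; right | eexists].
  by move=> [[b []] [[[h /= e]|[h //]] _] [o /= e']]; rewrite e in e'.
by dsub Hchart d (fun x => (f x, tt)).
Qed.

Lemma Dchart_inl v (g : tup ccar v -> tup U wO) (f : tup ccar v -> ccar SO) :
  racc (fun s => Base (inl s)) (fun s a => a) g -> vacc f ->
  Dchart (fun x => f x = inl (g x)).
Proof.
move=> rg vf.
have := @Dchart_in v (map inl wO) [:: SO] (fun a e => e.1 = inl (tunlift a)) _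
  (fun x => (f x, tt)) _ (racc_Base rg) (racc_cons vf (racc_nil _ (fun=> tt))).
move=> h; apply: (ds_ext Hchart) (h _) _; last by move=> x; rewrite /tunlift /tlift tmapK.
set w := _ ++ _.
have e1 : Df w (fun x => (tsnd (tfst (w := cword SO) (tsnd x))).2.1
                       = (tsnd (tfst (w := cword SO) (tsnd x))).2.2.1)
  by apply: (ds_eq H (s := inl s0)); acc.
have e3 : Df w (fun x => tunlift (tfst x)
                       = tunlift (tfst (tfst (w := cword SO) (tsnd x))) :> tup U wO).
  by apply: (@Df_eq_lift w wO (fun x => tfst x)
      (fun x => tfst (tfst (w := cword SO) (tsnd x)))); acc.
apply: (ds_ext H) (ds_and H e1 e3) _ => x; split=> [[h1 h2]|].
  exists (inl (tunlift (tfst x)), tt) => //; split=> //; left.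
  by rewrite h2.
by move=> [[b []] [[[h1 /= e]|[h1 /= e]] _] /= e']; rewrite e in e' => //; case: e'.
Qed.

Lemma Dchart_inr v (g : tup ccar v -> ccar (Base (inr tt))) (f : tup ccar v -> ccar SO) :
  vacc g -> vacc f -> Dchart (fun x => f x = inr (g x)).
Proof.
move=> vg vf; have d : Dchart (w := [:: Base (inr tt); SO]) (fun x => x.2.1 = inr x.1).
  rewrite /Dchart /Dpull /=; set w := _ :: _.
  have e1 : Df w (fun x => (tsnd (tfst (w := cword SO) x.2)).2.1
                         = (tsnd (tfst (w := cword SO) x.2)).2.2.1)
    by apply: (ds_eq H (s := inl s0)); acc.
  have e2 : Df w (fun x => (tsnd (tfst (w := cword SO) x.2)).1 = x.1)
    by apply: (ds_eq H (s := inr tt)); acc.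
  apply: (ds_ext H) (ds_and H (ds_not H e1) e2) _ => x; split=> [[h1 h2]|].
    exists (x.1, (inr x.1, tt)); split=> //; split=> //; right.
    by rewrite h2.
  move=> [[o [b []]] /= [<- [[[h /= e]|[h e]] _]] e']; rewrite e in e' => //.
  by case: e'.
by dsub Hchart d (fun x => (g x, (f x, tt))).
Qed.

Lemma Dchart_inlI v (g : tup ccar v -> tup U wI) (f : tup ccar v -> ccar SI) :
  racc (fun s => Base (inl s)) (fun s a => a) g -> vacc f ->
  Dchart (fun x => f x = inl (g x)).
Proof.
move=> rg vf.
have := @Dchart_in v (map inl wI) [:: SI] (fun a e => e.1 = inl (tunlift a)) _
  (fun x => (f x, tt)) _ (racc_Base rg) (racc_cons vf (racc_nil _ (fun=> tt))).
move=> h; apply: (ds_ext Hchart) (h _) _; last by move=> x; rewrite /tunlift /tlift tmapK.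
set w := _ ++ _.
have e1 : Df w (fun x => (tsnd (tfst (w := cword SI) (tsnd x))).1
                       = (tsnd (tfst (w := cword SI) (tsnd x))).2.1)
  by apply: (ds_eq H (s := inl s0)); acc.
have e3 : Df w (fun x => tunlift (tfst x)
                       = tunlift (tfst (tfst (w := cword SI) (tsnd x))) :> tup U wI).
  by apply: (@Df_eq_lift w wI (fun x => tfst x)
      (fun x => tfst (tfst (w := cword SI) (tsnd x)))); acc.
apply: (ds_ext H) (ds_and H e1 e3) _ => x; split=> [[h1 h2]|].
  exists (inl (tunlift (tfst x)), tt) => //; split=> //; left.
  by rewrite h2.
by move=> [[b []] [[[h1 /= e]|[h1 /= e]] _] /= e']; rewrite e in e' => //; case: e'.
Qed.

Definition untup w : tup ccar (map (fun s => Base (inl s)) w) -> tup U w :=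
  tunmap (A := U) (B := ccar) (g := fun s => Base (inl s)) (fun s a => a) (w := w).

Lemma racc_untup v w (g : tup ccar v -> tup ccar (map (fun s => Base (inl s)) w)) :
  bacc g -> racc (fun s => Base (inl s)) (fun s a => a)
    (fun x => untup (g x)).
Proof.
exact: (@racc_tunmap _ _ _ ccar ccar U (fun s => s) (fun s a => a)
  (fun s => Base (inl s)) (fun s a => a)).
Qed.

Lemma Dchart_ex_tup v w (D : tup U w -> tup ccar v -> Prop) :
  Dchart (w := map (fun s => Base (inl s)) w ++ v)
    (fun x => D (untup (tfst x)) (tsnd x)) ->
  Dchart (fun x => exists a, D a x).
Proof.
move=> d; have := ds_ext_tup Hchart (D := fun a x => D (untup a) x) d.
move=> d'; apply: (ds_ext Hchart) d' _ => x; split=> [[a Da]|[a Da]].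
  by eexists; exact: Da.
by exists (tmap (B := ccar) (g := fun s => Base (inl s)) (fun s a => a) a); rewrite /untup tmapK.
Qed.

Lemma Dchart_pr v (f : tup ccar v -> ccar SO) (g : tup ccar v -> ccar SI) :
  def0_2 (pr G) -> vacc f -> vacc g -> Dchart (fun x => pr Gs (f x) (g x)).
Proof.
move=> [phi hphi] vf vg.
have d1 : Dchart (fun x : tup ccar v => exists a : tup U wO, exists j : tup U wI,
    f x = inl a /\ (g x = inl j /\ pr G a j)).
  apply: Dchart_ex_tup; apply: Dchart_ex_tup; apply: (ds_and Hchart).
    apply: Dchart_inl; last by apply: (sacc_comp vf); acc.
    by apply: racc_untup; acc.
  apply: (ds_and Hchart).
    apply: Dchart_inlI; last by apply: (sacc_comp vg); acc.
    by apply: racc_untup; acc.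
  set w := _ ++ _.
  have d : def0 (fun x : tup U (wO ++ wI) => pr G (tfst x) (tsnd x)).
    by exists phi => x; rewrite hphi tcat_fst_snd.
  have := Dchart_lift (v := w) (g := fun x => tcat (untup (tfst (tsnd x))) (untup (tfst x))) d.
  move=> d'; apply: (ds_ext Hchart) (d' _) _ => [|x].
    by apply: racc_tcat; apply: racc_untup; acc.
  by rewrite tfst_tcat tsnd_tcat.
have d2 : Dchart (w := [:: SO; SI])
    (fun x => (exists o, x.1 = inr o) /\ x.2.1 = inr tt).
  apply: (ds_and Hchart); first by apply: Dchart_isinr; acc.
  apply: (ds_ext Hchart) (ds_not Hchart (Dchart_ex_tup (w := wI) (v := [:: SO; SI])
    (D := fun j x => x.2.1 = inl j) _)) _.
    by apply: Dchart_inlI; [apply: racc_untup | ]; acc.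
  move=> [a [[j|[]] []]] /=; first by split=> // -[]; exists j.
  by split=> // _ [].
have d3 : Dchart (fun x : tup ccar v => (exists o, f x = inr o) /\ g x = inr tt).
  by dsub Hchart d2 (fun x => (f x, (g x, tt))).
apply: (ds_ext Hchart) (ds_or Hchart d1 d3) _ => x /=; split.
  by move=> [[a [j [-> [-> h]]]]|[[o ->] ->]].
case: (f x) (g x) => [a|a] [j|[]] //= h; first by left; exists a, j.
by right; split=> //; exists a.
Qed.


(** One interpretation serves two purposes: the sorts [Old] recover U', for generation of the
    language, and [NI], [NO], [NM] hold the indices, points and morphisms of G'. *)
Inductive gsort := Old of srt L + cover_srt | NI | NO | NM.

Definition gcar (s : gsort) : Type :=
  match s with
  | Old s => U1 s | NI => II | NO => OO | NM => {m : MM | mor Gs m}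
  end.

Section WithQ.
Variable n : nat.
Hypothesis hQ : Dchart (w := prs SO n.+2) (Qv Gs (n := n.+2)).
Hypothesis hcodes : forall m, mor Gs m -> exists z : tup ccar (prs SO n.+1), codes Gs z m.
Hypothesis hpr : def0_2 (pr G).

Definition gword (s : gsort) : seq (csort L) :=
  match s with
  | Old (inl s) => [:: Base (inl s)]
  | Old (inr Ost) => [:: Base (inr tt)]
  | NI => [:: SI]
  | NO => [:: SO]
  | Old (inr Mst) | NM => prs SO n.+1
  end.

(* M_* is not a sort of U'': its elements are represented by their values on
   a finite base. *)
Definition grep (s : gsort) : tup ccar (gword s) -> gcar s -> Prop :=
  match s return tup ccar (gword s) -> gcar s -> Prop with
  | Old s => match s return tup ccar (gword (Old s)) -> gcar (Old s) -> Prop with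
    | inl s => fun x b => x.1 = b
    | inr Ost => fun x b => x.1 = b
    | inr Mst => fun x b => codes Gs (n := n.+1) x (inr b)
    end
  | NI => fun x b => x.1 = b
  | NO => fun x b => x.1 = b
  | NM => fun x b => codes Gs (n := n.+1) x (sval b)
  end.

Lemma grep_fun s x b b' : @grep s x b -> grep x b' -> b = b'.
Proof.
case: s x b b' => [[s|[]]|||] x b b' /=; try by move=> -> ->.
  by move=> c c'; case: (codes_fun c c').
by move=> c c'; apply: sval_inj_prop; apply: codes_fun c c'.
Qed.

Lemma grep_surj s b : exists x, @grep s x b.
Proof.
case: s b => [[s|[]]|||] b /=; try by exists (b, tt).
  exact: (@hcodes (inr b)).
by apply: hcodes; case: b.
Qed.

Lemma Dchart_cact v (gz : tup ccar v -> tup ccar (prs SO n.+1)) (f f' : tup ccar v -> ccar SO) :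
  bacc gz -> vacc f -> vacc f' -> Dchart (fun x => cact Gs (gz x) (f x) (f' x)).
Proof.
move=> rz vf vf'.
have q u (gz' : tup ccar u -> tup ccar (prs SO n.+1)) (k k' : tup ccar u -> ccar SO) :
    bacc gz' -> vacc k -> vacc k' -> Dchart (fun x => Qv Gs (n := n.+2) (k x, (k' x, gz' x))).
  by move=> r1 r2 r3; dsub Hchart hQ (fun x => (k x, (k' x, gz' x))).
have d : Dchart (fun x : tup ccar v => forall x' y' y'',
    Qv Gs (n := n.+2) (x', (y', gz x)) -> Qv Gs (n := n.+2) (x', (y'', gz x)) ->
    y' = y'').
  do 3!apply: (ds_all Hchart).
  have rz' : bacc (fun x : tup ccar [:: SO, SO, SO & v] => gz x.2.2.2).
    by apply: (racc_comp rz); acc.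
  apply: (ds_imp Hchart); first by apply: q => //; acc.
  apply: (ds_imp Hchart); first by apply: q => //; acc.
  by apply: (ds_eq Hchart); acc.
apply: (ds_ext Hchart) (ds_and Hchart (q _ _ _ _ rz vf vf') d) _ => x.
by rewrite (cactP hGs (gz x) (f x) (f' x)).
Qed.

Lemma Dchart_ker v (gz gz' : tup ccar v -> tup ccar (prs SO n.+1)) :
  bacc gz -> bacc gz' ->
  Dchart (fun x => exists2 m, codes Gs (gz x) m & codes Gs (gz' x) m).
Proof.
move=> r r'.
have d1 : Dchart (fun v0 : tup ccar v => exists x y, cact Gs (gz v0) x y).
  do 2!apply: (ds_ex Hchart); apply: Dchart_cact; try by acc.
  by apply: (racc_comp r); acc.
have d2 : Dchart (fun v0 : tup ccar v =>
    forall x y, cact Gs (gz v0) x y <-> cact Gs (gz' v0) x y).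
  do 2!apply: (ds_all Hchart); apply: (ds_iff Hchart); apply: Dchart_cact; try by acc.
    by apply: (racc_comp r); acc.
  by apply: (racc_comp r'); acc.
apply: (ds_ext Hchart) (ds_and Hchart d1 d2) _ => x.
by rewrite (codes_ker hGs (gz x) (gz' x)).
Qed.

(** A morphism lies in [M_*] exactly when one of its ends is [O_*], and a single pair of its graph
    shows this. *)
Lemma codes_inr (z : tup ccar (prs SO n.+1)) m : codes Gs z m ->
  ((exists mk, m = inr mk) <->
   exists x y, cact Gs z x y /\ ((exists o, x = inr o) \/ exists o, y = inr o)).
Proof.
move=> c; split=> [[mk e]|[x [y [/(codes_act _ _ c) h o]]]].
  have [x [y h]] := act_total hGs (codes_mor hGs c).
  exists x, y; split; first exact/(codes_act _ _ c).
  rewrite e in h; case: h => -[p [q [s hx hy]]] _.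
  case: p q s hx hy => [j|[]] [j'|[]] //; rewrite /star_st; first by case: (sval mk).
  + by case: y => // o _ _; right; exists o.
  + by case: x => // o _ _; left; exists o.
  + by case: x => // o _ _; left; exists o.
case: m h {c} => [m|mk] h; last by exists mk.
by case: x y h o => [a|a] [b|b] //= _ [[]|[]].
Qed.

Lemma Dchart_ker_inr v (gz gz' : tup ccar v -> tup ccar (prs SO n.+1)) :
  bacc gz -> bacc gz' ->
  Dchart (fun x => exists2 m, codes Gs (gz x) (inr m) & codes Gs (gz' x) (inr m)).
Proof.
move=> r r'.
have d : Dchart (fun v0 : tup ccar v => exists x y, cact Gs (gz v0) x y /\
    ((exists o, x = inr o) \/ exists o, y = inr o)).
  do 2!apply: (ds_ex Hchart); apply: (ds_and Hchart).
    by apply: Dchart_cact; try (by acc); apply: (racc_comp r); acc.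
  by apply: (ds_or Hchart); apply: Dchart_isinr; acc.
apply: (ds_ext Hchart) (ds_and Hchart (Dchart_ker r r') d) _ => x; split.
  move=> [[m c c'] /(codes_inr c) [mk e]].
  by exists mk; rewrite -e.
move=> [mk c c']; split; first by exists (inr mk).
by apply/(codes_inr c); exists mk.
Qed.

Lemma grep_ker s : Dchart (w := gword s ++ gword s)
  (fun x => exists2 b, grep (tfst x) b & grep (tsnd x) b).
Proof.
have E t : Dchart (w := [:: t; t]) (fun x => exists2 b, x.1 = b & x.2.1 = b).
  by apply: (ds_ext Hchart) (ds_eq0 Hchart t) _ => x; split=> [e|[b -> ->]//]; exists x.2.1.
case: s => [[s|[]]|||] /=; try exact: E.
  by apply: Dchart_ker_inr; acc.
have d : Dchart (w := prs SO n.+1 ++ prs SO n.+1)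
    (fun x => exists2 m, codes Gs (tfst x) m & codes Gs (tsnd x) m).
  by apply: Dchart_ker; acc.
apply: (ds_ext Hchart) d _ => x; split=> [[m c c']|[b c c']]; last by exists (sval b).
by exists (exist _ m (codes_mor hGs c)).
Qed.

Definition Dgpd : dfam gcar := Dpull grep Dchart.
Definition Hgpd : defsys Dgpd := Dpull_defsys grep_fun grep_surj Hchart grep_ker.

Definition gbase (s : csort L) : gsort :=
  match s with
  | Base (inl s) => Old (inl s)
  | Base (inr _) => Old (inr Ost)
  | SI => NI
  | SO => NO
  end.

Definition gbase_out (s : csort L) : gcar (gbase s) -> ccar s :=
  match s with
  | Base s => match s return gcar (gbase (Base s)) -> ccar (Base s) with
     inl _ => id | inr _ => id end
  | SI => id | SO => id
  end.

Definition gbase_get (s : csort L) : tup ccar (gword (gbase s)) -> ccar s :=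
  match s with
  | Base s => match s return tup ccar (gword (gbase (Base s))) -> ccar (Base s) with
     inl _ => fun x => x.1 | inr tt => fun x => x.1 end
  | SI => fun x => x.1 | SO => fun x => x.1
  end.

Lemma Dgpd_in v w w' (D : tup ccar w -> tup gcar w' -> Prop)
    (g : tup gcar v -> tup ccar w) (f : tup gcar v -> tup gcar w') :
  Dchart (w := w ++ flat gword w') (fun x => exists2 e, crs grep (tsnd x) e & D (tfst x) e) ->
  racc gbase gbase_out g -> bacc f -> Dgpd (fun e => D (g e) (f e)).
Proof.
apply: (@Dpull_in _ ccar _ gcar gword grep grep_fun Dchart Hchart grep_ker
  gbase gbase_out gbase_get).
  by case=> [[s|[]]||] /=; acc.
by case=> [[s|[]]||] x b /= ->.
Qed.

Lemma Dgpd_in0 v w (D : tup ccar w -> Prop) (g : tup gcar v -> tup ccar w) :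
  Dchart D -> racc gbase gbase_out g -> Dgpd (fun e => D (g e)).
Proof.
apply: (@Dpull_in0 _ ccar _ gcar gword grep grep_fun Dchart Hchart grep_ker
  gbase gbase_out gbase_get).
  by case=> [[s|[]]||] /=; acc.
by case=> [[s|[]]||] x b /= ->.
Qed.

Lemma Dgpd_act v (fm : tup gcar v -> gcar NM) (f f' : tup gcar v -> gcar NO) :
  vacc fm -> vacc f -> vacc f' -> Dgpd (fun x => act Gs (sval (fm x)) (f x) (f' x)).
Proof.
move=> vm vf vf'.
have := @Dgpd_in v [:: SO; SO] [:: NM] (fun a e => act Gs (sval e.1) a.1 a.2.1)
  (fun x => (f x, (f' x, tt))) (fun x => (fm x, tt)).
apply; [|apply: racc_cons; [exact: vf|apply: racc_cons; [exact: vf'|exact: racc_nil]]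
  | by acc].
set w := _ ++ _.
have d : Dchart (w := w) (fun x => cact Gs (n := n.+1) (tfst (w := prs SO n.+1) x.2.2) x.1 x.2.1).
  by apply: Dchart_cact; acc.
apply: (ds_ext Hchart) d _ => x; split=> [[m c h]|[[m []] /= [c _] h]].
  by exists (exist _ m (codes_mor hGs c), tt).
by exists (sval m).
Qed.

Lemma Dgpd_pr v (f : tup gcar v -> gcar NO) (g : tup gcar v -> gcar NI) :
  vacc f -> vacc g -> Dgpd (fun x => pr Gs (f x) (g x)).
Proof.
move=> vf vg.
have d : Dchart (w := [:: SO; SI]) (fun x => pr Gs x.1 x.2.1) by apply: (Dchart_pr hpr); acc.
have := @Dgpd_in0 v [:: SO; SI] _ (fun x => (f x, (g x, tt))) d; apply.
by apply: racc_cons; [exact: vf|apply: racc_cons; [exact: vg|exact: racc_nil]].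
Qed.

Lemma racc_Old v w (g : tup gcar v -> tup U w) :
  racc (fun s => Old (inl s)) (fun s a => a) g ->
  racc gbase gbase_out
    (fun x => tmap (B := ccar) (g := fun s => Base (inl s)) (fun s a => a) (g x)).
Proof.
by apply: (@racc_tmap _ _ _ gcar U ccar gbase gbase_out (fun s => Base (inl s))
  (fun s => Old (inl s)) (fun s a => a) (fun s a => a) (fun s u y => y)).
Qed.

Lemma Dgpd_lift v w (D : tup U w -> Prop) (g : tup gcar v -> tup U w) :
  def0 D -> racc (fun s => Old (inl s)) (fun s a => a) g -> Dgpd (fun e => D (g e)).
Proof.
move=> d rg.
have d0 : Dchart (fun x => D (untup (w := w) x)).
  by apply: Dchart_lift d _; apply: racc_untup; acc.
apply: (ds_ext Hgpd) (Dgpd_in0 d0 (racc_Old rg)) _ => x.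
by rewrite /untup tmapK.
Qed.

Lemma Dgpd_inl v (g : tup gcar v -> tup U wO) (f : tup gcar v -> gcar NO) :
  racc (fun s => Old (inl s)) (fun s a => a) g -> vacc f ->
  Dgpd (fun x => f x = inl (g x)).
Proof.
move=> rg vf; set w := map (fun s => Base (inl s)) wO.
have d0 : Dchart (w := SO :: w) (fun x => x.1 = inl (untup x.2)).
  by apply: Dchart_inl; [apply: racc_untup | ]; acc.
have := @Dgpd_in0 v (SO :: w) _ (fun x => (f x, _)) d0 (racc_cons _ (racc_Old rg)).
move=> d; apply: (ds_ext Hgpd) (d _) _ => [|x]; first exact: vf.
by rewrite /= /untup tmapK.
Qed.

Lemma Dgpd_inlI v (g : tup gcar v -> tup U wI) (f : tup gcar v -> gcar NI) :
  racc (fun s => Old (inl s)) (fun s a => a) g -> vacc f ->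
  Dgpd (fun x => f x = inl (g x)).
Proof.
move=> rg vf; set w := map (fun s => Base (inl s)) wI.
have d0 : Dchart (w := SI :: w) (fun x => x.1 = inl (untup x.2)).
  by apply: Dchart_inlI; [apply: racc_untup | ]; acc.
have := @Dgpd_in0 v (SI :: w) _ (fun x => (f x, _)) d0 (racc_cons _ (racc_Old rg)).
move=> d; apply: (ds_ext Hgpd) (d _) _ => [|x]; first exact: vf.
by rewrite /= /untup tmapK.
Qed.

Lemma Dgpd_inr v (g : tup gcar v -> gcar (Old (inr Ost))) (f : tup gcar v -> gcar NO) :
  vacc g -> vacc f -> Dgpd (fun x => f x = inr (g x)).
Proof.
move=> vg vf.
have d0 : Dchart (w := [:: Base (inr tt); SO]) (fun x => x.2.1 = inr x.1).
  by apply: Dchart_inr; acc.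
have := @Dgpd_in0 v [:: Base (inr tt); SO] _ (fun x => (g x, (f x, tt))) d0; apply.
by apply: racc_cons; [exact: vg|apply: racc_cons; [exact: vf|exact: racc_nil]].
Qed.

(** An element of [M_*] and its copy in [NM] have the same codes, so this is the kernel relation
    between codes of the two sorts. *)
Lemma Dgpd_inrM v (g : tup gcar v -> gcar (Old (inr Mst))) (f : tup gcar v -> gcar NM) :
  vacc g -> vacc f -> Dgpd (fun x => sval (f x) = inr (g x)).
Proof.
move=> vg vf.
have d1 : Dgpd (w := [:: Old (inr Mst); NM]) (fun x => sval x.2.1 = inr x.1).
  have := @Dgpd_in [:: Old (inr Mst); NM] [::] [:: Old (inr Mst); NM]
    (fun _ x => sval x.2.1 = inr x.1) (fun=> tt) (fun x => x).
  apply; [|exact: racc_nil|exact: racc_id].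
  set w := _ ++ _.
  have d0 : Dchart (w := w) (fun x => exists2 m,
    codes Gs (n := n.+1) (tfst (w := prs SO n.+1) x) (inr m) &
    codes Gs (n := n.+1) (tfst (w := prs SO n.+1) (tsnd (w := prs SO n.+1) x)) (inr m)).
    by apply: Dchart_ker_inr; acc.
  apply: (ds_ext Hchart) d0 _ => x; split=> [[m c c']|].
    by exists (m, (exist _ (inr m) (codes_mor hGs c'), tt)).
  by move=> [[m [m' []]] /= [c [c' _]] e]; exists m => //; rewrite -e.
by dsub Hgpd d1 (fun x => (g x, (f x, tt))).
Qed.

End WithQ.
End OverDefsys.

End Interpretation.

Arguments Old {L} _.
Arguments NI {L}.
Arguments NO {L}.
Arguments NM {L}.

(** * Finite generation, internality, automorphisms and U''^eq *)

Section Induced.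
Variables (L : language) (U : structure L) (wI wM wO : seq (srt L)).
Variables (G : gpd (tup U wI) (tup U wM) (tup U wO)) (i : tup U wI).
Variable s0 : srt L.
Hypotheses (hG : is_groupoid G) (hi : obj G i).
Hypothesis hs0 : exists c d : U s0, c <> d.

Local Notation U1 := (ext (Defs.cover G i)).
Local Notation U2 := (ext (cover_ind G i)).
Local Notation OO := (tup U wO + Ostar G i)%type.
Local Notation MM := (tup U wM + Mstar G i)%type.
Local Notation II := (tup U wI + unit)%type.
Local Notation ccar := (@ccar L U wI wM wO G i).
Local Notation crep := (@crep L U wI wM wO G i s0).
Local Notation cword := (@cword L wI wO s0).
Local Notation Gs := (@Gs L U wI wM wO G i).
Local Notation isrt := (@isrt L wO).
Local Notation iout := (@iout L U wI wM wO G i).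
Local Notation iin := (@iin L U wI wM wO G i).

Variable n : nat.
Variable phiQ : formula (L := extlang (cover_lang wO)) (map isrt (flat cword (prs SO n.+2))).
Hypothesis hphiQ : forall y : tup U1 (map isrt (flat cword (prs SO n.+2))),
  (exists2 e, crs crep (tunmap iout y) e & Qv Gs (n := n.+2) e) <-> sat phiQ y.
Hypothesis hcodes : forall m, mor Gs m -> exists z : tup ccar (prs SO n.+1), codes Gs z m.
Hypothesis hpr : def0_2 (pr G).

Local Notation L2 := (extlang (ind_lang (E := cover_lang wO) (fun _ : unit => Ost))).

(** The new symbols of U'' are formulas of U'; the generating one is [phiQ] itself. *)
Definition qsym : nrsym (ind_lang (E := cover_lang wO) (fun _ : unit => Ost)) :=
  existT _ (flat cword (prs SO n.+2)) phiQ.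

Definition FQ : Defs.fsym L2 -> Prop := fun=> True.
Definition RQ (r : rsym L2) : Prop := if r is inr r then r = qsym else True.

Definition DQ : dfam U2 := Dform (U := U2) FQ RQ.
Definition HQ : defsys DQ := Dform_defsys U2 FQ RQ.

Lemma DQ_lift w (D : tup U w -> Prop) v (g : tup U2 v -> tup U w) :
  def0 D -> racc inl (fun s a => a) g -> DQ (fun x => D (g x)).
Proof.
move=> d rg; apply: (ext_lift_acc HQ) d rg => [r|f].
  exact: (@Dform_rel _ U2 FQ RQ (inl r)).
exact: (@Dform_fun _ U2 FQ RQ (inl f)).
Qed.

Lemma DQ_Q : Dchart s0 DQ (w := prs SO n.+2) (Qv Gs (n := n.+2)).
Proof.
have d := @Dform_rel _ U2 FQ RQ (inr qsym) erefl.
apply: (ds_ext HQ) d _ => x /=.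
by rewrite -hphiQ tmapK //; case.
Qed.

Local Notation gcar := (@gcar L U wI wM wO G i).
Local Notation Dgpd := (@Dgpd L U wI wM wO G i s0 DQ n).
Local Notation Hgpd := (Hgpd hG hi hs0 HQ DQ_Q hcodes).
Local Notation grep := (@grep L U wI wM wO G i n).
Local Notation gword := (@gword L n).

Lemma Dgpd_valO v b (g : tup gcar v -> tup U1 (arO wO b)) (f : tup gcar v -> gcar NO) :
  racc Old (fun s a => a) g -> vacc f -> Dgpd (fun x => f x = valO (g x)).
Proof.
case: b g => g rg vf.
  apply: (Dgpd_inr hG hi hs0 HQ DQ_Q); last exact: vf.
  exact: (sacc_hd rg).
apply: (Dgpd_inl hG hi hs0 HQ DQ_Q hcodes); last exact: vf.
exact: (@racc_tunmap _ _ _ gcar U1 U Old (fun s a => a) inl (fun s a => a) _ _ _ rg).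
Qed.


Definition Dcover : dfam U1 := Dreindex (A0 := U1) Dgpd (g := Old) (fun s a => a).
Definition Hcover : defsys Dcover := @Dreindex_defsys _ _ _ U1 _ Hgpd Old (fun s a => a)
  (fun s a => a) (fun _ _ => erefl) (fun _ _ => erefl).

Lemma Dcover_lift w (D : tup U w -> Prop) v (g : tup gcar v -> tup U w) :
  def0 D -> racc (fun s => Old (inl s)) (fun s a => a) g -> Dgpd (fun x => D (g x)).
Proof. exact: (Dgpd_lift hG hi hs0 HQ DQ_lift DQ_Q hcodes). Qed.

Lemma racc_Old_tunlift v w (g : tup gcar v -> tup U1 (map inl w)) :
  racc Old (fun s a => a) g ->
  racc (fun s => Old (inl s)) (fun s a => a) (fun x => tunlift (g x) : tup U w).
Proof.
exact: (@racc_tunmap _ _ _ gcar U1 U Old (fun s a => a) inl (fun s a => a)).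
Qed.

Lemma racc_unOld w : racc Old (fun s a => a)
  (tunmap (A := U1) (B := gcar) (g := Old) (fun s a => a) (w := w)).
Proof. exact: (@racc_tunmap0 _ _ gcar U1 Old (fun s a => a)). Qed.

(** By [sat_in] it is enough to interpret the symbols of L and the four symbols of R. The latter say
    that an element of [NM] lying over the given element of [M_*] maps one point to the other. *)
Lemma Dcover_cover w (phi : formula (L := extlang (cover_lang wO)) w) :
  Dcover (sat (U := U1) phi).
Proof.
have [psi u e] := @def0_full _ U1 w (sat phi) (ex_intro _ phi (fun=> iff_refl _)).
apply: (ds_ext Hcover) (sat_in Hcover _ _ u) _; last by move=> x; rewrite e.
- case=> [r|[b c]] _ /=.
    apply: (Dcover_lift (D := @rint L U r) (g := fun x => tunlift (tunmap _ x))).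
      by have [psi' _ e'] := @Dform_rel _ U (fun=> True) (fun=> True) r I; exists psi'.
    by apply: racc_Old_tunlift; exact: racc_unOld.
  rewrite /Dcover /Dreindex /=.
  set w0 := Old (inr Mst) :: map Old (arO wO b ++ arO wO c).
  pose un x := tunmap (A := U1) (B := gcar) (g := Old) (fun s a => a)
    (w := arO wO b ++ arO wO c) x.
  have run : racc Old (fun s a => a) un by exact: racc_unOld.
  have d : Dgpd (w := w0) (fun y =>
      exists (a : gcar NO) (a' : gcar NO) (m : gcar NM),
      [/\ a = valO (tfst (un y.2)), a' = valO (tsnd (un y.2)) &
          sval m = inr y.1 /\ act Gs (sval m) a a']).
    do 3!apply: (ds_ex Hgpd).
    set w1 := [:: NM, NO, NO & w0].
    have r1 : racc Old (fun s a => a) (fun x : tup gcar w1 => un x.2.2.2.2).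
      by apply: (racc_comp run); acc.
    have d1 : Dgpd (w := w1) (fun x => x.2.2.1 = valO (tfst (un x.2.2.2.2))).
      by apply: Dgpd_valO; acc.
    have d2 : Dgpd (w := w1) (fun x => x.2.1 = valO (tsnd (un x.2.2.2.2))).
      by apply: Dgpd_valO; acc.
    have d3 : Dgpd (w := w1) (fun x => sval x.1 = inr x.2.2.2.1).
      by apply: (Dgpd_inrM hG hi hs0 HQ DQ_Q hcodes); acc.
    have d4 : Dgpd (w := w1) (fun x => act Gs (sval x.1) x.2.2.1 x.2.1).
      by apply: (Dgpd_act hG hi hs0 HQ DQ_Q); acc.
    apply: (ds_ext Hgpd) (ds_and Hgpd d1 (ds_and Hgpd d2 (ds_and Hgpd d3 d4))) _ => x.
    by split=> [[? [? ?]]|[? ? ?]].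
  apply: (ds_ext Hgpd) d _ => y; split.
    by move=> [a [a' [m [-> -> [-> h]]]]].
  by move=> h; eexists; eexists; exists (exist (mor Gs) (inr y.1) I).
- move=> [f|[]] _ /=; rewrite /Dcover /Dreindex /=.
  pose un x := tunmap (A := U1) (B := gcar) (g := Old) (fun s a => a)
    (w := map inl (fdom f)) x.
  have run : racc Old (fun s a => a) un by exact: racc_unOld.
  apply: (@Dcover_lift (fcod f :: fdom f) (fun x => x.1 = fint x.2)
    (Old (inl (fcod f)) :: map Old (map inl (fdom f)))
    (fun x => (x.1, tunlift (un x.2)))).
    by have [psi' _ e'] := @Dform_fun _ U (fun=> True) (fun=> True) f I; exists psi'.
  apply: racc_cons; first by exists (vz _ _).
  by apply: racc_Old_tunlift; apply: (racc_comp run); acc.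
Qed.

Local Notation cwc := (cwc cword gword).
Local Notation crc := (crc crep grep).

Definition kbo (s : srt L + unit) : gsort L := Old (isrt s).
Definition ko (s : srt L + unit) : gcar (kbo s) -> U2 s := iout (s := s).

Definition bcode (s : srt L + unit) : U2 s -> tup U2 (cwc (kbo s)) :=
  match s return U2 s -> tup U2 (cwc (kbo s)) with
  | inl _ => fun a => (a, tt)
  | inr tt => fun a => (a, tt)
  end.

Lemma racc_bcode v s (f : tup U2 v -> U2 s) : vacc f -> bacc (fun x => bcode (f x)).
Proof.
by case: s f => [s|[]] f vf; apply: racc_cons => //; exact: racc_nil.
Qed.

Lemma crc_bcode s (a : U2 s) b : crc (bcode a) b <-> ko b = a.
Proof.
case: s a b => [s|[]] a b.
  by split=> [[[c []] [/= -> _] <-]|<-] //; exists (b, tt).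
by split=> [[[c []] [/= -> _] <-]|<-] //; exists (b, tt).
Qed.

Fixpoint bflat w w' : tup U2 (w ++ flat cwc w') -> tup U2 (flat cwc (map kbo w ++ w')) :=
  match w with
  | [::] => fun x => x
  | s :: w1 => fun x => tcat (bcode x.1) (bflat x.2)
  end.

Lemma racc_bflat w w' v (g : tup U2 v -> tup U2 (w ++ flat cwc w')) :
  bacc g -> bacc (fun x => bflat (g x)).
Proof.
elim: w v g => [|s w IH] v g rg //=.
apply: racc_tcat; first by apply: racc_bcode; exact: (sacc_hd rg).
by apply: (IH _ (fun x => (g x).2)); exact: (racc_tl rg).
Qed.

Lemma crs_bflat w w' (x : tup U2 (w ++ flat cwc w')) e :
  crs crc (bflat x) e <->
  tunmap ko (tfst e) = tfst x /\ crs crc (tsnd x) (tsnd e).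
Proof.
elim: w x e => [|s w IH] x e /=; first by split=> [|[]].
rewrite tfst_tcat tsnd_tcat crc_bcode IH; split.
  by move=> [-> [-> c]].
by move=> [[-> ->] c].
Qed.

(** The way back from the interpreted sorts to U'': an element of a sort of U'' is its own code, so
    only the remaining sorts are left in coded form. *)
Lemma Dgpd_out w w' (D : tup U2 w -> tup gcar w' -> Prop) :
  Dgpd (w := map kbo w ++ w') (fun e => D (tunmap ko (tfst e)) (tsnd e)) ->
  DQ (w := w ++ flat cwc w') (fun x => exists2 e, crs crc (tsnd x) e & D (tfst x) e).
Proof.
move=> /(Dpull_comp HQ) d; rewrite /Dpull in d.
dsub HQ d (fun x => bflat x); first exact: racc_bflat (racc_id _ _).
move=> x; split.
  by move=> [e /crs_bflat [<- c] De]; exists (tsnd e).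
move=> [e c De]; exists (tcat (tmap (B := gcar) (g := kbo) iin (tfst x)) e).
  by apply/crs_bflat; rewrite tfst_tcat tsnd_tcat tmapK //; case.
by rewrite tfst_tcat tsnd_tcat tmapK //; case.
Qed.

Lemma racc_ko v w (g : tup gcar v -> tup gcar (map kbo w)) :
  bacc g -> racc kbo ko (fun x => tunmap ko (g x)).
Proof.
exact: (@racc_tunmap _ _ _ gcar gcar U2 (fun s => s) (fun s a => a) kbo ko).
Qed.

Lemma DQ_cover w (phi : formula (L := extlang (cover_lang wO)) (map isrt w)) :
  DQ (fun x : tup U2 w => sat phi (tmap iin x)).
Proof.
have d : Dgpd (w := map kbo w ++ [::])
    (fun e => sat phi (tmap iin (tunmap ko (tfst e)))).
  apply: (@Dreindex_out _ _ gcar U1 Dgpd Hgpd Old (fun s a => a) (fun s a => a) _ _ _ _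
    (sat phi) (fun e => tmap iin (tunmap ko (tfst e))) (Dcover_cover phi)) => //.
  apply: (@racc_tmap _ _ _ gcar U2 U1 Old (fun s a => a) isrt kbo ko iin
    (fun s u y => y)).
    by case.
  by apply: racc_ko; acc.
have d' := Dgpd_out (D := fun x (_ : tup gcar [::]) => sat phi (tmap iin x)) d.
dsub HQ d' (fun x : tup U2 w => tcat x (tt : tup U2 [::])).
by move=> x; rewrite tfst_tcat; split=> [[]//|h]; exists tt.
Qed.

(** Each symbol of U'' is a formula of U', already expressed through [qsym] by [DQ_cover];
    quantifiers of U'' then add nothing new. *)
Lemma DQ_all w (phi : formula (L := L2) w) : DQ (sat (U := U2) phi).
Proof.
have [psi u e] := @def0_full _ U2 w (sat phi) (ex_intro _ phi (fun=> iff_refl _)).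
apply: (ds_ext HQ) (sat_in HQ _ _ u) _; last by move=> x; rewrite e.
- case=> [r|[w0 phi0]] _; last exact: DQ_cover.
  exact: (@Dform_rel _ U2 FQ RQ (inl r)).
- by move=> f _; exact: (@Dform_fun _ U2 FQ RQ f).
Qed.

Lemma cover_ind_fg : finitely_generated (cover_ind G i).
Proof.
exists FQ, RQ; split.
- by exists [::] => -[].
- by exists [:: qsym] => r /= ->; left.
- move=> w phi; have [psi u e] := DQ_all phi.
  by exists psi.
Qed.


Lemma id_mor : exists2 m, st G m i i & forall a b, act G m a b <-> pr G a i /\ a = b.
Proof.
have [m s] := st_surj hG hi hi; have [m' s' e'] := act_inv hG s.
have [d sd ed] := act_comp hG s s'; exists d => // a b; rewrite ed; split.
  move=> [c h /e' h']; have [ha _] := act_obj hG s h; split=> //.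
  exact: (act_injective hG h h').
move=> [ha <-]; have [c [hc _]] := act_fun hG s ha.
by exists c => //; apply/e'.
Qed.

(** The identity of [O_i], lifted with source [O_*] and target [O_i], is the identification [sval].
    It is thus a morphism of G' and has a code in U''. *)
Lemma iota_mor : exists2 m : {m | mor Gs m}, st Gs (sval m) (inr tt) (inl i) &
  forall o a, act Gs (sval m) (inr o) (inl a) <-> sval o = a.
Proof.
have [m0 s0' e0] := id_mor.
have [m s em] := @st_mk _ _ _ G i m0 (inr tt) (inl i) s0'.
have [hm _ _] := st_star_sub hG s.
exists (exist _ m hm) => // o a; rewrite (act_st hG _ _ s) em /=.
split=> [[_ _ /e0 [] //]|<-]; split=> //; first exact: (svalP o).
by apply/e0; split=> //; exact: (svalP o).
Qed.

Lemma crc_fun2 s x b b' : @crc s x b -> crc x b' -> b = b'.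
Proof. exact: crc_fun (@crep_fun _ _ _ _ _ _ _ _) (@grep_fun _ _ _ _ _ _ _ _) s x b b'. Qed.

Lemma crc_surj2 s b : exists x, @crc s x b.
Proof. exact: (crc_surj (crep_surj hG hi hs0) (grep_surj hcodes)). Qed.

Lemma racc_kbo_lift v w (g : tup gcar v -> tup gcar (map kbo (map inl w))) :
  bacc g ->
  racc (fun s => Old (inl s)) (fun s a => a)
    (fun x => tunlift (tunmap ko (g x)) : tup U w).
Proof.
move=> rg.
exact: (@racc_tunmap _ _ _ gcar U2 U kbo ko inl (fun s a => a) _ _ _ (racc_ko rg)).
Qed.

Definition jrel (x : tup U2 (inr tt :: map inl wO)) (e : tup gcar [:: NM]) : Prop :=
  act Gs (sval e.1) (inr x.1) (inl (tunlift x.2)).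

Lemma DQ_jrel : DQ (w := inr tt :: map inl wO ++ flat cwc [:: NM])
  (fun x => exists2 e, crs crc (tsnd (w := inr tt :: map inl wO) x) e &
     jrel (tfst (w := inr tt :: map inl wO) x) e).
Proof.
apply: (@Dgpd_out (inr tt :: map inl wO)).
set w := _ ++ _.
have d : Dgpd (w := w) (fun e => exists (a : gcar NO) (b : gcar NO),
    a = inr e.1 /\ (b = inl (tunlift (tunmap ko (tfst e.2))) /\
    act Gs (sval (tsnd (w := map kbo (map inl wO)) e.2).1) a b)).
  do 2!apply: (ds_ex Hgpd); apply: (ds_and Hgpd).
    by apply: (Dgpd_inr hG hi hs0 HQ DQ_Q); acc.
  apply: (ds_and Hgpd).
    apply: (Dgpd_inl hG hi hs0 HQ DQ_Q hcodes); last by acc.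
    by apply: racc_kbo_lift; acc.
  by apply: (Dgpd_act hG hi hs0 HQ DQ_Q); acc.
apply: (ds_ext Hgpd) d _ => e; split; first by move=> [a [b [-> [-> h]]]].
by move=> h; eexists; eexists; split; [|split]; [ | |exact: h].
Qed.

Lemma cover_ind_internal : internal (cover_ind G i) tt.
Proof.
have [phi hphi] := hpr; have [psi _ hpsi] := DQ_jrel.
(* The code [z] of the identification is the parameter tuple of the definable bijection. *)
have [m s hm] := iota_mor; have [z cz] := crs_surj crc_surj2 ((m, tt) : tup gcar [:: NM]).
exists wO, (fun x => pr G x i), (fun a x => sval a = x); split.
- by exists wI, phi, i.
- exists (flat cwc [:: NM]), psi, z => x y; rewrite -(hm x.1 (tunlift y)).
  rewrite -(hpsi (tcat (x : tup U2 [:: inr tt]) (tcat y z))) /= tsnd_tcat tfst_tcat.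
  split=> [h|[e c]]; first by exists (m, tt).
  by rewrite (@crs_fun _ _ _ _ _ _ crc_fun2 [:: NM] z _ _ c cz).
- by move=> a x <-; exact: (svalP a).
- by move=> a; exists (sval a); split.
- move=> x hx; exists (exist _ x hx); split=> // a e; exact: sval_inj_prop.
Qed.

(** * Automorphisms of U'' over U and automorphisms of [O_*] in G' *)

Definition Phi (g : Ostar G i -> Ostar G i) (s : srt L + unit) : U2 s -> U2 s :=
  match s with inl _ => id | inr _ => g end.

Definition gO (g : Ostar G i -> Ostar G i) (x : OO) : OO :=
  match x with inl a => inl a | inr o => inr (g o) end.

Definition PhiB (g : Ostar G i -> Ostar G i) (s : csort L) : ccar s -> ccar s :=
  match s with Base s => Phi g (s := s) | SI => id | SO => gO g end.

Lemma tunlift_thom (h : forall s, U2 s -> U2 s) w (x : tup U2 (map inl w)) :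
  (forall s a, h (inl s) a = a) -> tunlift (thom h x) = tunlift x :> tup U w.
Proof.
rewrite /tunlift => hh; elim: w x => [|s w IH] //= [a x] /=.
by rewrite hh IH.
Qed.

Lemma crs_PhiB g w x e :
  crs crep (w := w) x e -> crs crep (thom (Phi g) x) (thom (PhiB g) e).
Proof.
have c1 s y b : @crep s y b -> crep (thom (Phi g) y) (PhiB g b).
  case: s y b => [s||] y b /=; first by move=> <-.
  - by rewrite -thom_tsnd -thom_tfst tunlift_thom.
  - rewrite -thom_tsnd -thom_tfst tunlift_thom //=.
    by move=> [[h ->]|[h ->]]; [left|right].
elim: w x e => [|s w IH] x e //= [c c'].
by rewrite -thom_tfst -thom_tsnd; split; [exact: c1 | exact: IH].
Qed.

(** Away from [O_*] the extension of [g] is the identity, which is a morphism; so at every object it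
    acts as an automorphism in G'. *)
Lemma Aut_star_gO g p : Aut_star g -> obj Gs p ->
  exists2 k, st Gs k p p & forall x, pr Gs x p -> act Gs k x (gO g x).
Proof.
move=> [m s hm] hp; case: p hp => [j|[]] hp; last first.
  by exists m => // -[a|o] // _; apply/hm.
have [k sk] := st_surj (hGs hG hi) hp hp; have [k' sk' e'] := act_inv (hGs hG hi) sk.
have [d sd ed] := act_comp (hGs hG hi) sk sk'; exists d => // -[a|o] //= hx.
apply/ed; have [c [hc _]] := act_fun (hGs hG hi) sk (hx : pr Gs (inl a) (inl j)).
by exists c => //; apply/e'.
Qed.

(** The morphism [m'] is l m k^{-1}, with [k] and [l] acting as [gO g] on the source and the target
    of [m]. *)
Lemma Aut_star_conj g m : Aut_star g -> mor Gs m ->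
  exists m', forall x y, act Gs m x y -> act Gs m' (gO g x) (gO g y).
Proof.
move=> ag hm; have hg := hGs hG hi; have [p [q s]] := st_tot hg hm.
have [_ hp hq] := st_sub hg s.
have [k sk hk] := Aut_star_gO ag hp; have [l sl hl] := Aut_star_gO ag hq.
have [k' sk' ek'] := act_inv hg sk; have [d sd ed] := act_comp hg sk' s.
have [d' sd' ed'] := act_comp hg sd sl; exists d' => x y h.
have [hx hy] := act_obj hg s h; apply/ed'; exists y; last exact: hl.
by apply/ed; exists x => //; apply/ek'; exact: hk.
Qed.

Lemma Qv_PhiB g k (e : tup ccar (prs SO k.+1)) : Aut_star g ->
  Qv Gs (n := k.+1) e -> Qv Gs (n := k.+1) (thom (PhiB g) e).
Proof.
move=> ag [m v]; have [hm _ _] := act_sub (hGs hG hi) v.1.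
have [m' h'] := Aut_star_conj ag hm; exists m'.
elim: {k} k.+1 e v => [|k IH] e //= [h v].
by split; [exact: h' | exact: IH].
Qed.

Lemma Aut_star_inv (g : Ostar G i -> Ostar G i) : Aut_star g -> exists g', [/\ Aut_star g',
  forall o, g (g' o) = o & forall o, g' (g o) = o].
Proof.
move=> [m s hm]; have hg := hGs hG hi; have [m' s' e'] := act_inv hg s.
have ch o : exists o', g o' = o.
  have [[a|o'] [h _]] := act_bij hg s (I : pr Gs (inr o) (inr tt)).
    by have [] := act_obj hg s h.
  by exists o'; apply/hm.
pose g' o := sval (constructive_indefinite_description _ (ch o)).
have hg' o : g (g' o) = o := svalP (constructive_indefinite_description _ (ch o)).
have gK o : g' (g o) = o.
  have h1 := (hm (g' (g o)) (g o)).2 (hg' _); have h2 := (hm o (g o)).2 erefl.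
  by have [] := act_injective hg h1 h2.
exists g'; split=> //; exists m' => // x y.
by rewrite (e' (inr y) (inr x)) hm; split=> [<-|<-].
Qed.

Lemma Dinv_lift_rel (h : forall s, U2 s -> U2 s) r :
  (forall s a, h (inl s) a = a) -> Dinv h (@rint _ U2 (inl r)).
Proof. by move=> hh x /=; rewrite tunlift_thom. Qed.

(** Since [qsym] generates the language, only its relation has to be checked, and conjugation by [g]
    carries a morphism through the given pairs to one through their images. *)
Lemma Phi_aut g : Aut_star g -> aut_over (X := cover_ind G i) (Phi g).
Proof.
move=> ag; have [g' [ag' gg' g'g]] := Aut_star_inv ag.
have P1K s a : Phi g (@Phi g' s a) = a by case: s a => //= ? o; rewrite gg'.
have P2K s a : Phi g' (@Phi g s a) = a by case: s a => //= ? o; rewrite g'g.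
have HD := Dinv_defsys P1K P2K.
have funs f (x : tup U2 (fdom f)) :
    Phi g (s := fcod f) (fint (s := U2) x) = fint (s := U2) (thom (Phi g) x).
  by case: f x => [f x|[]] /=; rewrite tunlift_thom.
(* One implication, applied to [g] and to its inverse to obtain the equivalence. *)
have half g1 g2 (x : tup U2 (flat cword (prs SO n.+2))) :
    Aut_star g1 -> (forall s a, Phi g2 (@Phi g1 s a) = a) ->
    (exists2 e, crs crep x e & Qv Gs (n := n.+2) e) ->
    exists2 e, crs crep (thom (Phi g1) x) e & Qv Gs (n := n.+2) e.
  move=> a1 _ [e c q]; exists (thom (PhiB g1) e); [exact: crs_PhiB | exact: Qv_PhiB].
have dall w (D : tup U2 w -> Prop) : DQ D -> Dinv (Phi g) D.
  move=> [phi u e]; apply: (ds_ext HD) (sat_in (F := FQ) (R := RQ) HD _ _ u) _.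
  - case=> [r|r] hr; first exact: Dinv_lift_rel.
    rewrite hr /= => x; rewrite -!hphiQ !tmapK; try by case.
    split; last exact: (@half g g').
    move=> h; have := @half g' g _ ag' P1K h.
    by rewrite thom_comp (thom_ext (h' := fun s a => a)) // thom_id.
  - move=> f _ [a x].
    change (Phi g (s := fcod f) a = fint (s := U2) (thom (Phi g) x) <->
            a = fint (s := U2) x).
    by rewrite -funs; split=> [e1|-> //]; rewrite -(P2K _ a) e1 P2K.
  - by move=> x; rewrite e.
split=> //; split=> //; first by move=> s; exists (Phi g' (s := s)).
case=> [r|[w phi]] x; first exact: Dinv_lift_rel.
exact: (dall _ _ (DQ_cover phi)).
Qed.

Lemma aut_inv (V : structure L2) (h : forall s, V s -> V s) w (phi : formula w) :
  automorphism h -> Dinv h (sat (U := V) phi).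
Proof.
move=> [hb hf hr].
have ex s : exists k : V s -> V s, (forall a, h s (k a) = a) /\ forall a, k (h s a) = a.
  by have [k k1 k2] := hb s; exists k.
pose k s := sval (constructive_indefinite_description _ (ex s)).
have hk s := svalP (constructive_indefinite_description _ (ex s)).
have HD : defsys (Dinv h) := Dinv_defsys (fun s => (hk s).1) (fun s => (hk s).2).
have [psi u e] := @def0_full _ V w (sat phi) (ex_intro _ phi (fun=> iff_refl _)).
apply: (ds_ext HD) (sat_in HD _ _ u) _; last by move=> x; rewrite e.
- by move=> r _ x; rewrite hr.
- move=> f _ [a x] /=; rewrite -hf; split=> [e1|-> //].
  by rewrite -((hk _).2 a) e1 (hk _).2.
Qed.

(** Let [z] code the identification of [O_*] with [O_i]. The automorphism fixes [O_i] pointwise and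
    moves [z] to the code of a morphism [m'] sending each [h o] to [sval o]; so [h] is the
    identification followed by the inverse of [m']. *)
Lemma aut_Aut_star h : aut_over (X := cover_ind G i) h -> Aut_star (h (inr tt)).
Proof.
move=> [ah hU]; have [psi _ hpsi] := DQ_jrel; have hg := hGs hG hi.
have [m s hm] := iota_mor; have [z cz] := crs_surj crc_surj2 ((m, tt) : tup gcar [:: NM]).
have inv (o : Ostar G i) a : sval o = a <->
    exists2 e, crs crc (thom h z) e & act Gs (sval e.1) (inr (h (inr tt) o)) (inl a).
  pose x := tcat ((o, tlift _ a) : tup U2 (inr tt :: map inl wO)) z.
  have := aut_inv (V := U2) psi ah x; rewrite -!hpsi /x /=.
  rewrite !thom_tcat !tsnd_tcat !tfst_tcat /jrel /= tunlift_thom //.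
  rewrite /tunlift /tlift tmapK // => ->; rewrite -hm.
  split=> [h1|[e c]]; first by exists (m, tt).
  by rewrite (@crs_fun _ _ _ _ _ _ crc_fun2 [:: NM] z _ _ c cz).
have [o0 _] := Ostar_inh hG hi.
(* One instance of the equivalence already shows that [thom h z] is a code; uniqueness of the coded
   morphism then gives the same [m'] for all points. *)
have [[m' []] c' h0] := (inv o0 (sval o0)).1 erefl.
have inv' o a : sval o = a <-> act Gs (sval m') (inr (h (inr tt) o)) (inl a).
  rewrite inv; split=> [[e c]|h1]; last by exists (m', tt).
  by rewrite (@crs_fun _ _ _ _ _ _ crc_fun2 [:: NM] _ _ _ c c').
have [p [q [s' hp hq]]] := act_ends hg h0.
have ep : p = inr tt := pr_fun hg hp (I : pr Gs (inr _) (inr tt)).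
have eq : q = inl i := pr_fun hg hq (svalP o0 : pr Gs (inl _) (inl i)).
rewrite ep eq in s'.
have [k sk ek] := act_inv hg s'; have [d sd ed] := act_comp hg s sk.
exists d => // x y; rewrite (ed (inr x) (inr y)); split.
  move=> [b h1 /ek h2]; have [_] := act_obj hg s h1; case: b h1 h2 => [b|b] h1 h2 // _.
  have h3 := (inv' x b).1 ((hm x b).1 h1).
  by have [] := act_injective hg h3 h2.
move=> <-; exists (inl (sval x)); first exact/hm.
by apply/ek; apply/inv'.
Qed.

Lemma cover_ind_iso : star_action_iso G i.
Proof.
exists Phi; split=> //.
- exact: Phi_aut.
- move=> g h _ _ e; exact: (f_equal (fun F => F (inr tt)) e).
- move=> h ah; exists (h (inr tt)); first exact: aut_Aut_star.
  apply: functional_extensionality_dep => -[s|[]] //.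
  by apply: functional_extensionality_dep => a; rewrite /= ah.2.
- by move=> g h _ _; apply: functional_extensionality_dep => -[s|[]].
Qed.

(** * Imaginary sorts of codes, and G' in the eq-expansion of U'' *)

Lemma crc_ker2 s : DQ (w := cwc s ++ cwc s)
  (fun x => exists2 b, crc (tfst x) b & crc (tsnd x) b).
Proof. exact: (crc_ker HQ (grep_ker hG hi hs0 HQ DQ_Q)). Qed.

(** An imaginary sort needs an equivalence relation on all tuples, so those that code nothing are
    put into one extra class. *)
Definition same_code s (x y : tup U2 (cwc s)) : Prop :=
  (exists2 b, crc x b & crc y b) \/
  (~ exists b, crc x b) /\ (~ exists b, crc y b).

Lemma DQ_same_code s : exists E : formula (L := L2) (cwc s ++ cwc s),
  forall x, same_code (tfst x) (tsnd x) <-> sat (U := U2) E x.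
Proof.
have d1 : DQ (w := cwc s ++ cwc s) (fun x => exists2 b, crc (tfst x) b & crc (tfst x) b).
  dsub HQ (crc_ker2 s) (fun x => tcat (tfst x) (tfst x)).
  by move=> x; rewrite tfst_tcat tsnd_tcat.
have d2 : DQ (w := cwc s ++ cwc s) (fun x => exists2 b, crc (tsnd x) b & crc (tsnd x) b).
  dsub HQ (crc_ker2 s) (fun x => tcat (tsnd x) (tsnd x)).
  by move=> x; rewrite tfst_tcat tsnd_tcat.
have [E _ hE] := ds_or HQ (crc_ker2 s) (ds_and HQ (ds_not HQ d1) (ds_not HQ d2)).
exists E => x; rewrite -hE; split=> -[h|[h1 h2]]; try by left.
  by right; split=> [[b hb _]|[b hb _]]; [apply: h1 | apply: h2]; exists b.
by right; split=> [[b hb]|[b hb]]; [apply: h1 | apply: h2]; exists b.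
Qed.

Definition Eform s := sval (constructive_indefinite_description _ (DQ_same_code s)).

Lemma EformP s x : same_code (tfst x) (tsnd x) <-> sat (U := U2) (Eform s) x.
Proof. exact: (svalP (constructive_indefinite_description _ (DQ_same_code s))). Qed.

Lemma Eform_equiv s : equiv_formula U2 (Eform s).
Proof.
have E x y : sat (U := U2) (Eform s) (tcat x y) <-> same_code x y.
  by rewrite -EformP tfst_tcat tsnd_tcat.
split=> [x|x y|x y z]; rewrite ?E.
- have [[b c]|n0] := classic (exists b, crc x b); last by right.
  by left; exists b.
- by move=> [[b c c']|[n1 n2]]; [left; exists b | right].
- move=> [[b c c']|[n1 n2]] [[b' d d']|[n3 n4]].
  + by left; exists b => //; rewrite (crc_fun2 c' d).
  + by case: n3; exists b.
  + by case: n2; exists b'.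
  + by right.
Qed.

Definition eqs s : eq_srt U2 := existT _ (cwc s) (exist _ (Eform s) (Eform_equiv s)).

Definition ccode s (b : gcar s) : tup U2 (cwc s) :=
  sval (constructive_indefinite_description _ (crc_surj2 b)).

Lemma ccodeP s (b : gcar s) : crc (ccode b) b.
Proof. exact: (svalP (constructive_indefinite_description _ (crc_surj2 b))). Qed.

Definition ceq s (b : gcar s) : eq_car (eqs s) := eq_proj (e := eqs s) (ccode b).

Lemma eq_rel_code s (x y : tup U2 (cwc s)) : eq_rel (e := eqs s) x y <-> same_code x y.
Proof. by rewrite /eq_rel /= -EformP tfst_tcat tsnd_tcat. Qed.

Lemma ceqP s (b : gcar s) x : eq_proj (e := eqs s) x = ceq b <-> crc x b.
Proof.
split=> [e|c].
  have : eq_rel (e := eqs s) x (ccode b).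
    have := f_equal (fun C => sval C (ccode b)) e => /= ->.
    by apply/eq_rel_code; left; exists b; apply: ccodeP.
  move=> /eq_rel_code [[b' c c']|[_ []]]; last by exists b; apply: ccodeP.
  by rewrite (crc_fun2 (ccodeP b) c').
apply: sval_inj_prop; apply: functional_extensionality_dep => y /=.
apply: propositional_extensionality; rewrite !eq_rel_code.
have cb := ccodeP b; split=> -[[b' c1 c2]|[n1 n2]].
- by left; exists b => //; rewrite (crc_fun2 c c1).
- by case: n1; exists b.
- by left; exists b => //; rewrite (crc_fun2 cb c1).
- by case: n1; exists b.
Qed.

Lemma ceq_inj s (b b' : gcar s) : ceq b = ceq b' -> b = b'.
Proof. by move=> /ceqP; apply: crc_fun2 (ccodeP b). Qed.

Local Notation Ueq := (cover_ind_eq G i).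
Local Notation L3 := (extlang (eq_lang U2)).

Definition eqsort s : srt L3 := inr (eqs s).

Definition cs w (e : tup gcar w) : tup Ueq (map eqsort w) :=
  tmap (B := Ueq) (g := eqsort) ceq e.

Fixpoint pj w : tup U2 (flat cwc w) -> tup Ueq (map eqsort w) -> Prop :=
  match w with
  | [::] => fun _ _ => True
  | s :: w' => fun z y => eq_proj (e := eqs s) (tfst z) = y.1 /\ pj (tsnd z) y.2
  end.

Lemma pj_crs w z (e : tup gcar w) y : crs crc z e -> (pj z y <-> y = cs e).
Proof.
elim: w z e y => [|s w IH] z e y; first by case: y.
case: e y => b e [a y] /= [/ceqP c /IH c']; rewrite c c'.
by split=> [[<- ->]|[-> ->]].
Qed.

Let DE : dfam Ueq := Dform (U := Ueq) (fun=> True) (fun=> True).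
Let HE : defsys DE := Dform_defsys Ueq _ _.

Lemma DE_pj v w (gz : tup Ueq v -> tup U2 (flat cwc w))
    (gy : tup Ueq v -> tup Ueq (map eqsort w)) :
  racc inl (fun s a => a) gz -> bacc gy -> DE (fun x => pj (gz x) (gy x)).
Proof.
elim: w gz gy => [|s w IH] gz gy rz ry; first exact: (ds_true HE).
apply: (ds_and HE); last exact: IH (racc_tsnd rz) (racc_tl ry).
have d := @Dform_fun _ Ueq (fun=> True) (fun=> True) (inr (eqs s)) I.
have rb := @racc_tmap_bacc _ _ Ueq U2 inl (fun s a => a) (fun s a => a)
  (fun _ _ => erefl) _ _ _ (racc_tfst rz).
dsub HE d (fun x => ((gy x).1, tmap (B := Ueq) (g := inl) (fun s a => a) (tfst (gz x)))).
by move=> x /=; rewrite /tunlift tmapK //; split=> ->.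
Qed.

(** An imaginary is compared with real tuples through the projection symbol of its sort: the set is
    described by quantifying over representatives. *)
Lemma DE_quot w w' (D : tup U2 w -> tup gcar w' -> Prop) :
  DQ (w := w ++ flat cwc w') (fun x => exists2 e, crs crc (tsnd x) e & D (tfst x) e) ->
  DE (w := map inl w ++ map eqsort w')
    (fun y => exists a e, y = tcat (tlift (eq_car (U := U2)) a) (cs e) /\ D a e).
Proof.
move=> [phi _ hphi].
pose D' := fun x : tup U2 (w ++ flat cwc w') =>
  exists2 e, crs crc (tsnd x) e & D (tfst x) e.
have d' : def0 D' by exists phi.
have rl (v : seq (srt L3)) (u : seq (srt L2)) (g : tup Ueq v -> tup Ueq (map inl u)) :
    bacc g -> racc inl (fun s a => a) (fun x => tunlift (g x) : tup U2 u).
  exact: (@racc_tunmap _ _ _ Ueq Ueq U2 (fun s => s) (fun s a => a) inl (fun s a => a)).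
have d : DE (w := map inl w ++ map eqsort w') (fun y =>
    exists z : tup Ueq (map inl (flat cwc w')),
      D' (tcat (tunlift (tfst y)) (tunlift z)) /\ pj (tunlift z) (tsnd y)).
  apply: (ds_ext_tup HE (D := fun z y =>
      D' (tcat (tunlift (tfst y)) (tunlift z)) /\ pj (tunlift z) (tsnd y))).
  apply: (ds_and HE).
    apply: (ext_lift_acc HE) d' _ => [r|f|].
    + exact: Dform_rel.
    + exact: (@Dform_fun _ Ueq (fun=> True) (fun=> True) (inl f)).
    + by apply: racc_tcat; apply: rl; acc.
  by apply: DE_pj; [apply: rl | ]; acc.
apply: (ds_ext HE) d _ => y; split.
  move=> [z [[e]]]; rewrite tsnd_tcat tfst_tcat => c De /(pj_crs _ c) ey.
  exists (tunlift (tfst y)), e; split=> //.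
  by rewrite -ey /tlift /tunlift tunmapK // tcat_fst_snd.
move=> [a [e [-> De]]]; have [z c] := crs_surj crc_surj2 e.
exists (tlift _ z); rewrite tfst_tcat tsnd_tcat /tlift /tunlift !tmapK //.
split; first by exists e; rewrite ?tfst_tcat ?tsnd_tcat.
by apply/(pj_crs _ c).
Qed.

Lemma def0_eq_of_Dgpd w w' (D : tup U2 w -> tup gcar w' -> Prop) :
  Dgpd (w := map kbo w ++ w') (fun e => D (tunmap ko (tfst e)) (tsnd e)) ->
  def0 (U := Ueq) (w := map inl w ++ map eqsort w')
    (fun y => exists a e, y = tcat (tlift (eq_car (U := U2)) a) (cs e) /\ D a e).
Proof. by move=> /Dgpd_out /DE_quot [phi _ h]; exists phi. Qed.

Lemma Dgpd_prb v (f : tup gcar v -> gcar NO) (g : tup gcar v -> gcar NI) :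
  vacc f -> vacc g -> Dgpd (fun x => pr Gs (f x) (g x)).
Proof. exact: (Dgpd_pr hG hi hs0 HQ DQ_lift DQ_Q hpr). Qed.

Lemma Dgpd_actb v (fm : tup gcar v -> gcar NM) (f f' : tup gcar v -> gcar NO) :
  vacc fm -> vacc f -> vacc f' -> Dgpd (fun x => act Gs (sval (fm x)) (f x) (f' x)).
Proof. exact: (Dgpd_act hG hi hs0 HQ DQ_Q). Qed.

Lemma Dgpd_obj : Dgpd (w := [:: NI]) (fun x => obj Gs x.1).
Proof.
have d : Dgpd (w := [:: NI]) (fun x => exists a : gcar NO, pr Gs a x.1).
  by apply: (ds_ex Hgpd); apply: Dgpd_prb; acc.
apply: (ds_ext Hgpd) d _ => x; split=> [[a /(pr_sub (hGs hG hi)) []]//|].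
exact: (pr_surj (hGs hG hi)).
Qed.

Lemma Dgpd_pts : Dgpd (w := [:: NO]) (fun x => pts Gs x.1).
Proof.
have d : Dgpd (w := [:: NO]) (fun x => exists p : gcar NI, pr Gs x.1 p).
  by apply: (ds_ex Hgpd); apply: Dgpd_prb; acc.
apply: (ds_ext Hgpd) d _ => x; split=> [[a /(pr_sub (hGs hG hi)) []]//|].
exact: (pr_tot (hGs hG hi)).
Qed.

Lemma Dgpd_st : Dgpd (w := [:: NM; NI; NI]) (fun x => st Gs (sval x.1) x.2.1 x.2.2.1).
Proof.
have d : Dgpd (w := [:: NM; NI; NI]) (fun x => exists (a : gcar NO) (b : gcar NO),
    act Gs (sval x.1) a b /\ (pr Gs a x.2.1 /\ pr Gs b x.2.2.1)).
  do 2!apply: (ds_ex Hgpd); apply: (ds_and Hgpd); first by apply: Dgpd_actb; acc.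
  by apply: (ds_and Hgpd); apply: Dgpd_prb; acc.
have hg := hGs hG hi.
apply: (ds_ext Hgpd) d _ => x; split.
  move=> [a [b [h [ha hb]]]]; have [p [q [s ha' hb']]] := act_ends hg h.
  by rewrite (pr_fun hg ha ha') (pr_fun hg hb hb').
move=> s; have [_ hp _] := st_sub hg s; have [a ha] := pr_surj hg hp.
have [b [hb _]] := act_fun hg s ha; have [_ hb'] := act_obj hg s hb.
by exists a, b.
Qed.

(** An element of [NM] is known only through its action, so it is matched with a real tuple of M by
    equality of graphs; injectivity of the action makes this an equality of morphisms. *)
Lemma Dgpd_inlM (hact : def0_3 (act G)) (hmor : def0 (mor G)) v
    (g : tup gcar v -> tup U wM) (f : tup gcar v -> gcar NM) :
  racc (fun s => Old (inl s)) (fun s a => a) g -> vacc f ->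
  Dgpd (fun x => mor G (g x) /\ sval (f x) = inl (g x)).
Proof.
move=> rg vf; have [phi hphi] := hact.
pose wB := map (fun s => Old (inl s)) wO : seq (gsort L).
pose un (x : tup gcar wB) : tup U wO :=
  tunmap (A := U) (B := gcar) (g := fun s => Old (inl s)) (fun s a => a) x.
have run u (k : tup gcar u -> tup gcar wB) : bacc k ->
    racc (fun s => Old (inl s)) (fun s a => a) (fun x => un (k x)).
  exact: (@racc_tunmap _ _ _ gcar gcar U (fun s => s) (fun s a => a)
    (fun s => Old (inl s)) (fun s a => a)).
have d : def0 (fun x : tup U (wM ++ (wO ++ wO)) =>
    act G (tfst x) (tfst (tsnd x)) (tsnd (tsnd x))).
  by exists phi => x; rewrite hphi !tcat_fst_snd.
have d1 : Dgpd (fun x : tup gcar v => forall (a : gcar NO) (b : gcar NO),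
    act Gs (sval (f x)) a b <-> exists (a' : tup gcar wB) (b' : tup gcar wB),
      a = inl (un a') /\ (b = inl (un b') /\ act G (g x) (un a') (un b'))).
  do 2!apply: (ds_all Hgpd); apply: (ds_iff Hgpd).
    by apply: Dgpd_actb; try (by acc); apply: (sacc_comp vf); acc.
  do 2!apply: (ds_ext_tup Hgpd); set u := wB ++ _.
  apply: (ds_and Hgpd).
    by apply: (Dgpd_inl hG hi hs0 HQ DQ_Q hcodes); [apply: run | ]; acc.
  apply: (ds_and Hgpd).
    by apply: (Dgpd_inl hG hi hs0 HQ DQ_Q hcodes); [apply: run | ]; acc.
  pose k (x : tup gcar u) := tcat (g (tsnd (tsnd x)).2.2)
    (tcat (un (tfst (tsnd x))) (un (tfst x))).
  apply: (ds_ext Hgpd) (Dcover_lift (g := k) d _) _ => [|x].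
    apply: racc_tcat; first by apply: (racc_comp rg); acc.
    by apply: racc_tcat; apply: run; acc.
  by rewrite /k !(tfst_tcat, tsnd_tcat).
have d2 : Dgpd (fun x : tup gcar v => mor G (g x)) := Dcover_lift hmor rg.
apply: (ds_ext Hgpd) (ds_and Hgpd d2 d1) _ => x.
have hg := hGs hG hi; split=> [[h1 h2]|[h1 h2]]; split=> //.
  apply: (act_inj hg) => [||a b]; [exact: (svalP (f x)) | by [] |].
  rewrite h2; split=> [[a' [b' [-> [-> h]]]]//|].
  case: a b => [a|a] [b|b] //= h.
  exists (tmap (B := gcar) (g := fun s => Old (inl s)) (fun s a => a) a),
         (tmap (B := gcar) (g := fun s => Old (inl s)) (fun s a => a) b).
  by rewrite /un !tmapK.
move=> a b; rewrite h2; split=> [|[a' [b' [-> [-> h]]]]//].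
case: a b => [a|a] [b|b] //= h.
exists (tmap (B := gcar) (g := fun s => Old (inl s)) (fun s a => a) a),
       (tmap (B := gcar) (g := fun s => Old (inl s)) (fun s a => a) b).
by rewrite /un !tmapK.
Qed.

Lemma cover_ind_eq_def0 (hobj : def0 (obj G)) (hmor : def0 (mor G))
    (hpts : def0 (pts G)) (hact : def0_3 (act G)) : star_def0_in_eq G i.
Proof.
have [m0 _ _] := iota_mor.
pose cI (p : II) : tup Ueq [:: eqsort NI] := (ceq (s := NI) p, tt).
pose cO (x : OO) : tup Ueq [:: eqsort NO] := (ceq (s := NO) x, tt).
(* The coding map [cM] must be total, while [NM] contains morphisms only; other elements get the
   default [m0]. *)
pose mm (m : MM) : {m | mor Gs m} :=
  match excluded_middle_informative (mor Gs m) with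
  | left h => exist _ m h | right _ => m0 end.
have mmE m : mor Gs m -> sval (mm m) = m.
  by rewrite /mm; case: (excluded_middle_informative _).
have mmK (m : {m | mor Gs m}) : mm (sval m) = m.
  by apply: sval_inj_prop; rewrite mmE //; exact: (svalP m).
pose cM (m : MM) : tup Ueq [:: eqsort NM] := (ceq (s := NM) (mm m), tt).
exists [:: eqsort NI], [:: eqsort NM], [:: eqsort NO], cI, cM, cO; split; [|split].
- split.
  + by move=> p q _ _ e; exact: (ceq_inj (f_equal fst e)).
  + move=> m m' hm hm' e; have em := ceq_inj (f_equal fst e).
    by rewrite -(mmE m hm) em mmE.
  + by move=> x y _ _ e; exact: (ceq_inj (f_equal fst e)).
- have rlift w w' : racc (fun s => Old (inl s)) (fun s a => a)
      (fun e : tup gcar (map kbo (map inl w) ++ w') =>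
        tunlift (tunmap ko (tfst e)) : tup U w) by apply: racc_kbo_lift; acc.
  split.
  + have := @def0_eq_of_Dgpd (map inl wI) [:: NI]
      (fun a e => obj G (tunlift a) /\ e.1 = inl (tunlift a)).
    case.
      apply: (ds_and Hgpd); first exact: (Dcover_lift hobj (rlift _ _)).
      by apply: (Dgpd_inlI hG hi hs0 HQ DQ_Q hcodes) (rlift _ _) _; acc.
    move=> phi hphi; exists phi => x y; rewrite -hphi; split.
      move=> [a ha [-> ->]]; exists (tlift _ a), (inl a, tt).
      by rewrite /tunlift /tlift tmapK.
    move=> [a [[p []] [/= e [ha ep]]]]; exists (tunlift a) => //.
    have := f_equal (fun z => tfst z) e; have := f_equal (fun z => tsnd z) e.
    rewrite !tfst_tcat !tsnd_tcat => -> ->.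
    by rewrite /real_eq /cI -ep /tlift /tunlift tunmapK.
  + have := @def0_eq_of_Dgpd (map inl wM) [:: NM]
      (fun a e => mor G (tunlift a) /\ sval e.1 = inl (tunlift a)).
    case; first by apply: (Dgpd_inlM hact hmor) (rlift _ _) _; acc.
    move=> phi hphi; exists phi => x y; rewrite -hphi; split.
      move=> [a ha [-> ->]]; exists (tlift _ a), (mm (inl a), tt).
      by rewrite /tunlift /tlift tmapK // mmE.
    move=> [a [[p []] [/= e [ha ep]]]]; exists (tunlift a) => //.
    have := f_equal (fun z => tfst z) e; have := f_equal (fun z => tsnd z) e.
    rewrite !tfst_tcat !tsnd_tcat => -> ->.
    by rewrite /real_eq /cM -ep mmK /tlift /tunlift tunmapK.
  + have := @def0_eq_of_Dgpd (map inl wO) [:: NO]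
      (fun a e => pts G (tunlift a) /\ e.1 = inl (tunlift a)).
    case.
      apply: (ds_and Hgpd); first exact: (Dcover_lift hpts (rlift _ _)).
      by apply: (Dgpd_inl hG hi hs0 HQ DQ_Q hcodes) (rlift _ _) _; acc.
    move=> phi hphi; exists phi => x y; rewrite -hphi; split.
      move=> [a ha [-> ->]]; exists (tlift _ a), (inl a, tt).
      by rewrite /tunlift /tlift tmapK.
    move=> [a [[p []] [/= e [ha ep]]]]; exists (tunlift a) => //.
    have := f_equal (fun z => tfst z) e; have := f_equal (fun z => tsnd z) e.
    rewrite !tfst_tcat !tsnd_tcat => -> ->.
    by rewrite /real_eq /cO -ep /tlift /tunlift tunmapK.
  + have d : Dgpd (w := [:: Old (inr Ost); NO]) (fun e => e.2.1 = inr e.1).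
      by apply: (Dgpd_inr hG hi hs0 HQ DQ_Q); acc.
    have [phi hphi] := @def0_eq_of_Dgpd [:: inr tt] [:: NO] (fun a e => e.1 = inr a.1) d.
    exists phi => -[o []] y; rewrite -hphi; split.
      by move=> ->; exists (o, tt), (inr o, tt).
    move=> [[a []] [[p []] [/= e ep]]].
    have /= -> := f_equal (fun z => z.2) e; have /= -> := f_equal (fun z => z.1) e.
    by rewrite /cO -ep.
- split; split.
  + have [phi hphi] := @def0_eq_of_Dgpd [::] [:: NI] (fun _ e => obj Gs e.1) Dgpd_obj.
    exists phi => y; rewrite -hphi; split.
      by move=> [p hp <-]; exists tt, (p, tt).
    by move=> [u0 [[p []] [-> hp]]]; exists p.
  + have [phi hphi] := @def0_eq_of_Dgpd [::] [:: NM] (fun _ e => True) (ds_true Hgpd _).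
    exists phi => y; rewrite -hphi; split.
      by move=> [m hm <-]; exists tt, (mm m, tt).
    move=> [u0 [[m []] [-> _]]]; exists (sval m); first exact: (svalP m).
    by rewrite /cM mmK.
  + have [phi hphi] := @def0_eq_of_Dgpd [::] [:: NO] (fun _ e => pts Gs e.1) Dgpd_pts.
    exists phi => y; rewrite -hphi; split.
      by move=> [p hp <-]; exists tt, (p, tt).
    by move=> [u0 [[p []] [-> hp]]]; exists p.
  + have [phi hphi] := @def0_eq_of_Dgpd [::] [:: NM; NI; NI]
      (fun _ e => st Gs (sval e.1) e.2.1 e.2.2.1) Dgpd_st.
    exists phi => x y z; rewrite -hphi; split.
      move=> [m [p [q [s <- <- <-]]]]; exists tt, (mm m, (p, (q, tt))).
      by have [hm _ _] := st_sub (hGs hG hi) s; rewrite /= mmE.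
    case: x y z => x [] [y []] [z []].
    move=> [u0 [[m [p [q []]]] [/= [-> -> ->] s]]]; exists (sval m), p, q.
    by rewrite /cM mmK.
  + have d : Dgpd (w := [:: NO; NI]) (fun e => pr Gs e.1 e.2.1) by apply: Dgpd_prb; acc.
    have [phi hphi] := @def0_eq_of_Dgpd [::] [:: NO; NI] (fun _ e => pr Gs e.1 e.2.1) d.
    exists phi => x y; rewrite -hphi; split.
      by move=> [a [p [h <- <-]]]; exists tt, (a, (p, tt)).
    case: x y => x [] [y []].
    by move=> [u0 [[a [p []]] [/= [-> ->] h]]]; exists a, p.
  + have d : Dgpd (w := [:: NM; NO; NO]) (fun e => act Gs (sval e.1) e.2.1 e.2.2.1).
      by apply: Dgpd_actb; acc.
    have [phi hphi] := @def0_eq_of_Dgpd [::] [:: NM; NO; NO]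
      (fun _ e => act Gs (sval e.1) e.2.1 e.2.2.1) d.
    exists phi => x y z; rewrite -hphi; split.
      move=> [m [p [q [s <- <- <-]]]]; exists tt, (mm m, (p, (q, tt))).
      by have [hm _ _] := act_sub (hGs hG hi) s; rewrite /= mmE.
    case: x y z => x [] [y []] [z []].
    move=> [u0 [[m [p [q []]]] [/= [-> -> ->] s]]]; exists (sval m), p, q.
    by rewrite /cM mmK.
Qed.
End Induced.

(** * U'' interpreted in U with the parameter i *)

Section OverU.
Variables (L : language) (U : structure L) (wI wM wO : seq (srt L)).
Variables (G : gpd (tup U wI) (tup U wM) (tup U wO)) (i : tup U wI).
Variable s0 : srt L.
Hypotheses (hG : is_groupoid G) (hi : obj G i).
Hypothesis hs0 : exists c d : U s0, c <> d.
Hypotheses (hpr : def0_2 (pr G)) (hact : def0_3 (act G)).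

Local Notation U2 := (ext (cover_ind G i)).
Local Notation OO := (tup U wO + Ostar G i)%type.
Local Notation ccar := (@ccar L U wI wM wO G i).
Local Notation crep := (@crep L U wI wM wO G i s0).
Local Notation cword := (@cword L wI wO s0).
Local Notation Gs := (@Gs L U wI wM wO G i).

Let Dp : dfam U := Dparam (Dform (U := U) (fun=> True) (fun=> True)) i.
Let Hp : defsys Dp := Dparam_defsys (Dform_defsys U _ _) i.

Definition uword (s : srt L + unit) : seq (srt L) :=
  match s with inl s => [:: s] | inr _ => wO end.

Definition urep (s : srt L + unit) : tup U (uword s) -> U2 s -> Prop :=
  match s return tup U (uword s) -> U2 s -> Prop with
  | inl s => fun x a => x.1 = a
  | inr _ => fun x a => x = sval a
  end.

Lemma urep_fun s x b b' : @urep s x b -> urep x b' -> b = b'.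
Proof.
case: s x b b' => [s|[]] x b b' /=; first by move=> -> ->.
by move=> -> /sval_inj_prop.
Qed.

Lemma urep_surj s b : exists x, @urep s x b.
Proof. by case: s b => [s|[]] b; [exists (b, tt) | exists (sval b)]. Qed.

Lemma Dp_pr v (g : tup U v -> tup U wO) : bacc g -> Dp (fun x => pr G (g x) i).
Proof.
move=> rg; have /def0_full d : def0 (fun x : tup U (wO ++ wI) => pr G (tfst x) (tsnd x)).
  by have [phi h] := hpr; exists phi => x; rewrite h tcat_fst_snd.
have d' : Dp (fun x => pr G x i) := Dparam_in i d.
exact: (ds_sub Hp d' rg).
Qed.

Lemma urep_ker s : Dp (w := uword s ++ uword s)
  (fun x => exists2 b, urep (tfst x) b & urep (tsnd x) b).
Proof.
case: s => [s|[]] /=.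
  by apply: (ds_ext Hp) (ds_eq0 Hp s) _ => -[a [b []]] /=; split=> [->|[c -> ->]] //; exists b.
have d1 : Dp (w := wO ++ wO) (fun x => tfst x = tsnd x) by apply: (ds_eq_tup Hp); acc.
have d2 : Dp (w := wO ++ wO) (fun x => pr G (tfst x) i) by apply: Dp_pr; acc.
apply: (ds_ext Hp) (ds_and Hp d1 d2) _ => x; split.
  by move=> [<- h]; exists (exist (fun a => pr G a i) _ h).
by move=> [o -> ->]; split=> //; exact: (svalP o).
Qed.

Definition Dbase : dfam U2 := Dpull urep Dp.
Definition Hbase : defsys Dbase := Dpull_defsys urep_fun urep_surj Hp urep_ker.

Lemma Dbase_in v w w' (D : tup U w -> tup U2 w' -> Prop)
    (g : tup U2 v -> tup U w) (f : tup U2 v -> tup U2 w') :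
  Dp (w := w ++ flat uword w') (fun x => exists2 e, crs urep (tsnd x) e & D (tfst x) e) ->
  racc inl (fun s (a : U2 (inl s)) => a) g -> bacc f -> Dbase (fun e => D (g e) (f e)).
Proof.
apply: (@Dpull_in _ U _ U2 uword urep urep_fun Dp Hp urep_ker inl (fun s a => a)
  (fun s x => x.1)) => [s|s x b //].
by acc.
Qed.

Lemma Dbase_lift w (D : tup U w -> Prop) v (g : tup U2 v -> tup U w) :
  def0 D -> racc inl (fun s a => a) g -> Dbase (fun x => D (g x)).
Proof.
move=> d; apply: (@Dpull_in0 _ U _ U2 uword urep urep_fun Dp Hp urep_ker inl (fun s a => a)
  (fun s x => x.1)) => [s|s x b //|]; first by acc.
exact: (Dparam_sub (Dform_defsys U _ _) i (def0_full d)).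
Qed.

Lemma Dbase_sval : Dbase (w := inr tt :: map inl wO) (fun x => sval x.1 = tunlift x.2).
Proof.
set w := _ :: _.
have := @Dbase_in w wO [:: inr tt] (fun a e => sval e.1 = a) (fun x => tunlift x.2)
  (fun x => (x.1, tt)).
apply; last by acc.
  have d1 : Dp (w := wO ++ flat uword [:: inr tt]) (fun x => tfst x = tfst (w := wO) (tsnd x)).
    by apply: (ds_eq_tup Hp); acc.
  have d2 : Dp (w := wO ++ flat uword [:: inr tt]) (fun x => pr G (tfst x) i).
    by apply: Dp_pr; acc.
  apply: (ds_ext Hp) (ds_and Hp d1 d2) _ => x; split.
    by move=> [e h]; exists (exist (fun a => pr G a i) _ h, tt).
  by move=> [[o []] [/= -> _] <-]; split=> //; exact: (svalP o).
apply: (@racc_tunmap _ _ _ U2 U2 U (fun s => s) (fun s a => a) inl (fun s a => a)).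
by acc.
Qed.

Local Notation DchartB := (@Dchart L U wI wM wO G i s0 Dbase).
Local Notation HchartB := (Hchart hG hi hs0 Hbase).

Lemma DchartB_sval v (f : tup ccar v -> ccar (Base (inr tt))) (g : tup ccar v -> tup U wO) :
  vacc f -> racc (fun s => Base (inl s)) (fun s a => a) g ->
  DchartB (fun x => sval (f x) = g x).
Proof.
move=> vf rg.
have := @Dchart_in L U wI wM wO G i s0 Dbase Hbase v (inr tt :: map inl wO) [::]
  (fun x _ => sval x.1 = tunlift x.2) (fun x => (f x, tlift _ (g x))) (fun=> tt).
move=> h; apply: (ds_ext HchartB) (h _ _ _) _.
- set w := _ ++ _.
  have d : Dbase (w := w) (fun x => sval x.1 = tunlift (tfst x.2)).
    by dsub Hbase Dbase_sval (fun x => (x.1, tfst x.2)).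
  by apply: (ds_ext Hbase) d _ => x; split=> [e|[]//]; exists tt.
- by apply: racc_cons; [exact: vf | exact: racc_Base].
- exact: racc_nil.
- by move=> x /=; rewrite /tunlift /tlift tmapK.
Qed.

Lemma DchartB_unstar v (f : tup ccar v -> ccar SO) (g : tup ccar v -> tup U wO) :
  vacc f -> racc (fun s => Base (inl s)) (fun s a => a) g ->
  DchartB (fun x => unstar (f x) = g x).
Proof.
move=> vf rg.
have d1 := Dchart_inl hG hi hs0 Hbase rg vf.
have d2 : DchartB (fun x : tup ccar v => exists o : ccar (Base (inr tt)),
    f x = inr o /\ sval o = g x).
  apply: (ds_ex HchartB); apply: (ds_and HchartB).
    by apply: (Dchart_inr hG hi hs0 Hbase); try (by acc); apply: (sacc_comp vf); acc.
  by apply: DchartB_sval; [acc | apply: (racc_comp rg); acc].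
apply: (ds_ext HchartB) (ds_or HchartB d1 d2) _ => x; split.
  by move=> [->|[o [-> <-]]].
by case: (f x) => [a /= ->|o /= <-]; [left | right; exists o].
Qed.

Lemma DchartB_act v (gm : tup ccar v -> tup U wM) (f f' : tup ccar v -> ccar SO) :
  racc (fun s => Base (inl s)) (fun s a => a) gm -> vacc f -> vacc f' ->
  DchartB (fun x => act G (gm x) (unstar (f x)) (unstar (f' x))).
Proof.
move=> rm vf vf'.
have d : DchartB (fun x : tup ccar v => exists a b,
    unstar (f x) = a /\ (unstar (f' x) = b /\ act G (gm x) a b)).
  do 2!apply: (Dchart_ex_tup hG hi hs0 Hbase).
  apply: (ds_and HchartB).
    by apply: DchartB_unstar; [apply: (sacc_comp vf) | apply: racc_untup]; acc.
  apply: (ds_and HchartB).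
    by apply: DchartB_unstar; [apply: (sacc_comp vf') | apply: racc_untup]; acc.
  set w := _ ++ _.
  have da : def0 (fun x : tup U (wM ++ (wO ++ wO)) =>
      act G (tfst x) (tfst (tsnd x)) (tsnd (tsnd x))).
    by have [phi h] := hact; exists phi => x; rewrite h !tcat_fst_snd.
  pose g (x : tup ccar w) := tcat (gm (tsnd (tsnd x)))
    (tcat (untup (tfst (tsnd x))) (untup (tfst x))).
  apply: (ds_ext HchartB) (Dchart_lift hG hi hs0 Hbase Dbase_lift (g := g) da _) _.
    apply: racc_tcat; first by apply: (racc_comp rm); acc.
    by apply: racc_tcat; apply: racc_untup; acc.
  by move=> x; rewrite /g !(tfst_tcat, tsnd_tcat).
apply: (ds_ext HchartB) d _ => x; split; first by move=> [a [b [<- [<-]]]].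
by move=> h; do 2!eexists; split; [|split]; [ | | exact: h].
Qed.

Definition kind (x : OO) : bool := if x is inr _ then true else false.

Fixpoint uact k (b c : bool) (m : tup U wM) : tup ccar (prs SO k) -> Prop :=
  match k with
  | 0 => fun _ => True
  | k'.+1 => fun z => [/\ kind z.1 = b, kind z.2.1 = c,
      act G m (unstar z.1) (unstar z.2.1) & uact b c m z.2.2]
  end.

(* Under the identification of O_* with O_i, a morphism of G' is a morphism of G
   together with the information which of its ends is O_*. *)
Lemma Qv_uact k (e : tup ccar (prs SO k.+1)) :
  Qv Gs (n := k.+1) e <-> exists b c m, uact (k := k.+1) b c m e.
Proof.
have hg := hGs hG hi; split.
  move=> [m v]; have [p [q [s _ _]]] := act_ends hg v.1.
  exists (if p is inr _ then true else false), (if q is inr _ then true else false), (um m).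
  elim: {k} k.+1 e v => [|k IH] e //= [h v].
  have [hx hy h'] := (act_st hG _ _ s).1 h.
  split=> //; last exact: IH.
    by case: (p) hx => [j|[]]; case: (e.1).
  by case: (q) hy => [j|[]]; case: (e.2.1).
move=> [b [c [m u]]].
have [hm _ _] : [/\ mor G m, pts G (unstar e.1) & pts G (unstar e.2.1)].
  by case: u => _ _ h _; exact: act_sub hG _ _ _ h.
have [j [j' s]] := st_tot hG hm.
(* The kinds of the first pair dictate the ends in G'. Where a kind says [O_*], the underlying end
   is [i], because the points of [O_*] lie over [i]. *)
pose p : tup U wI + unit := if b then inr tt else inl j.
pose q : tup U wI + unit := if c then inr tt else inl j'.
have ep : us i p = j.
  rewrite /p; case: b u @p => // -[kx _ h _] _ /=.
  have [hx _] := act_obj hG s h; case: (e.1) kx hx => //= o _ hx.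
  exact: (pr_fun hG (svalP o) hx).
have eq : us i q = j'.
  rewrite /q; case: c u @q => // -[_ ky h _] _ /=.
  have [_ hy] := act_obj hG s h; case: (e.2.1) ky hy => //= o _ hy.
  exact: (pr_fun hG (svalP o) hy).
have [m' s' em] : exists2 m', st Gs m' p q & um m' = m.
  by apply: st_mk; rewrite ep eq.
exists m'; elim: {k} k.+1 e u => [|k IH] e //= [kx ky h u].
split; last exact: IH.
apply/(act_st hG _ _ s'); have [hx hy] := act_obj hG s h.
split; last by rewrite em.
  by rewrite /p -kx; case: (e.1) hx.
by rewrite /q -ky; case: (e.2.1) hy.
Qed.

Lemma DchartB_kind v b (f : tup ccar v -> ccar SO) : vacc f -> DchartB (fun x => kind (f x) = b).
Proof.
move=> vf; have d := Dchart_isinr hG hi hs0 Hbase vf; case: b.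
  apply: (ds_ext HchartB) d _ => x; case: (f x) => a.
    by split=> // -[].
  by split=> // _; exists a.
apply: (ds_ext HchartB) (ds_not HchartB d) _ => x; case: (f x) => a.
  by split=> // _ [].
by split=> // -[]; exists a.
Qed.

Lemma DchartB_uact k b c v (gm : tup ccar v -> tup U wM) (gz : tup ccar v -> tup ccar (prs SO k)) :
  racc (fun s => Base (inl s)) (fun s a => a) gm -> bacc gz ->
  DchartB (fun x => uact b c (gm x) (gz x)).
Proof.
move=> rm; elim: k gz => [|k IH] gz rz; first exact: (ds_true HchartB).
have v1 := sacc_hd rz; have v2 := sacc_hd (racc_tl rz).
apply: (ds_ext HchartB) (ds_and HchartB (DchartB_kind b v1) (ds_and HchartB (DchartB_kind c v2)
  (ds_and HchartB (DchartB_act rm v1 v2) (IH _ (racc_tl (racc_tl rz)))))) _ => x /=.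
by split=> [[? [? [? ?]]]|[? ? ? ?]].
Qed.

Lemma DchartB_Q k : DchartB (w := prs SO k.+1) (Qv Gs (n := k.+1)).
Proof.
have d b c : DchartB (w := prs SO k.+1) (fun z => exists m, uact b c m z).
  apply: (Dchart_ex_tup hG hi hs0 Hbase).
  by apply: DchartB_uact; [apply: racc_untup | ]; acc.
apply: (ds_ext HchartB) (ds_or HchartB (ds_or HchartB (d true true) (d true false))
  (ds_or HchartB (d false true) (d false false))) _ => z.
rewrite Qv_uact; split.
  by move=> [[[m u]|[m u]]|[[m u]|[m u]]]; do 3!eexists; exact: u.
by move=> [[] [[] [m u]]]; [left; left|left; right|right; left|right; right]; exists m.
Qed.


(** * Stable embeddedness and saturation by transfer to U *)

Section Transfer.
Variable n : nat.
Variable phiQ : formula (L := extlang (cover_lang wO))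
  (map (@isrt L wO) (flat cword (prs SO n.+2))).
Hypothesis hphiQ : forall y : tup (ext (Defs.cover G i)) _,
  (exists2 e, crs crep (tunmap (@iout L U wI wM wO G i) y) e & Qv Gs (n := n.+2) e) <-> sat phiQ y.
Hypothesis hcodes : forall m, mor Gs m -> exists z : tup ccar (prs SO n.+1), codes Gs z m.

Local Notation L2 := (extlang (ind_lang (E := cover_lang wO) (fun _ : unit => Ost))).

(** Finite generation pays off here: besides the symbols of L only [qsym] has to be interpreted in
    U. *)
Lemma Dbase_all w (phi : formula (L := L2) w) : Dbase (sat (U := U2) phi).
Proof.
have [psi u e] := DQ_all hG hi hs0 hphiQ hcodes phi.
apply: (ds_ext Hbase) (sat_in Hbase _ _ u) _; last by move=> x; rewrite e.
- case=> [r|r] hr.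
    apply: (Dbase_lift (D := @rint L U r) (g := fun x => tunlift x)).
      by have [psi' _ e'] := @Dform_rel _ U (fun=> True) (fun=> True) r I; exists psi'.
    exact: (@racc_tunmap0 _ _ U2 U inl (fun s a => a)).
  rewrite hr; apply: (ds_ext Hbase) (DchartB_Q n.+1) _ => x /=.
  by rewrite -hphiQ tmapK //; case.
- case=> [f|[]] _.
  apply: (@Dbase_lift (fcod f :: fdom f) (fun x => x.1 = fint x.2)
    (inl (fcod f) :: map inl (fdom f)) (fun x => (x.1, tunlift x.2))).
    by have [psi' _ e'] := @Dform_fun _ U (fun=> True) (fun=> True) f I; exists psi'.
  apply: racc_cons; first by exists (vz _ _).
  apply: (@racc_tunmap _ _ _ U2 U2 U (fun s => s) (fun s a => a) inl (fun s a => a)).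
  by acc.
Qed.

(** Parameters [b] from U'' become a code [y] of them followed by [i]; the formula obtained depends
    on neither the point nor its code, so it can be used inside a type. *)
Lemma Dbase_param w v (phi : formula (L := L2) (w ++ v)) (b : tup U2 v) (y : tup U (flat uword v)) :
  crs urep y b ->
  exists psi : formula (flat uword w ++ (flat uword v ++ wI)), forall x,
    sat (U := U) psi (tcat x (tcat y i)) <->
    exists2 e, crs urep x e & sat (U := U2) phi (tcat e b).
Proof.
move=> cy; have [D0 d e0] := Dbase_all phi.
have H := Dform_defsys U (fun=> True) (fun=> True).
have [psi _ epsi] : Dform (U := U) (fun=> True) (fun=> True)
    (w := flat uword w ++ (flat uword v ++ wI))
    (fun x => D0 (tcat (flatcat (tfst x) (tfst (tsnd x))) (tsnd (tsnd x)))).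
  dsub H d (fun x => tcat (flatcat (tfst x) (tfst (tsnd x))) (tsnd (tsnd x))).
  by apply: racc_flatcat; acc.
exists psi => x; rewrite -epsi !(tfst_tcat, tsnd_tcat) -e0; split.
  move=> [e /crs_cat [c c'] s]; exists (tfst e) => //.
  by rewrite -(crs_fun urep_fun c' cy) tcat_fst_snd.
move=> [e c s]; exists (tcat e b) => //.
by apply/crs_cat; rewrite tfst_tcat tsnd_tcat.
Qed.

Fixpoint ulift w : tup U w -> tup U (flat uword (map inl w)) :=
  match w with
  | [::] => fun _ => tt
  | s :: w' => fun x => (x.1, ulift x.2)
  end.

Lemma racc_ulift w v (g : tup U v -> tup U w) : bacc g -> bacc (fun x => ulift (g x)).
Proof.
elim: w v g => [|s w IH] v g rg /=; first exact: racc_nil.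
by apply: racc_cons; [exact: (sacc_hd rg) | apply: IH; exact: (racc_tl rg)].
Qed.

Lemma crs_ulift w (x : tup U w) e : crs urep (ulift x) e <-> tunlift e = x.
Proof.
rewrite /tunlift; elim: w x e => [|s w IH] x e /=; first by case: x.
rewrite IH; case: x => a x /=; split=> [[-> ->]//|[-> ->]//].
Qed.

(** Elements of U are their own codes, so a definition with parameters in U'' translates into one
    over a code of these parameters together with [i]. *)
Lemma cover_ind_stably_embedded : stably_embedded (cover_ind G i).
Proof.
move=> w D [v [phi [b hphi]]].
have [y cy] := crs_surj urep_surj b; have [psi hpsi] := Dbase_param phi cy.
have [psi' _ e] : Dform (U := U) (fun=> True) (fun=> True)
    (w := w ++ (flat uword v ++ wI)) (fun x => sat psi (tcat (ulift (tfst x)) (tsnd x))).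
  have H := Dform_defsys U (fun=> True) (fun=> True).
  have d : Dform (U := U) (fun=> True) (fun=> True) (sat (U := U) psi).
    exact: (def0_full (ex_intro _ psi (fun=> iff_refl _))).
  dsub H d (fun x => tcat (ulift (tfst x)) (tsnd x)).
  by apply: racc_ulift; acc.
exists (flat uword v ++ wI), psi', (tcat y i) => x.
rewrite -e tfst_tcat tsnd_tcat hpsi; split=> [Dx|[e' /crs_ulift <- /hphi //]].
exists (tlift _ x); first by apply/crs_ulift; rewrite /tunlift /tlift tmapK.
by apply/hphi; rewrite /tunlift /tlift tmapK.
Qed.

(** The elements of U over which a translated type lives: the coordinates of the codes of the
    parameters, and those of [i]. *)
Definition base_params (P : forall s, U2 s -> Prop) (s : srt L) (u : U s) : Prop :=
  (exists s' (a : U2 s') (x : tup U (uword s')) (y : var (uword s') s),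
     [/\ P s' a, urep x a & tget y x = u]) \/
  exists y : var wI s, tget y i = u.

Lemma tall_get (A : srt L -> Type) (P : forall s, A s -> Prop) w (x : tup A w) :
  (forall s (y : var w s), P s (tget y x)) -> tall P x.
Proof.
elim: w x => [|s w IH] //= x h; split; first exact: (h s (vz s w)).
by apply: IH => t y; exact: (h t (vs s y)).
Qed.

Lemma tall_cat (A : srt L -> Type) (P : forall s, A s -> Prop) w v
    (x : tup A w) (y : tup A v) : tall P x -> tall P y -> tall P (tcat x y).
Proof. by elim: w x => [|s w IH] //= x [h1 h2] h3; split=> //; apply: IH. Qed.

Lemma tall_base_params (P : forall s, U2 s -> Prop) v y (b : tup U2 v) :
  crs urep y b -> tall P b -> tall (base_params P) (tcat y i).
Proof.
move=> c hb; apply: tall_cat; last by apply: tall_get => s z; right; exists z.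
elim: v y b c hb => [|s v IH] y b //= [c c'] [h h'].
rewrite -(tcat_fst_snd y); apply: tall_cat; last exact: IH c' h'.
by apply: tall_get => t z; left; exists s, b.1, (tfst y), z.
Qed.

(** The type is translated formula by formula to tuples of codes and realised in U. Each translation
    also says that its solutions are codes, so the realisation presents an element of U''. *)
Lemma cover_ind_saturated : saturated U ->
  (forall P, small P -> small (base_params P)) -> saturated U2.
Proof.
move=> sU hsmall P smP w p hp fin.
pose good (q : pformula U2 w) (q' : pformula U (flat uword w)) :=
  p q /\ forall x, psat q' x <-> exists2 e, crs urep x e & psat q e.
pose p' q' := tall (base_params P) (pf_param q') /\ exists q, good q q'.
have ex q : p q -> exists q', p' q' /\ good q q'.
  case: q => v phi b pq; have [y cy] := crs_surj urep_surj b.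
  have [psi hpsi] := Dbase_param phi cy; exists (PFormula psi (tcat y i)).
  have gq : good (PFormula phi b) (PFormula psi (tcat y i)) by split.
  split=> //; split; last by exists (PFormula phi b).
  exact: tall_base_params cy (hp _ pq).
have [|l hl|x hx] := sU _ (hsmall P smP) (flat uword w) p'.
- by move=> q' [].
- have [l' [h1 h2]] : exists l', (forall q, List.In q l' -> p q) /\
      forall q', List.In q' l -> exists2 q, List.In q l' & good q q'.
    elim: l hl => [|q' l IH] hl; first by exists [::].
    have [|l' [h1 h2]] := IH; first by move=> q hq; apply: hl; right.
    have [_ [q gq]] := hl q' (or_introl erefl).
    exists (q :: l'); split=> [q1 [<-|/h1 //]|q1 [<-|/h2 [q2 h3 h4]]]; first by case: gq.
      by exists q => //; left.
    by exists q2 => //; right.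
  have [e he] := fin _ h1; have [x cx] := crs_surj urep_surj e.
  exists x => q' /h2 [q hq [_ gq]]; apply/gq; exists e => //; exact: he.
(* For an empty type nothing forces [x] to be a code; the element then comes from satisfiability of
   the empty list. *)
- have [[q0 pq0]|none] := classic (exists q, p q); last first.
    have [e _] := fin [::] (fun q (f : False) => match f with end).
    by exists e => q pq; case: none; exists q.
  have sol q : p q -> exists2 e, crs urep x e & psat q e.
    by move=> /ex [q' [hq' [_ gq]]]; apply/gq; apply: hx.
  have [e ce _] := sol q0 pq0; exists e => q /sol [e' ce' s].
  by rewrite (crs_fun urep_fun ce ce').
Qed.

End Transfer.

End OverU.

(** * Smallness of parameter sets *)

Section Smallness.
Variables (L : language) (U : structure L).
Hypothesis hU : ~ exists f : Defs.total U -> {w : seq (srt L) & formula w}, injective f.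

(** Counts leading negations, to separate the iterated negations of falsity that embed [nat] into
    the formulas. *)
Fixpoint fdepth w (phi : formula (L := L) w) : nat :=
  if phi is fnot _ p then (fdepth p).+1 else 0.

Lemma inj_nat_formula : inj nat {w : seq (srt L) & formula w}.
Proof.
exists (fun k => existT _ [::] (iter k (fnot (w := [::])) (ffalse [::]))) => k l e.
have := f_equal (fun t => fdepth (projT2 t)) e => /=.
have d j : fdepth (iter j (fnot (w := [::])) (ffalse [::])) = j.
  by elim: j => //= j ->.
by rewrite !d.
Qed.

Lemma total_not_countable : ~ inj (Defs.total U) nat.
Proof. by move=> h; apply: hU; exact: (inj_trans h inj_nat_formula). Qed.

Lemma inj_nat_total : inj nat (Defs.total U).
Proof. by have [//|/total_not_countable] := inj_nat_dichotomy (Defs.total U). Qed.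

(** If every sort had at most one element, then U would embed into the set of sorts, hence into the
    formulas. *)
Lemma two_element_sort : exists s (c d : U s), c <> d.
Proof.
apply: NNPP => none; apply: hU.
exists (fun t => existT _ [:: projT1 t] (ffalse [:: projT1 t])).
move=> [s a] [s' a'] e; have [es] := f_equal (fun t => projT1 t) e; simpl in es.
subst s'; congr existT; apply: NNPP => ne; apply: none.
by exists s, a, a'.
Qed.

Lemma inj_double_infinite X : inj nat X -> inj (X + X) X.
Proof. by move=> h; exact: (inj_trans (inj_double h) (inj_square h)). Qed.

Lemma inj_tup_total w : inj (tup U w) (Defs.total U).
Proof.
elim: w => [|s w IH].
  by have [f _] := inj_nat_total; exists (fun _ => f 0) => -[] [].
apply: inj_trans (inj_square inj_nat_total).
apply: inj_prod IH; exists (fun a => existT _ s a) => a b.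
exact: inj_pair2.
Qed.

Fixpoint tlist w : tup U w -> seq (Defs.total U) :=
  match w with
  | [::] => fun _ => [::]
  | s :: w' => fun x => existT _ s x.1 :: tlist x.2
  end.

Lemma tlist_get w s (y : var w s) (x : tup U w) :
  exists k, List.nth_error (tlist x) k = Some (existT _ s (tget y x)).
Proof.
elim: y x => [t w'|t w' r y IH] x; first by exists 0.
by have [k hk] := IH x.2; exists k.+1.
Qed.

Variables (wI wM wO : seq (srt L)).
Variables (G : gpd (tup U wI) (tup U wM) (tup U wO)) (i : tup U wI).
Local Notation U2 := (ext (cover_ind G i)).

Lemma inj_total_cover_ind : inj (Defs.total U2) (Defs.total U).
Proof.
apply: inj_trans (inj_double_infinite inj_nat_total).
apply: (@inj_trans _ (Defs.total U + tup U wO)); last first.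
  by apply: inj_sum (inj_tup_total wO); exists id.
exists (fun t : Defs.total U2 => match t with
  | existT (inl s) a => inl (existT _ s a)
  | existT (inr tt) o => inr (sval o)
  end).
move=> [[s|[]] a] [[s'|[]] a'] //= e.
  exact: (f_equal (fun z : Defs.total U + tup U wO =>
    if z is inl t then existT (fun s => U2 s) (inl (projT1 t)) (projT2 t)
    else existT (fun s => U2 s) (inl s) a) e).
have e1 := f_equal (fun z : Defs.total U + tup U wO =>
  if z is inr x then x else sval a) e.
by rewrite (sval_inj_prop e1).
Qed.

(** The coordinates form at most a countable multiple of the parameters plus the finitely many from
    [i]. Were they as many as U, then so would be the parameters, and U'' is no larger than U. *)
Lemma small_base_params (P : forall s, U2 s -> Prop) :
  small P -> small (base_params (G := G) (i := i) P).
Proof.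
move=> smP [f [fI fP]]; apply: smP.
pose TP := {a : Defs.total U2 | P (projT1 a) (projT2 a)}.
suff [g gI] : inj (Defs.total U) TP.
  have [h hI] := inj_total_cover_ind.
  exists (fun t => sval (g (h t))); split; last by move=> t; exact: (svalP (g (h t))).
  by move=> t t' /sval_inj_prop /gI /hI.
pose cu (t : Defs.total U2) : seq (Defs.total U) := match t with
  | existT (inl s) a => [:: existT _ s a]
  | existT (inr tt) o => tlist (sval o)
  end.
have cuE s (a : U2 s) x : urep x a -> cu (existT _ s a) = tlist x.
  by case: s a x => [s|[]] a x /= ->.
(* An element is found from a parameter and a position in its list of coordinates, or from a
   position in [i] alone. *)
have h1 : inj (Defs.total U) (TP * nat + nat).
  apply: (@inj_rel _ _ (fun u t => match t with
    | inl (a, k) => List.nth_error (cu (sval a)) k = Some (f u)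
    | inr k => List.nth_error (tlist i) k = Some (f u) end)).
    move=> u; have fu := fP u.
    have -> : f u = existT _ (projT1 (f u)) (projT2 (f u)) by case: (f u).
    case: fu => [[s [a [x [y [Pa c <-]]]]]|[y <-]].
      have [k hk] := tlist_get y x; rewrite -(cuE _ _ _ c) in hk.
      pose t : TP := exist (fun t : Defs.total U2 => P (projT1 t) (projT2 t)) (existT _ s a) Pa.
      by exists (inl (t, k)).
    by have [k hk] := tlist_get y i; exists (inr k).
  move=> u u' [[a k]|k] -> [] /fI //.
have key X : inj nat X -> inj TP X -> inj (Defs.total U) X.
  move=> hn hX; have hid : inj X X by exists id.
  apply: inj_trans h1 _; apply: inj_trans (inj_sum (inj_prod hX hn) hn) _.
  exact: inj_trans (inj_sum (inj_square hn) hid) (inj_double_infinite hn).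
(* An infinite parameter set absorbs the factor and the summand [nat]; a countable one would make U
   countable. *)
have [hn|hT] := inj_nat_dichotomy TP; first by apply: key => //; exists id.
by case: total_not_countable; apply: key => //; exists id.
Qed.

End Smallness.

Theorem theorem3p14 (L : language) (T : theory L) (U : structure L)
    (hT : complete T) (hEI : elim_imaginaries T) (hU : monster T U)
    (wI wM wO : seq (srt L))
    (G : gpd (tup U wI) (tup U wM) (tup U wO))
    (hG : is_groupoid G) (hdef : def0_gpd G)
    (hff : finitely_faithful G) (hconn : connected G)
    (i : tup U wI) (hi : obj G i) :
  [/\ internal_generalised_imaginary_sort (cover_ind G i),
      is_groupoid (gpd_star G i) /\ star_def0_in_eq G i
    & star_action_iso G i].
Proof.
have [_ sU bigU] := hU; have [[hobj hmor hpts] [_ hpr hact]] := hdef.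
have [s0 hs0] := two_element_sort bigU.
(* The point [a0] keeps the code nonempty in case the base [l] is empty. *)
have [l [hl ff]] := hff i hi; have [a0 ha0] := pr_surj hG hi.
have hg := hGs hG hi.
(* The base is placed at the old object [O_i], whose automorphisms in G' are exactly those in [G],
   so finite faithfulness of [G] applies as it stands. *)
pose l' : seq (ccar G i SO) := map inl l.
have hcodes : forall m, mor (Gs G i) m ->
    exists z : tup (ccar G i) (prs SO (size l').+1), codes (Gs G i) z m.
  have inl' a : List.In a (inl a0 :: l') -> exists2 b, a = inl b & b = a0 \/ List.In b l.
    case=> [<-|/List.in_map_iff [b [<- hb]]]; first by exists a0; [|left].
    by exists b; [|right].
  apply: (codes_surj hg (i0 := inl i) (l := l') (a0 := inl a0)) => //.
    by move=> a /inl' [b -> [->|/hl]].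
  move=> [m|[[m k] h]] //= s fx [a|a] //= ha.
  apply: (ff m s) => // b hb; apply: (fx (inl b)); right.
  by apply/List.in_map_iff; exists b.
have [phiQ hphiQ] := Q_def0 i s0 hact (size l').+2.
split; [|split|].
- exists tt; split; first by case.
  split.
  + apply: (cover_ind_saturated hG hi hs0 hpr hact hphiQ hcodes sU).
    by move=> P; exact: (small_base_params bigU).
  + exact: (cover_ind_stably_embedded hG hi hs0 hpr hact hphiQ hcodes).
  + exact: (cover_ind_internal hG hi hs0 hphiQ hcodes hpr).
  + exact: (cover_ind_fg hG hi hs0 hphiQ hcodes).
- exact: star_is_groupoid.
- exact: (cover_ind_eq_def0 hG hi hs0 hphiQ hcodes).
- exact: (cover_ind_iso hG hi hs0 hphiQ hcodes).
Qed.
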